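(* Let $T\subset[0,\infty)$ be locally finite and suppose that the natural density $d(T)=\lim_{R\to\infty}\frac{N_T(R)}{R}$ exists in $[0,\infty]$, where $N_T(R)=\#(T\cap[0,R])$. Then $T\in\mathfrak U$ if and only if $0\in T$ and $0<d(T)<\infty$.
   Context: $\mathbb N=\{0,1,2,\dots\}$. A set $T\subset[0,\infty)$ is locally finite if $T\cap[0,R]$ is finite for every $R>0$. For a positive operator $A$ on a Hilbert space, $A^t$ is defined by continuous functional calculus for $t>0$ and $A^0=I$. The family $\{CA^t\}_{t\in T}$ is exactly observable if there are $0<a\le b<\infty$ with $a\|x\|^2\le\sum_{t\in T}\|CA^tx\|^2\le b\|x\|^2$ for all $x\in H$. $\mathfrak U$ is the class of universal time sets: locally finite $T\subset[0,\infty)$ such that for all separable complex Hilbert spaces $H,Y$, every positive $A\in\mathcal B(H)$ and every $C\in\mathcal B(H,Y)$, exact observability of $\{CA^n\}_{n\in\mathbb N}$ implies exact observability of $\{CA^t\}_{t\in T}$. *)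

(* Defs.v *)
From HB Require Import structures.
From mathcomp Require Import all_boot all_order all_algebra sesquilinear finmap.
From mathcomp.real_closed Require Export complex.
From mathcomp Require Import all_classical all_reals all_analysis.

Set Implicit Arguments.
Unset Strict Implicit.
Unset Printing Implicit Defensive.

Import Order.TTheory GRing.Theory Num.Theory.
Import numFieldNormedType.Exports.

Local Open Scope classical_set_scope.
Local Open Scope ring_scope.

(* The inner product is linear in its first argument and conjugate-linear in
   the second one. *)
HB.mixin Record CompleteNormedModule_isHilbert (R : realType) V
    & CompleteNormedModule R[i] V := {
  hdot : {dot V for @Num.conj R[i]};
  hnormE : forall x : V, `|x| ^+ 2 = hdot x x }.

#[short(type="hilbertType")]
HB.structure Definition Hilbert (R : realType) :=
  {V of CompleteNormedModule R[i] V & CompleteNormedModule_isHilbert R V}.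

Definition separable (T : topologicalType) : Prop :=
  exists2 D : set T, countable D & dense D.

(* The library norm of a normed module over R[i] takes its values in the
   nonnegative real elements of R[i]. *)
Definition rnorm (R : realType) (V : normedModType R[i]) (x : V) : R :=
  complex.Re `|x|.

Section FunctionalCalculus.
Context {R : realType}.
Implicit Type H : hilbertType R.

(* In the order of R[i], 0 <= z entails that z is real. *)
Definition positive_op H (A : {linear H -> H}) : Prop :=
  continuous A /\ forall x : H, 0 <= hdot (A x) x.

Definition spectrum H (A : {linear H -> H}) : set R[i] :=
  [set z | ~ exists B : {linear H -> H},
     [/\ continuous B, cancel (fun x => A x - z *: x) B
       & cancel B (fun x => A x - z *: x)]].

Definition poly_op H (p : {poly R[i]}) (A : {linear H -> H}) : H -> H :=
  fun x => \sum_(i < size p) p`_i *: iter i A x.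

(* The continuous functional calculus of a self-adjoint operator A: f(A) is the
   limit, in operator norm, of p_n(A), where p_n are polynomials converging
   to f uniformly on the spectrum of A. *)
Definition is_cfc H (A : {linear H -> H}) (f : R[i] -> R[i]) (B : H -> H) :=
  exists p : nat -> {poly R[i]}, forall e : R[i], 0 < e ->
    (\forall n \near \oo, forall z, spectrum A z -> `|(p n).[z] - f z| <= e) /\
    (\forall n \near \oo, forall x : H,
        `|poly_op (p n) A x - B x| <= e * `|x|).

Definition cfc H (A : {linear H -> H}) (f : R[i] -> R[i]) : H -> H :=
  xget (fun=> 0) (is_cfc A f).

(* Meant for positive A and 0 <= t: the spectrum of A then consists of
   nonnegative reals, on which z |-> (Re z)^t is the usual power. *)
Definition op_powR H (A : {linear H -> H}) (t : R) : H -> H :=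
  if t == 0 then id else cfc A (fun z => ((complex.Re z) `^ t)%:C%C).

Definition exactly_observable (H Y : hilbertType R) (C : {linear H -> Y})
    (A : {linear H -> H}) (T : set R) : Prop :=
  exists a b : R, [/\ 0 < a, a <= b & forall x : H,
    ((a * rnorm x ^+ 2)%:E <= \esum_(t in T) (rnorm (C (op_powR A t x)) ^+ 2)%:E
      <= (b * rnorm x ^+ 2)%:E)%E].

End FunctionalCalculus.

Section TimeSets.
Context {R : realType}.
Implicit Type T : set R.

Definition locally_finite T : Prop :=
  forall r : R, 0 < r -> finite_set (T `&` `[0, r]).

Definition universal_time_set T : Prop :=
  [/\ T `<=` `[0, +oo[, locally_finite T &
    forall (H Y : hilbertType R) (A : {linear H -> H}) (C : {linear H -> Y}),
      separable H -> separable Y -> positive_op A -> continuous C ->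
      exactly_observable C A (range (fun n : nat => n%:R)) ->
      exactly_observable C A T].

(* For locally finite T; fset_set of an infinite set is empty. *)
Definition counting_fun T (r : R) : nat := #|` fset_set (T `&` `[0, r]) |%fset.

End TimeSets.

(* Main.v *)
(* Sufficiency. Observability over the naturals makes [A] a contraction and gives
   [||C A^n|| <= sqrt (b / n)]. A dyadic partition of unity [1 = sum_j phi_j psi_j] in
   polynomials of [A] then shows that the observations [C A^s x] and [C A^t x] at times
   of [[2^i, 2^(i+1)]] with [|s - t| <= 2^i / M] differ by an amount whose square,
   weighted by [2^i] and summed over [i], is of order [||x||^2 / M^2]. As every such
   window contains about [d 2^i / M] points of [T], sums of [||C A^t x||^2] over late
   times of [T] and of the naturals are comparable up to a small multiple of [||x||^2].
   For the lower bound, the finitely many early natural times are recovered from [T]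
   by the Muntz theorem on [[0, 1]], as [sum_T 1/t] diverges, except time 0, which has
   to belong to [T].
   Necessity. In l^2 take [A] diagonal with entries [lam_0 = 0], [lam_k = 2^(-1/(2k))]
   and [C = sqrt (1 - A^2)], for which the sum over the naturals is [||x||^2]. Testing
   on the k-th basis vector gives uniform bounds for
   [(1 - 2^(-1/k)) sum_T 2^(-t/k)], which exclude the densities 0 and infinity; [k = 0]
   forces [0] to be in [T]. *)
From HB Require Import structures.
Require Import Defs.
From mathcomp Require Import all_boot all_order all_algebra sesquilinear finmap.
From mathcomp Require Import all_classical all_reals all_analysis ring lra.
Import Order.TTheory GRing.Theory Num.Theory.
Import numFieldNormedType.Exports.
Import Normc.
Set Implicit Arguments.
Unset Strict Implicit.
Unset Printing Implicit Defensive.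
Local Open Scope classical_set_scope.
Local Open Scope ring_scope.

(** * Real norms and inner products *)

(** A density says nothing below scales proportional to [2^i], so late times can only be matched up
    to [2^i / M]. The decay of [C A^n] alone bounds [||C A^s x - C A^t x||^2] by a multiple of
    [||x||^2 / (M^2 2^i)]; weighted by the [2^i] points of the window this is the same for every
    [i], and the sum over [i] diverges. The partition of unity repairs this: the part of [x] living
    where [1 - l] has size [2^-j] reaches window [i] only with a factor [2^(-|i-j|/2)], so a Schur
    test makes the sum over [i] finite. The comparison constant does not depend on [M], hence [M]
    can be taken so large that the error is absorbed in [a ||x||^2]; only the times below the
    resulting scale are left to Muntz. The functional calculus is used without spectral measures. It
    rests on the bound of [||p(A)||] by the supremum of [|p|] over the spectrum, obtained from
    resolvents, while a Lax-Milgram argument locates the spectrum in the reals. *)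

Section Rnorm.
Context {R : realType}.
Implicit Types V : normedModType R[i].

Lemma realCM (a b : R) : (a * b)%:C%C = a%:C%C * b%:C%C.
Proof. exact: rmorphM. Qed.

Lemma realCD (a b : R) : (a + b)%:C%C = a%:C%C + b%:C%C.
Proof. exact: rmorphD. Qed.

Lemma normE_rnorm V (x : V) : `|x| = (rnorm x)%:C%C.
Proof. by rewrite /rnorm (RRe_real (normr_real x)). Qed.

Lemma rnorm_ge0 V (x : V) : 0 <= rnorm x.
Proof. by rewrite -ler0c -normE_rnorm. Qed.

Lemma rnorm_eq0 V (x : V) : rnorm x = 0 -> x = 0.
Proof. by move=> x0; apply/normr0_eq0; rewrite normE_rnorm x0. Qed.

Lemma rnorm0 V : rnorm (0 : V) = 0.
Proof. by rewrite /rnorm normr0. Qed.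

Lemma rnormN V (x : V) : rnorm (- x) = rnorm x.
Proof. by rewrite /rnorm normrN. Qed.

Lemma rnormZ V z (x : V) : rnorm (z *: x) = normc z * rnorm x.
Proof.
by apply: complexI; rewrite -normE_rnorm normrZ normE_rnorm realCM.
Qed.

Lemma ler_rnormD V (x y : V) : rnorm (x + y) <= rnorm x + rnorm y.
Proof. by rewrite -lecR realCD -!normE_rnorm ler_normD. Qed.

Lemma ler_rnormB V (x y : V) : rnorm (x - y) <= rnorm x + rnorm y.
Proof. by rewrite (le_trans (ler_rnormD _ _))// rnormN. Qed.

Lemma rdistC V (x y : V) : rnorm (x - y) = rnorm (y - x).
Proof. by rewrite -rnormN opprB. Qed.

Lemma ler_rnorm_sum V I (r : seq I) (P : pred I) (F : I -> V) :
  rnorm (\sum_(i <- r | P i) F i) <= \sum_(i <- r | P i) rnorm (F i).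
Proof.
elim/big_rec2: _ => [|i y x _ xy]; first by rewrite rnorm0.
by rewrite (le_trans (ler_rnormD _ _))// lerD2l.
Qed.

Lemma normc_real (r : R) : normc r%:C%C = `|r|.
Proof. by rewrite /normc/= expr0n/= addr0 sqrtr_sqr. Qed.

Lemma normcE (z : R[i]) : (normc z)%:C%C = `|z|.
Proof. by []. Qed.

Lemma normc_ge0 (z : R[i]) : 0 <= normc z.
Proof. by case: z => a b; rewrite sqrtr_ge0. Qed.

Lemma linear_boundP (V W : normedModType R[i]) (f : {linear V -> W}) :
  continuous f <-> exists2 b : R, 0 <= b & forall x, rnorm (f x) <= b * rnorm x.
Proof.
split=> [/linear_bounded_continuous/linear_boundedP/pinfty_ex_gt0[M M0 Mf]|].
  exists (complex.Re M) => [|x].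
    by rewrite -ler0c RRe_real ?ltW// gtr0_real.
  by rewrite -lecR realCM -!normE_rnorm [X in X * _]RRe_real ?gtr0_real.
move=> [b b0 bf]; apply/linear_bounded_continuous/linear_boundedP.
near=> r => x.
apply: (@le_trans _ _ (b%:C%C * `|x|)).
  by rewrite !normE_rnorm -realCM lecR bf.
by rewrite ler_wpM2r//; near: r; apply: nbhs_pinfty_ge; rewrite complex_real.
Unshelve. all: by end_near. Qed.

Lemma cauchy_rnorm (V : completeNormedModType R[i]) (u : nat -> V) :
  (forall e : R, 0 < e -> exists N, forall m n, (N <= m)%N -> (N <= n)%N ->
     rnorm (u m - u n) <= e) ->
  exists l : V, forall e : R, 0 < e -> exists N, forall n, (N <= n)%N ->
     rnorm (u n - l) <= e.
Proof.
move=> cu; suff /cvg_ex[l ul] : cvgn u.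
  exists l => e e0; have eC0 : (0 : R[i]) < e%:C%C by rewrite ltcR.
  have /cvgrPdist_le/(_ _ eC0)[N _ Nu] := ul; exists N => n /Nu /=.
  by rewrite normE_rnorm lecR rdistC.
apply/cauchy_cvgP/cauchy_ballP => e e0.
have [r er] : exists r, e = r%:C%C by apply/complex_realP/gtr0_real.
move: e0; rewrite {}er ltcR => r0; have [|N Nu] := cu (r / 2).
  by rewrite divr_gt0.
near_simpl; exists ([set n | (N <= n)%N], [set n | (N <= n)%N]).
  by split; exists N.
move=> [m n] [/= Nm Nn]; rewrite -ball_normE /ball_/= normE_rnorm ltcR.
by rewrite (le_lt_trans (Nu _ _ Nm Nn))// ltr_pdivrMr// ltr_pMr// ltr1n.
Qed.

Lemma ball_rnorm V (x y : V) (e : R) : ball x e%:C%C y <-> rnorm (x - y) < e.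
Proof. by rewrite -ball_normE /ball_/= normE_rnorm ltcR. Qed.

End Rnorm.

Lemma expr_small (R : realType) (q e : R) : 0 <= q -> q < 1 -> 0 < e ->
  exists N, forall n, (N <= n)%N -> q ^+ n <= e.
Proof.
move=> q0 q1 e0; have /cvgrPdist_le/(_ _ e0)[N _ Nq] : q ^+ n @[n --> \oo] --> 0.
  by apply: cvg_expr; rewrite ger0_norm.
exists N => n /Nq /=; rewrite sub0r normrN ger0_norm//; exact: exprn_ge0.
Qed.

Lemma geometric_cauchy (R : realType) (V : completeNormedModType R[i]) (u : nat -> V)
    (K q : R) : 0 <= K -> 0 <= q -> q < 1 ->
  (forall n, rnorm (u n.+1 - u n) <= K * q ^+ n) ->
  exists l : V, forall e : R, 0 < e -> exists N, forall n, (N <= n)%N ->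
     rnorm (u n - l) <= e.
Proof.
move=> K0 q0 q1 uq; apply: cauchy_rnorm => e e0.
have q1' : 0 < 1 - q by rewrite subr_gt0.
have uD n k : rnorm (u (n + k)%N - u n) <= K * q ^+ n * (1 - q ^+ k) / (1 - q).
  elim: k => [|k IH].
    by rewrite addn0 !subrr rnorm0 mulr0 mul0r.
  rewrite addnS -(subrKA (u (n + k)%N)).
  rewrite (le_trans (ler_rnormD _ _))// (le_trans (lerD (uq _) IH))//.
  rewrite ler_pdivlMr// mulrDl divfK ?gt_eqF// exprD exprS le_eqVlt.
  by apply/orP; left; apply/eqP; ring.
have [N Nq] := expr_small q0 q1 (e := e * (1 - q) / (K + 1)) ltac:(by
  rewrite divr_gt0// ?mulr_gt0// ltr_wpDl).
exists N => m n Nm Nn; wlog mn : m n Nm Nn / (n <= m)%N.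
  by move=> W; have [/W->//|/ltnW/W] := leqP n m; rewrite rdistC; exact.
rewrite -(subnKC mn) (le_trans (uD _ _))// ler_pdivrMr//.
rewrite (@le_trans _ _ (K * q ^+ n))//.
  rewrite ler_piMr ?mulr_ge0 ?exprn_ge0// lerBlDr lerDl exprn_ge0//.
rewrite (le_trans (ler_wpM2l K0 (Nq _ Nn)))// mulrCA ler_piMr//.
  by rewrite mulr_ge0 ?ltW.
by rewrite ler_pdivrMr ?mul1r ?lerDl// ltr_wpDl.
Qed.

Section Hilbert.
Context {R : realType}.
Implicit Type H : hilbertType R.

Definition rdot H (x y : H) : R := complex.Re (hdot x y).

Lemma hdotC H (x y : H) : hdot x y = (hdot y x)^*%C.
Proof. by rewrite hermC expr0 mul1r. Qed.

Lemma rdotC H (x y : H) : rdot x y = rdot y x.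
Proof. by rewrite /rdot hdotC; case: (hdot y x). Qed.

Lemma rdotDl H (x y z : H) : rdot (x + y) z = rdot x z + rdot y z.
Proof. by rewrite /rdot linearDl raddfD. Qed.

Lemma rdotDr H (x y z : H) : rdot z (x + y) = rdot z x + rdot z y.
Proof. by rewrite !(rdotC z) rdotDl. Qed.

Lemma rdotZl H c (x y : H) : rdot (c *: x) y = rdot x (c^*%C *: y).
Proof.
by rewrite /rdot linearZl_LR linearZr_LR /=; congr (complex.Re (_ * _)); rewrite -[LHS]conjcK.
Qed.

Lemma ReZ (r : R) (z : R[i]) : complex.Re (r%:C%C * z) = r * complex.Re z.
Proof. by case: z => a b /=; rewrite mul0r subr0. Qed.

Lemma rdotrZl H (r : R) (x y : H) : rdot (r%:C%C *: x) y = r * rdot x y.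
Proof.
rewrite /rdot linearZl_LR -ReZ; congr complex.Re.
Qed.

Lemma rdotrZr H (r : R) (x y : H) : rdot x (r%:C%C *: y) = r * rdot x y.
Proof. by rewrite rdotC rdotrZl rdotC. Qed.

Lemma rdotNl H (x y : H) : rdot (- x) y = - rdot x y.
Proof. by rewrite /rdot linearNl raddfN. Qed.

Lemma rdotNr H (x y : H) : rdot x (- y) = - rdot x y.
Proof. by rewrite rdotC rdotNl rdotC. Qed.

Lemma rnorm_sqr H (x : H) : rnorm x ^+ 2 = rdot x x.
Proof. by rewrite /rdot -hnormE normE_rnorm !expr2 -realCM. Qed.

Lemma rnormD_sqr H (x y : H) :
  rnorm (x + y) ^+ 2 = rnorm x ^+ 2 + 2 * rdot x y + rnorm y ^+ 2.
Proof.
by rewrite !rnorm_sqr rdotDl !rdotDr (rdotC y x); ring.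
Qed.

Lemma rnormB_sqr H (x y : H) :
  rnorm (x - y) ^+ 2 = rnorm x ^+ 2 - 2 * rdot x y + rnorm y ^+ 2.
Proof. by rewrite rnormD_sqr rnormN rdotNr mulrN. Qed.

Lemma ler_rdot H (x y : H) : rdot x y <= rnorm x * rnorm y.
Proof.
have : rnorm (x + y) ^+ 2 <= (rnorm x + rnorm y) ^+ 2.
  by rewrite lerXn2r ?nnegrE ?addr_ge0 ?rnorm_ge0 ?ler_rnormD.
by rewrite rnormD_sqr sqrrD; lra.
Qed.

Lemma ler_abs_rdot H (x y : H) : `|rdot x y| <= rnorm x * rnorm y.
Proof. by rewrite ler_norml ler_rdot andbT lerNl -rdotNl -(rnormN x) ler_rdot. Qed.

End Hilbert.

(** * Spectrum and polynomial calculus of positive operators *)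

Section Inverse.
Context {R : realType} (H : hilbertType R).

(* The iteration [u |-> u - k t (f u - y)] is a contraction for small [k > 0]. *)
Lemma coercive_surjective (f : H -> H) (t : R[i]) (M d : R) (y : H) :
  linear f -> 0 < d -> (forall x, rnorm (t *: f x) <= M * rnorm x) ->
  (forall x, d * rnorm x ^+ 2 <= rdot (t *: f x) x) -> exists x, f x = y.
Proof.
move=> lf d0 fM fd.
pose f' : {linear H -> H} := HB.pack f (GRing.isLinear.Build _ _ _ _ f lf).
have fB x x' : f (x - x') = f x - f x' by exact: (linearB f').
have f0 : f 0 = 0 by rewrite -[X in f X](subrr 0) fB subrr.
(* For [t = 0] coercivity forces the space to be trivial. *)
have [t0|t0] := eqVneq t 0.
  have y0 : rnorm y ^+ 2 <= 0.
    have := fd y; rewrite t0 scale0r rdotC -(scale0r y) (rdotrZr 0) mul0r.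
    by rewrite pmulr_rle0.
  exists 0; rewrite f0; apply/esym/rnorm_eq0/eqP.
  by rewrite -sqrf_eq0 eq_le y0 sqr_ge0.
(* The bound is enlarged so that [d <= M']. The squared contraction factor is at most
   [1 - 2 k d + k^2 M'^2], which this [k] minimises, with value [q2]. *)
pose M' := `|M| + d; pose k := d / M' ^+ 2.
have M'0 : 0 < M' by rewrite ltr_wpDl.
have k0 : 0 < k by rewrite divr_gt0 ?exprn_gt0.
have {}fM x : rnorm (t *: f x) <= M' * rnorm x.
  rewrite (le_trans (fM x))// ler_wpM2r ?rnorm_ge0//.
  by rewrite (le_trans (ler_norm M))// lerDl ltW.
pose q2 := 1 - (d / M') ^+ 2.
have dM : 0 <= d / M' <= 1.
  by apply/andP; split; [rewrite divr_ge0 ?ltW|rewrite ler_pdivrMr// mul1r lerDr].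
have q20 : 0 <= q2 by rewrite subr_ge0 expr_le1//; case/andP: dM.
have q21 : Num.sqrt q2 < 1.
  rewrite -[ltRHS]sqrtr1 ltr_sqrt// /q2 ltrBlDr ltrDl exprn_gt0 ?divr_gt0//.
pose g x := x - k%:C%C *: (t *: f x).
have gq x : rnorm (g x) <= Num.sqrt q2 * rnorm x.
  rewrite -ler_sqr ?nnegrE ?mulr_ge0 ?sqrtr_ge0 ?rnorm_ge0//.
  rewrite exprMn sqr_sqrtr// rnormB_sqr rdotrZr (rdotC x) rnormZ normc_real.
  rewrite (gtr0_norm k0) exprMn.
  have : rnorm (t *: f x) ^+ 2 <= M' ^+ 2 * rnorm x ^+ 2.
    by rewrite -exprMn lerXn2r ?nnegrE ?mulr_ge0 ?rnorm_ge0// ltW.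
  move/(ler_wpM2l (sqr_ge0 k)); have := ler_wpM2l (ltW k0) (fd x).
  have -> : q2 * rnorm x ^+ 2 = rnorm x ^+ 2 - 2 * (k * (d * rnorm x ^+ 2))
      + k ^+ 2 * (M' ^+ 2 * rnorm x ^+ 2).
    by rewrite /q2 /k; field; rewrite gt_eqF.
  by lra.
have gB x x' : g (x - x') = g x - g x'.
  by rewrite /g fB !scalerBr !opprD !opprK addrACA.
pose c := k%:C%C *: (t *: y); pose u n := iter n (fun x => g x + c) 0.
have uS n : u n.+2 - u n.+1 = g (u n.+1 - u n).
  by rewrite gB [u n.+2]/= [in X in _ - X]/u iterS opprD addrACA subrr addr0.
have uq n : rnorm (u n.+1 - u n) <= rnorm c * Num.sqrt q2 ^+ n.
  elim: n => [|n IH].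
    by rewrite /u/= /g f0 !scaler0 !subr0 add0r expr0 mulr1.
  rewrite uS (le_trans (gq _))// exprS mulrCA ler_wpM2l// sqrtr_ge0.
have [l ul] := geometric_cauchy (rnorm_ge0 c) (sqrtr_ge0 q2) q21 uq.
have gl : g l + c = l.
  apply/subr0_eq/rnorm_eq0/eqP; rewrite eq_le rnorm_ge0 andbT.
  apply/ler_addgt0Pr => e e0; rewrite add0r.
  have [//|N Nu] := ul (e / 2); first by rewrite divr_gt0.
  have -> : g l + c - l = (u N.+1 - l) - g (u N - l).
    by rewrite gB -[u N.+1]/(g (u N) + c) opprB [RHS]addrC -[g (u N) + c - l]addrA subrKA addrA.
  rewrite (le_trans (ler_rnormB _ _))// (splitr e) lerD ?Nu//.
  rewrite (le_trans (gq _))// (le_trans _ (Nu N _))//.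
  by rewrite ler_piMl ?rnorm_ge0 1?ltW.
exists l; apply/(scalerI t0)/(scalerI (a := k%:C%C)).
  by rewrite -[0]/(0%:C%C) (inj_eq (@complexI _)) gt_eqF.
apply/esym/subr0_eq/(addrI l); rewrite addr0 -[RHS]gl /g addrAC addrA.
by [].
Qed.

(** Lax-Milgram up to a scalar: injectivity and the bound of the inverse come from Cauchy-Schwarz.
    The factor [t] rotates [A - z] until its real part is coercive, so that one statement serves
    every [z] off the spectrum. *)
Lemma coercive_inverse (f : H -> H) (t : R[i]) (M d : R) :
  linear f -> 0 < d -> (forall x, rnorm (t *: f x) <= M * rnorm x) ->
  (forall x, d * rnorm x ^+ 2 <= rdot (t *: f x) x) ->
  exists B : {linear H -> H}, [/\ continuous B, cancel f B & cancel B f].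
Proof.
move=> lf d0 fM fd.
pose f' : {linear H -> H} := HB.pack f (GRing.isLinear.Build _ _ _ _ f lf).
have fb x : d * rnorm x <= normc t * rnorm (f x).
  have [x0|x0] := eqVneq (rnorm x) 0.
    by rewrite x0 mulr0 mulr_ge0 ?normc_ge0 ?rnorm_ge0.
  have xp : 0 < rnorm x by rewrite lt_def x0 rnorm_ge0.
  rewrite -(ler_pM2r xp) -mulrA -expr2 (le_trans (fd x))// -rnormZ.
  exact: ler_rdot.
have finj : injective f.
  move=> x y fxy; apply/subr0_eq/rnorm_eq0/eqP.
  rewrite eq_le rnorm_ge0 andbT -(pmulr_rle0 _ d0) (le_trans (fb _))//.
  by rewrite [f _](linearB f') [X in X - _]fxy subrr rnorm0 mulr0.
have fsurj y : exists x, f x = y by apply: (coercive_surjective y lf d0 fM fd).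
pose B0 y := sval (cid (fsurj y)).
have fB0 : cancel B0 f by move=> y; rewrite /B0; case: cid.
have lB0 : linear B0.
  by move=> a u v; apply: finj; rewrite lf !fB0.
pose B : {linear H -> H} := HB.pack B0 (GRing.isLinear.Build _ _ _ _ B0 lB0).
exists B; split=> //; last by move=> x; apply: finj; rewrite fB0.
apply/linear_boundP; exists (normc t / d).
  by rewrite divr_ge0 ?normc_ge0// ltW.
move=> y; rewrite mulrAC ler_pdivlMr// mulrC.
by rewrite (le_trans (fb _))// fB0.
Qed.

End Inverse.

Section Positive.
Context {R : realType} (H : hilbertType R).
Implicit Types (A : {linear H -> H}) (x y : H).

Lemma positive_rdot A x : positive_op A -> 0 <= rdot (A x) x.
Proof. by case=> _ /(_ x); rewrite lecE => /andP[]. Qed.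

(** Polarisation over the complex numbers: the imaginary part of [hdot (A u) u] vanishes for all
    [u], and at [u = x + i y] its cross terms are the two sides. *)
Lemma positive_sym A x y : positive_op A -> rdot (A x) y = rdot x (A y).
Proof.
move=> [_ Ap]; pose m (u v : H) := complex.Im (hdot u v).
have m0 u : m (A u) u = 0 by have := Ap u; rewrite lecE => /andP[/eqP].
have mD u v w : m (u + v) w = m u w + m v w by rewrite /m linearDl raddfD.
have mDr u v w : m w (u + v) = m w u + m w v by rewrite /m linearDr raddfD.
have mil u v : m ('i%C *: u) v = rdot u v.
  rewrite /m linearZl_LR; transitivity (complex.Im ('i%C * hdot u v)) => //.
  by rewrite mulrC ImiRe.
have mir u v : m u ('i%C *: v) = - rdot u v.
  rewrite /m hdotC; transitivity (- m ('i%C *: v) u).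
    by rewrite /m; case: (hdot _ _).
  by rewrite mil rdotC.
have ri u v : rdot ('i%C *: u) v = - m u v.
  rewrite /rdot linearZl_LR; transitivity (complex.Re ('i%C * hdot u v)) => //.
  by rewrite mulrC ReiNIm.
have := m0 (x + 'i%C *: y); rewrite linearD linearZ mD !mDr !mir mil m0 ri m0.
by move=> h; rewrite (rdotC x); lra.
Qed.

End Positive.

Section Spectrum.
Context {R : realType} (H : hilbertType R).
Implicit Types (A : {linear H -> H}) (x y : H).

Lemma rdot0l x : rdot 0 x = 0.
Proof. by rewrite -(scale0r x) (rdotrZl 0) mul0r. Qed.

Lemma rdot0r x : rdot x 0 = 0.
Proof. by rewrite rdotC rdot0l. Qed.

Lemma linear_bound A : continuous A ->
  exists2 b : R, 0 <= b & forall x, rnorm (A x) <= b * rnorm x.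
Proof. by move/linear_boundP. Qed.

(** Outside the segment, [A - z] becomes coercive after multiplication by [i Im z], by [1] or by
    [-1], according as [z] is not real, negative or above [M]. *)
Lemma spectrum_positive A (M : R) (z : R[i]) : positive_op A ->
  (forall x, rdot (A x) x <= M * rnorm x ^+ 2) -> spectrum A z ->
  0 <= complex.Re z <= M /\ z = (complex.Re z)%:C%C.
Proof.
move=> Apos AM Az.
have dotE (t : R[i]) x : rdot (t *: (A x - z *: x)) x =
    complex.Re (t * ((rdot (A x) x)%:C%C - z * (rnorm x ^+ 2)%:C%C)).
  rewrite {1}/rdot linearZl_LR; transitivity (complex.Re (t * hdot (A x - z *: x) x)) => //.
  congr (complex.Re (_ * _)); rewrite linearBl linearZl_LR; congr (_ - _).
    by rewrite RRe_real// ger0_real//; case: Apos.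
  by rewrite /= rnorm_sqr /rdot -hnormE RRe_real// realX// normr_real.
have coer (t : R[i]) (d : R) : 0 < d ->
    (forall x, d * rnorm x ^+ 2 <= rdot (t *: (A x - z *: x)) x) -> False.
  move=> d0 td; apply: Az; have [b b0 Ab] := linear_bound Apos.1.
  apply: (@coercive_inverse _ _ (fun x => A x - z *: x) t (normc t * (b + normc z)) d) => //.
    move=> c u v /=; rewrite linearP scalerDr scalerBr opprD addrACA; congr (_ - _ + _).
    by rewrite !scalerA mulrC.
  move=> x; rewrite rnormZ -mulrA ler_wpM2l ?normc_ge0//.
  by rewrite (le_trans (ler_rnormB _ _))// mulrDl rnormZ lerD.
have Im0 : complex.Im z = 0.
  apply/eqP; apply: contraT => z0.
  (* The form of [A] is real, so the real part of [i Im z (A - z)] is exactly [(Im z)^2] times the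
     identity. *)
  exfalso; apply: (@coer (0 +i* complex.Im z)%C (complex.Im z ^+ 2)).
    by rewrite lt_def sqr_ge0 sqrf_eq0 z0.
  move=> x; rewrite dotE; clear; case: z => a b /=.
  rewrite le_eqVlt; apply/orP; left; apply/eqP; ring.
have zE : z = (complex.Re z)%:C%C by apply/eqP; rewrite eq_complex/= Im0 !eqxx.
split=> //; apply/andP; split; rewrite leNgt; apply/negP => zlt.
- apply: (@coer 1 (- complex.Re z)); first by rewrite oppr_gt0.
  move=> x; rewrite dotE mul1r zE -realCM /=.
  by have := positive_rdot x Apos; lra.
- apply: (@coer (-1) (complex.Re z - M)); first by rewrite subr_gt0.
  move=> x; rewrite dotE mulN1r zE -realCM /=.
  by have := AM x; lra.
Qed.

End Spectrum.

Lemma realCN (R : realType) (a : R) : (- a)%:C%C = - a%:C%C.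
Proof. exact: rmorphN. Qed.

Lemma linear_for0 (K : pzRingType) (V W : lmodType K) (f : V -> W) :
  linear f -> f 0 = 0.
Proof. by move=> lf; have := lf (-1) 0 0; rewrite scaler0 addr0 scaleN1r addNr. Qed.

Section PolyOp.
Context {R : realType} (H : hilbertType R).
Variable A : {linear H -> H}.
Implicit Types (p q : {poly R[i]}) (x y : H).

Lemma poly_op_wide n p x : (size p <= n)%N ->
  poly_op p A x = \sum_(i < n) p`_i *: iter i A x.
Proof.
move=> pn; rewrite /poly_op (big_ord_widen n (fun i => p`_i *: iter i A x))//.
rewrite big_mkcond; apply: eq_bigr => i _; case: ifP => // /negbT.
by rewrite -leqNgt => ip; rewrite nth_default// scale0r.
Qed.

Lemma poly_op0 x : poly_op 0 A x = 0.
Proof. by rewrite /poly_op size_poly0 big_ord0. Qed.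

Lemma poly_opD p q x : poly_op (p + q) A x = poly_op p A x + poly_op q A x.
Proof.
rewrite !(@poly_op_wide (maxn (size p) (size q))) ?leq_maxl ?leq_maxr//.
  by rewrite -big_split/=; apply: eq_bigr => i _; rewrite coefD scalerDl.
exact: size_polyD.
Qed.

Lemma poly_opZ c p x : poly_op (c *: p) A x = c *: poly_op p A x.
Proof.
rewrite !(@poly_op_wide (size p)) ?size_scale_leq// scaler_sumr.
by apply: eq_bigr => i _; rewrite coefZ scalerA.
Qed.

Lemma poly_opB p q x : poly_op (p - q) A x = poly_op p A x - poly_op q A x.
Proof. by rewrite poly_opD -scaleN1r poly_opZ scaleN1r. Qed.

Lemma poly_opC c x : poly_op c%:P A x = c *: x.
Proof. by rewrite (@poly_op_wide 1) ?size_polyC_leq1// big_ord1 coefC. Qed.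

Lemma poly_opMX p x : poly_op (p * 'X) A x = poly_op p A (A x).
Proof.
rewrite (@poly_op_wide (size p).+1).
  rewrite big_ord_recl coefMX/= scale0r add0r; apply: eq_bigr => i _.
  by rewrite coefMX/= -iterSr.
have [->|p0] := eqVneq p 0; first by rewrite mul0r size_poly0.
by rewrite size_mulX.
Qed.

Lemma poly_op_is_linear p : linear (poly_op p A).
Proof.
move=> c x y; rewrite /poly_op scaler_sumr -big_split/=; apply: eq_bigr => i _.
have -> : iter i A (c *: x + y) = c *: iter i A x + iter i A y.
  by elim: (val i) => //= n ->; rewrite linearP.
by rewrite scalerDr !scalerA mulrC.
Qed.

Lemma poly_opM p q x : poly_op (p * q) A x = poly_op p A (poly_op q A x).
Proof.
have comm r y : poly_op r A (A y) = A (poly_op r A y).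
  rewrite /poly_op linear_sum; apply: eq_bigr => i _.
  by rewrite linearZ -iterSr.
elim/poly_ind: p x => [|p c IH] x; first by rewrite mul0r !poly_op0.
rewrite mulrDl !poly_opD mul_polyC poly_opZ poly_opC; congr (_ + _).
by rewrite mulrAC !poly_opMX IH comm.
Qed.

Lemma poly_opX n x : poly_op 'X^n A x = iter n A x.
Proof.
elim: n x => [|n IH] x; first by rewrite expr0 poly_opC scale1r.
by rewrite exprSr poly_opMX IH iterSr.
Qed.

Lemma poly_op1X x : poly_op 'X A x = A x.
Proof. exact: (poly_opX 1). Qed.

Lemma poly_op_eigen p x (l : R[i]) : A x = l *: x -> poly_op p A x = p.[l] *: x.
Proof.
move=> Ax; have it n : iter n A x = l ^+ n *: x.
  elim: n => [|n IH]; first by rewrite scale1r.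
  by rewrite iterS IH linearZ/= Ax scalerA exprSr.
rewrite /poly_op horner_coef scaler_suml; apply: eq_bigr => i _.
by rewrite it scalerA.
Qed.

Lemma poly_op_bounded p : continuous A ->
  exists2 b : R, 0 <= b & forall x, rnorm (poly_op p A x) <= b * rnorm x.
Proof.
move=> /linear_bound[b b0 Ab]; elim/poly_ind: p => [|p c [d d0 pd]].
  by exists 0 => // x; rewrite poly_op0 rnorm0 mul0r.
exists (d * b + normc c); first by rewrite addr_ge0 ?mulr_ge0 ?normc_ge0.
move=> x; rewrite poly_opD poly_opC poly_opMX mulrDl.
rewrite (le_trans (ler_rnormD _ _))// lerD ?rnormZ//.
by rewrite (le_trans (pd _))// -mulrA ler_wpM2l.
Qed.

Lemma poly_op_adjoint p x y : (forall x y, rdot (A x) y = rdot x (A y)) ->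
  rdot (poly_op p A x) y = rdot x (poly_op (map_poly conjc p) A y).
Proof.
move=> Asym; elim/poly_ind: p x y => [|p c IH] x y.
  by rewrite map_poly0 !poly_op0 rdot0l rdot0r.
rewrite rmorphD rmorphM/= map_polyX map_polyC/= !poly_opD !poly_opC.
rewrite rdotDl rdotDr rdotZl; congr (_ + _).
by rewrite poly_opMX IH Asym mulrC poly_opM poly_op1X.
Qed.

End PolyOp.

(** * Norm of a polynomial in a positive operator *)

Section SpectralBound.
Context {R : realType} (H : hilbertType R).
Variable A : {linear H -> H}.
Hypothesis Apos : positive_op A.
Implicit Types (p q : {poly R[i]}) (x y : H).

Let pos_le_bound : exists2 M : R, 0 <= M & forall x, rdot (A x) x <= M * rnorm x ^+ 2.
Proof.
have [M M0 AM] := linear_bound Apos.1; exists M => // x.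
by rewrite (le_trans (ler_rdot _ _))// expr2 mulrA ler_wpM2r ?rnorm_ge0.
Qed.

Lemma spectrum_real (z : R[i]) : spectrum A z ->
  0 <= complex.Re z /\ z = (complex.Re z)%:C%C.
Proof.
have [M M0 AM] := pos_le_bound.
by move=> /(spectrum_positive Apos AM)[/andP[]].
Qed.

Lemma not_spectrum_bounded_below (z : R[i]) : ~ spectrum A z ->
  exists2 k : R, 0 < k & forall x, k * rnorm x <= rnorm (A x - z *: x).
Proof.
move=> /contrapT[B [/linear_bound[b b0 Bb] AB BA]].
have b1 : 0 < b + 1 by rewrite ltr_wpDl.
exists (b + 1)^-1; first by rewrite invr_gt0.
move=> x; rewrite ler_pdivrMl// -[x in leLHS]AB (le_trans (Bb _))//.
by rewrite ler_wpM2r ?rnorm_ge0// lerDl.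
Qed.

(** [q] splits over the algebraically closed field [R[i]], and each factor [A - z] has a bounded
    inverse. *)
Lemma poly_bounded_below q : q != 0 -> (forall z, root q z -> ~ spectrum A z) ->
  exists2 k : R, 0 < k & forall x, k * rnorm x <= rnorm (poly_op q A x).
Proof.
have [rs ->] := closed_field_poly_normal q.
rewrite scaler_eq0 negb_or => /andP[c0 _] qs.
have {}qs z : z \in rs -> ~ spectrum A z.
  by move=> zrs; apply: qs; rewrite rootZ// root_prod_XsubC.
have nc0 : 0 < normc (lead_coef q).
  rewrite lt_def normc_ge0 andbT; apply/eqP => /eq0_normc.
  by apply/eqP.
suff [k k0 ks] : exists2 k : R, 0 < k & forall x, k * rnorm x <=
    rnorm (poly_op (\prod_(z <- rs) ('X - z%:P)) A x).
  exists (normc (lead_coef q) * k); first by rewrite mulr_gt0.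
  by move=> x; rewrite poly_opZ rnormZ -mulrA ler_wpM2l ?normc_ge0.
elim: rs qs => [|z rs IH] qs.
  by exists 1 => // x; rewrite big_nil poly_opC scale1r mul1r.
have [z' zr|k k0 ks] := IH; first by apply: qs; rewrite inE zr orbT.
have [d d0 ds] := not_spectrum_bounded_below (qs z (mem_head _ _)).
exists (d * k); first by rewrite mulr_gt0.
move=> x; rewrite big_cons poly_opM -mulrA.
apply: (le_trans (ler_wpM2l (ltW d0) (ks x))).
apply: (le_trans (ds _)); rewrite -polyCN poly_opD poly_opC scaleNr.
by rewrite poly_op1X.
Qed.

(** [p(A)] is normal: its adjoint is a polynomial in [A] too and commutes with it. *)
Let pnormal p x : rnorm (poly_op (map_poly conjc p) A x) = rnorm (poly_op p A x).
Proof.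
have Asym x y := @positive_sym _ _ A x y Apos.
apply/eqP; rewrite -(@eqrXn2 _ 2) ?rnorm_ge0// !rnorm_sqr.
rewrite [in X in _ == X]poly_op_adjoint// -poly_opM mulrC poly_opM.
by rewrite [eqbRHS]rdotC [eqbRHS]poly_op_adjoint.
Qed.

(* Let [m] be the supremum of [||p(A) x||^2] on the unit ball. If [m > c^2] then no
   root of [conj p * p - m] lies in the spectrum, so that [p(A)^* p(A) - m] is
   bounded below, which contradicts the choice of [m]. *)
Let poly_op_le_nonconst p (c : R) : (1 < size p)%N -> 0 <= c ->
  (forall z, spectrum A z -> normc p.[z] <= c) ->
  forall x, rnorm (poly_op p A x) <= c * rnorm x.
Proof.
move=> sp c0 pc.
have Asym x y := @positive_sym _ _ A x y Apos.
pose E := [set r | exists2 x, rnorm x <= 1 & r = rnorm (poly_op p A x) ^+ 2].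
have [b b0 pb] := poly_op_bounded p Apos.1.
have E0 : E 0.
  exists 0; rewrite ?rnorm0//; have /linear_for0 -> := poly_op_is_linear A p.
  by rewrite ?rnorm0 ?expr0n.
have supE : has_sup E.
  split; first by exists 0.
  exists (b ^+ 2) => _ [x x1 ->]; rewrite lerXn2r ?nnegrE ?rnorm_ge0//.
  by rewrite (le_trans (pb x))// ler_piMr.
pose m := sup E.
have m0 : 0 <= m by apply: ub_le_sup => //; case: supE.
have pm x : rnorm (poly_op p A x) ^+ 2 <= m * rnorm x ^+ 2.
  have [x0|x0] := eqVneq (rnorm x) 0.
    rewrite x0 expr0n mulr0 -(mul0r 0) -expr2.
    by rewrite lerXn2r ?nnegrE ?rnorm_ge0 ?(le_trans (pb x))// x0 mulr0.
  have xp : 0 < rnorm x by rewrite lt_def x0 rnorm_ge0.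
  rewrite -ler_pdivrMr ?exprn_gt0// -expr_div_n mulrC.
  apply: ub_le_sup; first by case: supE.
  have nV : normc ((rnorm x)^-1)%:C%C = (rnorm x)^-1.
    by rewrite normc_real ger0_norm ?invr_ge0 ?rnorm_ge0.
  exists ((rnorm x)^-1%:C%C *: x); first by rewrite rnormZ nV mulVf.
  have := poly_op_is_linear A p ((rnorm x)^-1%:C%C) x 0.
  have /linear_for0 -> := poly_op_is_linear A p; rewrite !addr0 => ->.
  by rewrite rnormZ nV.
have [mc|mc] := leP m (c ^+ 2).
  move=> x; rewrite -ler_sqr ?nnegrE ?mulr_ge0 ?rnorm_ge0// exprMn.
  by rewrite (le_trans (pm x))// ler_wpM2r ?sqr_ge0.
exfalso; pose q := map_poly conjc p * p - (m%:C%C)%:P.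
(* This is where [p] must be nonconstant: the degree of [conj p * p] is then positive. *)
have q0 : q != 0.
  rewrite subr_eq0; apply: contraTneq (size_polyC_leq1 m%:C%C) => <-.
  have p0 : p != 0 by rewrite -size_poly_gt0 ltnW.
  rewrite size_mul ?map_poly_eq0// size_map_poly.
  by case: (size p) sp => [|[|n]] // _; rewrite !addnS.
have qs z : root q z -> ~ spectrum A z.
  move=> qz Az; have [zr zE] := spectrum_real Az.
  have zJ : z^*%C = z by rewrite zE conjc_real.
  move: qz; rewrite /root !hornerE -[X in _.[X] * _]zJ horner_map/=.
  rewrite subr_eq0 mulrC -normCK => /eqP pz.
  have := pc _ Az; rewrite leNgt => /negP; apply.
  rewrite -ltr_sqr ?nnegrE ?normc_ge0//; move: mc; congr (_ < _).
  by apply: complexI; rewrite -pz expr2 realCM.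
have [k k0 ks] := poly_bounded_below q0 qs.
have mp : 0 < m by rewrite (le_lt_trans _ mc)// sqr_ge0.
(* Expanding [||q(A) x||^2] and using [||p(A)|| ^ 2 <= m] twice gives [k^2 ||x||^2 <= 2 m^2 ||x||^2
   - 2 m ||p(A) x||^2], so the supremum [m] can be lowered by [d]. *)
pose d := k ^+ 2 / (2 * m).
have d0 : 0 < d by rewrite divr_gt0 ?exprn_gt0 ?mulr_gt0.
have : m <= Num.max (m - d) 0.
  apply: ge_sup; first by exists 0.
  move=> _ [x x1 ->]; rewrite le_max; apply/orP.
  have : rnorm (poly_op p A x) ^+ 2 <= (m - d) * rnorm x ^+ 2.
    have : (k * rnorm x) ^+ 2 <= rnorm (poly_op q A x) ^+ 2.
      by rewrite lerXn2r ?nnegrE ?mulr_ge0 ?rnorm_ge0 ?(ltW k0).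
    rewrite /q -polyCN poly_opD poly_opC scaleNr rnormB_sqr rdotrZr rnormZ.
    rewrite normc_real ger0_norm// poly_opM pnormal.
    rewrite rdotC -[rdot x _]poly_op_adjoint// -rnorm_sqr => h1.
    have := pm (poly_op p A x); have := ler_wpM2l m0 (pm x).
    move=> pm1 pm2; rewrite -(ler_pM2l (x := 2 * m)) ?mulr_gt0//.
    have -> : 2 * m * ((m - d) * rnorm x ^+ 2) =
        2 * (m * (m * rnorm x ^+ 2)) - (k * rnorm x) ^+ 2.
      by rewrite /d; field; rewrite gt_eqF.
    by move: h1 pm1 pm2; lra.
  have [md|md] := leP (m - d) 0.
    move=> h; right; apply: (le_trans h).
    by rewrite mulr_le0_ge0 ?sqr_ge0.
  move=> h; left; apply: (le_trans h); rewrite ler_piMr ?(ltW md)//.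
  by rewrite expr_le1// rnorm_ge0.
by rewrite le_max leNgt gtrBl d0/= leNgt mp.
Qed.

(** On an empty spectrum the bound for the nonconstant polynomial ['X] holds with [c = 0]. Then
    [A = 0], which is not bounded below, so that [0] is in the spectrum after all. *)
Lemma spectrum_neq0 x : x != 0 -> spectrum A !=set0.
Proof.
move=> x0; apply: contrapT => /set0P/negP; rewrite negbK => /eqP sA.
have A0 y : A y = 0.
  apply/rnorm_eq0/eqP; rewrite eq_le rnorm_ge0 andbT -(mul0r (rnorm y)).
  rewrite -poly_op1X; apply: poly_op_le_nonconst => //; first by rewrite size_polyX.
  by rewrite sA.
have : ~ spectrum A 0 by rewrite sA.
move=> /not_spectrum_bounded_below[k k0 /(_ x)].
rewrite A0 scale0r subr0 rnorm0 pmulr_rle0// => x0'.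
move/eqP: x0; apply; apply/rnorm_eq0/eqP.
by rewrite eq_le x0' rnorm_ge0.
Qed.

Lemma poly_op_le p (c : R) :
  (forall z, spectrum A z -> normc p.[z] <= c) ->
  forall x, rnorm (poly_op p A x) <= c * rnorm x.
Proof.
move=> pc x; have [->|x0] := eqVneq x 0.
  have /linear_for0 -> := poly_op_is_linear A p.
  by rewrite rnorm0 mulr0.
(* A spectral point gives [0 <= c] and settles the constant polynomials, where the hypothesis could
   otherwise be vacuous. *)
have [z Az] := spectrum_neq0 x0.
have c0 : 0 <= c by rewrite (le_trans _ (pc z Az))// normc_ge0.
have [sp|sp] := ltnP 1 (size p); first exact: poly_op_le_nonconst.
have := pc _ Az; rewrite (size1_polyC sp) hornerC => pc'.
by rewrite poly_opC rnormZ ler_wpM2r ?rnorm_ge0.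
Qed.

End SpectralBound.

(** * Continuous functional calculus *)

Section Weierstrass.
Context {R : realType}.
Implicit Types (f g : nat -> R) (x : R).

Definition cont01 (h : R -> R) := {within `[0, 1], continuous h}.

Lemma cont01M (g h : R -> R) : cont01 g ->
  cont01 h -> cont01 (fun r => g r * h r).
Proof. by move=> gc hc r; apply: cvgM; [exact: gc|exact: hc]. Qed.

Lemma cont01D (g h : R -> R) : cont01 g ->
  cont01 h -> cont01 (fun r => g r + h r).
Proof. by move=> gc hc r; apply: cvgD; [exact: gc|exact: hc]. Qed.

Lemma cont01_cst (c : R) : cont01 (fun=> c).
Proof. by move=> r; exact: cvg_cst. Qed.

Lemma cont01_horner (p : {poly R}) : cont01 (horner p).
Proof. by apply: continuous_subspaceT; exact: continuous_horner. Qed.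

(** De Casteljau recursion, conditioning on the first of [n] trials: the value at [x] is the mean of
    [f] at a binomial variable with parameters [n] and [x]. *)
Fixpoint bernstein n f : {poly R} :=
  if n is n'.+1 then 'X * bernstein n' (f \o S) + (1 - 'X) * bernstein n' f
  else (f 0%N)%:P.

Lemma bernsteinS n f x : (bernstein n.+1 f).[x] =
  x * (bernstein n (f \o S)).[x] + (1 - x) * (bernstein n f).[x].
Proof. by rewrite /= !hornerE. Qed.

Lemma le_bernstein n f g x : 0 <= x <= 1 -> (forall k, (k <= n)%N -> f k <= g k) ->
  (bernstein n f).[x] <= (bernstein n g).[x].
Proof.
move=> /andP[x0 x1]; elim: n f g => [|n IH] f g fg.
  by rewrite /= !hornerC fg.
rewrite !bernsteinS lerD// ler_wpM2l ?subr_ge0// IH// => k kn; apply: fg => //.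
exact: leqW.
Qed.

(** The first two moments of the binomial law. *)
Lemma bernstein_quadratic n (a b c : R) x :
  (bernstein n (fun k => a + b * k%:R + c * k%:R ^+ 2)).[x] =
  a + b * (n%:R * x) + c * (n%:R * x + n%:R * (n%:R - 1) * x ^+ 2).
Proof.
elim: n a b c => [|n IH] a b c.
  by rewrite /= hornerC; ring.
rewrite bernsteinS IH.
have -> : (fun k : nat => a + b * k%:R + c * k%:R ^+ 2) \o S =
    (fun k => (a + b + c) + (b + 2 * c) * k%:R + c * k%:R ^+ 2).
  by apply/funext => k /=; rewrite -natr1; ring.
by rewrite IH -natr1; ring.
Qed.

Lemma segment_uniformly_continuous (h : R -> R) (e : R) :
  cont01 h -> 0 < e ->
  exists2 d : R, 0 < d & forall x y, 0 <= x <= 1 -> 0 <= y <= 1 -> `|x - y| < d ->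
    `|h x - h y| <= e.
Proof.
move=> hc e0.
(* Continuity is exploited on balls of twice the radius of the covering ones, so that two points
   closer than every chosen radius share one of them. *)
have loc x : exists d : R, 0 < d /\ (0 <= x <= 1 -> forall y, 0 <= y <= 1 ->
    `|x - y| < d *+ 2 -> `|h x - h y| <= e / 2).
  case: (pselect (0 <= x <= 1)) => [x01|]; last by exists 1.
  have xI : `[0, 1]%classic x by rewrite /= in_itv.
  have e2 : 0 < e / 2 by rewrite divr_gt0.
  have /subspace_continuousP/(_ x xI)/cvgrPdist_le/(_ _ e2) := hc.
  rewrite near_withinE => /nbhs_ballP[d /= d0 dP].
  exists (d / 2); split; first by rewrite divr_gt0.
  move=> _ y y01; rewrite mulr2n -splitr => xy.
  by apply: (dP y) => //; rewrite /= in_itv.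
pose d x := sval (cid (loc x)).
have d0 x : 0 < d x by rewrite /d; case: cid => ? [].
have dh x : 0 <= x <= 1 -> forall y, 0 <= y <= 1 ->
    `|x - y| < d x *+ 2 -> `|h x - h y| <= e / 2.
  by rewrite /d; case: cid => ? [].
have := @segment_compact R 0 1; rewrite compact_cover.
move=> /(_ R `[0, 1]%classic (fun x => ball x (d x))) [].
- by move=> x _; exact: ball_open.
- by move=> x x01; exists x => //; apply: ballxx.
move=> D D01 cov.
exists (\big[Num.min/1]_(x <- D) d x).
  by elim/big_ind: _ => // x y x0 y0; rewrite lt_min x0.
move=> x y x01 y01 xy.
have [|z /= zD zx] := cov x; first by rewrite /= in_itv.
have z01 : 0 <= z <= 1 by have := D01 _ zD; rewrite inE /= in_itv.
have zd : \big[Num.min/1]_(x <- D) d x <= d z by apply: ge_bigmin_seq.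
have h1 : `|h z - h x| <= e / 2.
  apply: dh => //; rewrite (lt_trans zx)// mulr2n ltrDl//.
have h2 : `|h z - h y| <= e / 2.
  apply: dh => //; rewrite -(subrKA x) (le_lt_trans (ler_normD _ _))// mulr2n.
  by rewrite ltrD// (lt_le_trans xy).
rewrite -(subrKA (h z)) (le_trans (ler_normD _ _))// (splitr e) lerD//.
by rewrite distrC.
Qed.

Lemma segment_bounded (h : R -> R) : cont01 h ->
  exists2 M : R, 0 <= M & forall x, 0 <= x <= 1 -> `|h x| <= M.
Proof.
move=> hc.
have [u _ uM] := EVT_max ler01 hc.
have hc' : cont01 (- h).
  by move=> x; apply: continuousN; exact: hc.
have [v _ vM] := EVT_max ler01 hc'.
exists (`|h u| + `|h v|) => [|x x01]; first by rewrite addr_ge0.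
rewrite ler_norml; have := uM x; have := vM x; rewrite /= in_itv/= => /(_ x01) h1 /(_ x01) h2.
rewrite lerNl; apply/andP; split.
  rewrite (le_trans h1)// (le_trans (ler_norm _))// normrN lerDr//.
by rewrite (le_trans h2)// (le_trans (ler_norm _))// lerDl.
Qed.

Theorem weierstrass (h : R -> R) (e : R) : cont01 h -> 0 < e ->
  exists p : {poly R}, forall x, 0 <= x <= 1 -> `|p.[x] - h x| <= e.
Proof.
move=> hc e0.
have [M M0 hM] := segment_bounded hc.
have [d d0 hd] := segment_uniformly_continuous hc (divr_gt0 e0 (ltr0n R 2)).
(* Since [x (1 - x) <= 1/4], the Chebyshev term [2 M / (d^2 N^2) * N x (1 - x)] is at most
   [M / (2 d^2 N)], hence at most [e / 2] for this [N]. *)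
pose N := (Num.truncn (M / (d ^+ 2 * e))).+1.
have NE : M / (d ^+ 2 * e) < N%:R.
  by rewrite truncnS_gt.
pose f k := h (k%:R / N%:R).
exists (bernstein N f) => x x01.
have N0 : 0 < N%:R :> R by rewrite ltr0n.
pose K := 2 * M / (d ^+ 2 * N%:R ^+ 2).
have K0 : 0 <= K by rewrite divr_ge0// mulr_ge0// ?ltW// exprn_gt0.
(* Either [k/N] is within [d] of [x], or the quadratic term alone exceeds [2 M]. *)
have fK k : (k <= N)%N -> `|f k - h x| <= e / 2 + K * (k%:R - N%:R * x) ^+ 2.
  move=> kN; have k01 : 0 <= (k%:R / N%:R : R) <= 1.
    by rewrite divr_ge0//= ler_pdivrMr// mul1r ler_nat.
  have [kx|kx] := ltP `|k%:R / N%:R - x| d.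
    rewrite (le_trans (hd _ _ k01 x01 kx))// lerDl.
    by rewrite mulr_ge0 ?sqr_ge0.
  apply: (@le_trans _ _ (2 * M)).
    rewrite (le_trans (ler_normB _ _))// mulr2n mulrDl mul1r lerD ?hM//.
  apply: ler_wpDl; first by rewrite ltW ?divr_gt0.
  have -> : k%:R - N%:R * x = N%:R * (k%:R / N%:R - x).
    by field; rewrite gt_eqF.
  rewrite -(real_normK (num_real (N%:R * _))) normrM (gtr0_norm N0) exprMn /K.
  have -> t : 2 * M / (d ^+ 2 * N%:R ^+ 2) * (N%:R ^+ 2 * t) = 2 * M * (t / d ^+ 2).
    by field; rewrite !gt_eqF.
  rewrite ler_peMr ?mulr_ge0// ler_pdivlMr ?exprn_gt0// mul1r.
  by rewrite lerXn2r ?nnegrE// ltW.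
have EB a : (bernstein N (fun k => a + K * (k%:R - N%:R * x) ^+ 2)).[x] =
    a + K * (N%:R * (x * (1 - x))).
  rewrite (_ : (fun k => _) = (fun k => (a + K * (N%:R * x) ^+ 2) +
    (- (2 * K * (N%:R * x))) * k%:R + K * k%:R ^+ 2)); last by apply/funext => k; ring.
  by rewrite bernstein_quadratic; ring.
have Ke : K * (N%:R * (x * (1 - x))) <= e / 2.
  have x4 : x * (1 - x) <= 1 / 4 by have := sqr_ge0 (x - 1 / 2); nra.
  rewrite (le_trans (ler_wpM2l K0 (ler_wpM2l (ltW N0) x4)))//.
  have -> : K * (N%:R * (1 / 4)) = M / (d ^+ 2 * e) / N%:R * (e / 2).
    by rewrite /K; field; rewrite !gt_eqF.
  by rewrite ler_piMl ?divr_ge0 ?ltW// ltr_pdivrMr// mul1r.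
have up : (bernstein N f).[x] <= h x + e / 2 + K * (N%:R * (x * (1 - x))).
  rewrite -EB; apply: le_bernstein => // k /fK.
  by rewrite ler_norml => /andP[_]; lra.
have lo : h x - e / 2 - K * (N%:R * (x * (1 - x))) <= (bernstein N f).[x].
  have EBN : (bernstein N (fun k => (h x - e / 2) + (- K) * (k%:R - N%:R * x) ^+ 2)).[x] =
      h x - e / 2 - K * (N%:R * (x * (1 - x))).
    rewrite (_ : (fun k => _) = (fun k => (h x - e / 2 - K * (N%:R * x) ^+ 2) +
      (2 * K * (N%:R * x)) * k%:R + (- K) * k%:R ^+ 2)); last by apply/funext => k; ring.
    by rewrite bernstein_quadratic; ring.
  rewrite -EBN; apply: le_bernstein => // k /fK.
  by rewrite ler_norml => /andP[+ _]; lra.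
by rewrite ler_norml; apply/andP; split; lra.
Qed.

End Weierstrass.

(** Only [e <= 1] has to be treated, so that in products of approximations the terms of order [e^2]
    can be bounded linearly in [e]. *)
Lemma eq_rnorm_small (R : realType) (V : normedModType R[i]) (u v : V) (K : R) :
  (forall e : R, 0 < e -> e <= 1 -> rnorm (u - v) <= e * K) -> u = v.
Proof.
move=> uv; apply/subr0_eq/rnorm_eq0/eqP; rewrite eq_le rnorm_ge0 andbT.
have K0 : 0 <= K by rewrite -(mul1r K) (le_trans _ (uv 1 _ _))// rnorm_ge0.
apply/ler_addgt0Pr => e e0; rewrite add0r.
have K1 : 0 < K + 1 by rewrite ltr_wpDl.
have := uv (Num.min 1 (e / (K + 1))); rewrite lt_min ltr01 divr_gt0// ge_min lexx.
move=> /(_ isT isT)/le_trans; apply.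
apply: (@le_trans _ _ (e / (K + 1) * K)).
  by rewrite ler_wpM2r// ge_min lexx orbT.
by rewrite mulrAC -mulrA ler_piMr ?(ltW e0)// ler_pdivrMr// mul1r lerDl.
Qed.

Lemma linear_forB (K : pzRingType) (V W : lmodType K) (f : V -> W) :
  linear f -> forall x y, f (x - y) = f x - f y.
Proof. by move=> lf x y; rewrite addrC -scaleN1r lf scaleN1r addrC. Qed.

Section Calculus.
Context {R : realType} (H : hilbertType R).
Variable A : {linear H -> H}.
Hypothesis Apos : positive_op A.
Implicit Types (x y : H).

(** [p] is compared through [poly_op_le] with an approximant of [f]; hence [f(A)] does not depend on
    the approximating sequence. *)
Lemma is_cfc_close f B (p : {poly R[i]}) (e : R) : is_cfc A f B ->
  (forall z, spectrum A z -> normc (p.[z] - f z) <= e) ->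
  forall x, rnorm (poly_op p A x - B x) <= e * rnorm x.
Proof.
move=> [q qB] pf x; apply/ler_addgt0Pr => d d0.
pose k := d / (2 * (rnorm x + 1)).
have x1 : 0 < rnorm x + 1 by rewrite ltr_wpDl ?rnorm_ge0.
have k0 : 0 < k by rewrite divr_gt0 ?mulr_gt0.
have kC : 0 < k%:C%C :> R[i] by rewrite ltcR.
have [qf qx] := qB _ kC; have [n _ /(_ n (leqnn n))[{}qf {}qx]] := filterI qf qx.
have nqx : rnorm (poly_op (q n) A x - B x) <= k * rnorm x.
  by rewrite -lecR realCM -!normE_rnorm qx.
have nqf z : spectrum A z -> normc ((q n).[z] - f z) <= k.
  by move=> Az; rewrite -lecR normcE qf.
have pq : rnorm (poly_op (p - q n) A x) <= (e + k) * rnorm x.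
  apply: poly_op_le => // z Az; rewrite hornerD hornerN -(subrKA (f z)).
  rewrite -lecR normcE (le_trans (ler_normD _ _))// realCD lerD//.
    by rewrite -normcE lecR pf.
  by rewrite distrC -normcE lecR nqf.
rewrite -(subrKA (poly_op (q n) A x)) (le_trans (ler_rnormD _ _))//.
rewrite -poly_opB (le_trans (lerD pq nqx))//.
have -> : d = k * (2 * (rnorm x + 1)) by rewrite divfK ?gt_eqF ?mulr_gt0.
by move: k0; clear; move: k (rnorm x) => k r; lra.
Qed.

Lemma is_cfc_poly f (p : {poly R[i]}) : (forall z, spectrum A z -> p.[z] = f z) ->
  is_cfc A f (poly_op p A).
Proof.
move=> pf; exists (fun=> p) => e e0; split; apply: nearW => _.
  by move=> z /pf ->; rewrite subrr normr0 ltW.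
by move=> x; rewrite subrr normr0 mulr_ge0// ltW.
Qed.

(** Both candidates are close to the same polynomial in [A], so the choice made by [xget] is
    immaterial. *)
Lemma cfc_unique f B : is_cfc A f B -> cfc A f = B.
Proof.
move=> fB; have fc : is_cfc A f (cfc A f) by apply: (xgetPex (fun=> 0)); exists B.
apply/funext => x; apply: (eq_rnorm_small (K := 2 * rnorm x)) => e e0 _.
have eC : 0 < e%:C%C :> R[i] by rewrite ltcR.
have [q qB] := fB; have [[n _ /(_ n (leqnn n)) qf] _] := qB _ eC.
have nqf z : spectrum A z -> normc ((q n).[z] - f z) <= e.
  by move=> Az; rewrite -lecR normcE qf.
have h1 := is_cfc_close fB nqf x; have h2 := is_cfc_close fc nqf x.
rewrite -(subrKA (poly_op (q n) A x)) (le_trans (ler_rnormD _ _))//.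
by rewrite mulrCA mulr2n mulrDl mul1r lerD// rdistC.
Qed.

Lemma op_powR_nat n : op_powR A n%:R = iter n A.
Proof.
rewrite /op_powR pnatr_eq0; case: eqP => [->//|/eqP n0].
rewrite (@cfc_unique _ (poly_op 'X^n A)); first by apply/funext => x; exact: poly_opX.
apply: is_cfc_poly => z /(spectrum_real Apos)[z0 zE].
rewrite hornerXn powR_mulrn// {1}zE; symmetry; exact: rmorphXn.
Qed.

End Calculus.

(** * Calculus of real continuous functions on the unit interval *)

Section UnitCalculus.
Context {R : realType} (H : hilbertType R).
Variable A : {linear H -> H}.
Hypothesis Apos : positive_op A.
Hypothesis A1 : forall x, rdot (A x) x <= rnorm x ^+ 2.
Implicit Types (x y : H) (g h : R -> R) (p q : {poly R}).

Definition rpoly p : {poly R[i]} := map_poly (real_complex R) p.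

(** The spectrum being real, a function of the real part is enough. For [t != 0] the operator
    [op_powR A t] is [fcalc] of the power function by unfolding. *)
Definition fcalc g : H -> H := cfc A (fun z => (g (complex.Re z))%:C%C).

Let spectrum01 (z : R[i]) : spectrum A z ->
  0 <= complex.Re z <= 1 /\ z = (complex.Re z)%:C%C.
Proof. by apply: spectrum_positive => // x; rewrite mul1r. Qed.

Lemma rpolyE p (r : R) : (rpoly p).[r%:C%C] = (p.[r])%:C%C.
Proof. exact: horner_map. Qed.

Lemma rpoly_le p (c : R) : (forall r, 0 <= r <= 1 -> `|p.[r]| <= c) ->
  forall x, rnorm (poly_op (rpoly p) A x) <= c * rnorm x.
Proof.
move=> pc; apply: poly_op_le => // z /spectrum01[z01 ->].
by rewrite rpolyE normc_real pc.
Qed.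

(** Weierstrass approximants with error [1/(n+1)] are Cauchy in operator norm by [rpoly_le], so
    their pointwise limit is a uniform one. *)
Lemma is_cfc_ex g : cont01 g ->
  exists B, is_cfc A (fun z => (g (complex.Re z))%:C%C) B.
Proof.
move=> gc; have pn n : exists p : {poly R}, forall r : R, 0 <= r <= 1 -> `|p.[r] - g r| <= n.+1%:R^-1.
  by apply: weierstrass; rewrite // invr_gt0.
pose p n := sval (cid (pn n)).
have pg n (r : R) : 0 <= r <= 1 -> `|(p n).[r] - g r| <= n.+1%:R^-1.
  by rewrite /p; case: cid => /= q; apply.
have pp n m x : (n <= m)%N ->
    rnorm (poly_op (rpoly (p n)) A x - poly_op (rpoly (p m)) A x) <= 2 * n.+1%:R^-1 * rnorm x.
  move=> nm; rewrite -poly_opB -rmorphB; apply: rpoly_le => r r01.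
  rewrite hornerD hornerN -(subrKA (g r)) (le_trans (ler_normD _ _))//.
  rewrite mulr2n mulrDl mul1r lerD ?pg// distrC (le_trans (pg _ _ r01))//.
  by rewrite lef_pV2 ?posrE// ler_nat.
have small (k : R) : 0 < k -> exists N, forall n, (N <= n)%N -> 2 * n.+1%:R^-1 <= k.
  move=> k0; exists (Num.truncn (2 / k)) => n Nn.
  rewrite ler_pdivrMr// mulrC -ler_pdivrMr// (le_trans (ltW (truncnS_gt _)))//.
  by rewrite ler_nat.
have lim x : exists l : H, forall e : R, 0 < e -> exists N, forall n, (N <= n)%N ->
     rnorm (poly_op (rpoly (p n)) A x - l) <= e.
  apply: cauchy_rnorm => e e0.
  have x1 : 0 < rnorm x + 1 by rewrite ltr_wpDl ?rnorm_ge0.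
  have [N Nk] := small (e / (rnorm x + 1)) (divr_gt0 e0 x1).
  exists N => m n Nm Nn; wlog mn : m n Nm Nn / (m <= n)%N.
    by move=> W; have [/W->//|/ltnW/W] := leqP m n; rewrite rdistC; exact.
  rewrite (le_trans (pp _ _ _ mn))// (le_trans (ler_wpM2r (rnorm_ge0 _) (Nk _ Nm)))//.
  by rewrite mulrAC -mulrA ler_piMr ?(ltW e0)// ler_pdivrMr// mul1r lerDl.
pose B x := sval (cid (lim x)).
have BP x (e : R) : 0 < e -> exists N, forall n, (N <= n)%N ->
    rnorm (poly_op (rpoly (p n)) A x - B x) <= e.
  by rewrite /B; case: cid => /= l; apply.
exists B; exists (fun n => rpoly (p n)) => e e0.
have [r er] : exists r, e = r%:C%C by apply/complex_realP/gtr0_real.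
move: e0; rewrite {}er ltcR => r0; have [N Nk] := small r r0.
split; exists N => // n /= Nn.
  move=> z /spectrum01[z01 {1}->]; rewrite rpolyE -rmorphB -normcE lecR normc_real.
  rewrite (le_trans (pg _ _ z01))// (le_trans _ (Nk n Nn))//.
  by rewrite ler_peMl// ler1n.
move=> x; rewrite !normE_rnorm -realCM lecR; apply/ler_addgt0Pr => d d0.
have [M MB] := BP x d d0.
rewrite -(subrKA (poly_op (rpoly (p (maxn n M))) A x)) (le_trans (ler_rnormD _ _))//.
rewrite lerD ?MB ?leq_maxr// (le_trans (pp _ _ _ (leq_maxl _ _)))//.
by rewrite ler_wpM2r ?rnorm_ge0// Nk.
Qed.

Lemma fcalc_approx g p (e : R) : cont01 g ->
  (forall r, 0 <= r <= 1 -> `|p.[r] - g r| <= e) ->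
  forall x, rnorm (poly_op (rpoly p) A x - fcalc g x) <= e * rnorm x.
Proof.
move=> /is_cfc_ex[B gB] pg; rewrite /fcalc (cfc_unique Apos gB).
apply: is_cfc_close => //; first exact: gB.
move=> z /spectrum01[z01 {1}->]; rewrite rpolyE -rmorphB normc_real.
exact: pg.
Qed.

Lemma fcalc_poly p : fcalc (horner p) = poly_op (rpoly p) A.
Proof.
apply: cfc_unique => //; apply: is_cfc_poly => z /spectrum01[_ {1}->].
exact: rpolyE.
Qed.

Lemma fcalc_ext g h : (forall r, 0 <= r <= 1 -> g r = h r) -> cont01 g ->
  fcalc g = fcalc h.
Proof.
move=> gh /is_cfc_ex[B gB]; rewrite /fcalc (cfc_unique Apos gB).
symmetry; apply: cfc_unique => //; have [p pP] := gB; exists p => e /pP[p1 p2].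
split=> //; apply: filterS p1 => n pn z Az; rewrite -gh ?pn//.
by have [] := spectrum01 Az.
Qed.

Lemma fcalc_le g (c : R) : cont01 g ->
  (forall r, 0 <= r <= 1 -> `|g r| <= c) -> forall x, rnorm (fcalc g x) <= c * rnorm x.
Proof.
move=> gc gle x; apply/ler_addgt0Pr => d d0.
pose k := d / (2 * (rnorm x + 1)).
have x1 : 0 < rnorm x + 1 by rewrite ltr_wpDl ?rnorm_ge0.
have k0 : 0 < k by rewrite divr_gt0 ?mulr_gt0.
have [p pg] := weierstrass gc k0.
have h1 := fcalc_approx gc pg x.
have h2 : rnorm (poly_op (rpoly p) A x) <= (c + k) * rnorm x.
  apply: rpoly_le => r r01; rewrite -(subrK (g r) p.[r]) addrC.
  by rewrite (le_trans (ler_normD _ _))// lerD ?gle ?pg.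
rewrite -(subKr (poly_op (rpoly p) A x) (fcalc g x)) (le_trans (ler_rnormB _ _))//.
rewrite (le_trans (lerD h2 h1))//.
have -> : d = k * (2 * (rnorm x + 1)) by rewrite divfK ?gt_eqF ?mulr_gt0.
by move: k0; clear; move: k (rnorm x) => k r; lra.
Qed.

Lemma fcalc_is_linear g : cont01 g -> linear (fcalc g).
Proof.
move=> gc c x y; pose K := rnorm (c *: x + y) + (normc c * rnorm x + rnorm y).
apply: (eq_rnorm_small (K := K)) => e e0 _.
have [p pg] := weierstrass gc e0; have ap := fcalc_approx gc pg.
rewrite -(subrKA (poly_op (rpoly p) A (c *: x + y))) (le_trans (ler_rnormD _ _))//.
rewrite /K (mulrDr e) lerD//; first by rewrite rdistC.
rewrite poly_op_is_linear opprD addrACA -scalerBr (le_trans (ler_rnormD _ _))//.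
by rewrite rnormZ mulrDr lerD// mulrCA ler_wpM2l ?normc_ge0.
Qed.

Lemma fcalcM g h x : cont01 g -> cont01 h ->
  fcalc (fun r => g r * h r) x = fcalc g (fcalc h x).
Proof.
move=> gc hc; have [N N0 gN] := segment_bounded gc.
have [M M0 hM] := segment_bounded hc.
pose K := ((M + 1) + N) * rnorm x + ((N + 1) * rnorm x + M * rnorm x).
apply: (eq_rnorm_small (K := K)) => e e0 e1.
have [p pg] := weierstrass gc e0; have [q qh] := weierstrass hc e0.
have pq r : 0 <= r <= 1 -> `|(p * q).[r] - g r * h r| <= e * ((M + 1) + N).
  move=> r01; have -> : (p * q).[r] - g r * h r =
      (p.[r] - g r) * q.[r] + g r * (q.[r] - h r) by rewrite hornerM; ring.
  rewrite (le_trans (ler_normD _ _))// !normrM mulrDr (mulrC e N).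
  rewrite lerD// ?ler_pM ?pg ?gN ?qh//.
  rewrite -(subrK (h r) q.[r]) addrC (le_trans (ler_normD _ _))//.
  by rewrite lerD ?hM// (le_trans (qh _ r01)).
have hgc := cont01M gc hc.
have h1 := fcalc_approx hgc pq x.
have h2 := fcalc_approx gc pg (fcalc h x).
have h3 := fcalc_approx hc qh x.
rewrite -(subrKA (poly_op (rpoly (p * q)) A x)) (le_trans (ler_rnormD _ _))//.
rewrite /K (mulrDr e) lerD//; first by rewrite rdistC mulrA.
rewrite /rpoly rmorphM poly_opM -(subrKA (poly_op (rpoly p) A (fcalc h x))).
rewrite (le_trans (ler_rnormD _ _))// (mulrDr e) lerD//.
  have /linear_forB <- := poly_op_is_linear A (rpoly p).
  have pN r : 0 <= r <= 1 -> `|p.[r]| <= N + 1.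
    move=> r01; rewrite -(subrK (g r) p.[r]) addrC (le_trans (ler_normD _ _))//.
    by rewrite lerD ?gN// (le_trans (pg _ r01)).
  rewrite (le_trans (rpoly_le pN _))// mulrCA ler_wpM2l// addr_ge0//.
rewrite (le_trans h2)// ler_wpM2l ?(ltW e0)//; exact: fcalc_le.
Qed.

Lemma fcalcD g h x : cont01 g -> cont01 h ->
  fcalc (fun r => g r + h r) x = fcalc g x + fcalc h x.
Proof.
move=> gc hc; apply: (eq_rnorm_small (K := 2 * rnorm x + (rnorm x + rnorm x))) => e e0 _.
have [p pg] := weierstrass gc e0; have [q qh] := weierstrass hc e0.
have pq r : 0 <= r <= 1 -> `|(p + q).[r] - (g r + h r)| <= e * 2.
  move=> r01; rewrite hornerD opprD addrACA (le_trans (ler_normD _ _))//.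
  by rewrite mulr_natr mulr2n lerD ?pg ?qh.
have h1 := fcalc_approx (cont01D gc hc) pq x.
rewrite -(subrKA (poly_op (rpoly (p + q)) A x)) (le_trans (ler_rnormD _ _))//.
rewrite (mulrDr e) lerD//; first by rewrite rdistC mulrA.
rewrite /rpoly rmorphD poly_opD opprD addrACA (le_trans (ler_rnormD _ _))//.
by rewrite mulrDr lerD//; [exact: fcalc_approx gc pg x|exact: fcalc_approx hc qh x].
Qed.

Lemma fcalc_cst (c : R) x : fcalc (fun=> c) x = c%:C%C *: x.
Proof.
rewrite -(@fcalc_ext (horner c%:P) (fun=> c)); first last.
- exact: cont01_horner.
- by move=> r _; rewrite hornerC.
by rewrite fcalc_poly /rpoly map_polyC/= poly_opC.
Qed.

Lemma fcalcZ g (c : R) x : cont01 g ->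
  fcalc (fun r => c * g r) x = c%:C%C *: fcalc g x.
Proof.
by move=> gc; rewrite (@fcalcM (fun=> c) g x (@cont01_cst _ c) gc) fcalc_cst.
Qed.

Lemma fcalc_sym g x y : cont01 g ->
  rdot (fcalc g x) y = rdot x (fcalc g y).
Proof.
move=> gc; apply/eqP; rewrite -subr_eq0 -normr_eq0 eq_le normr_ge0 andbT.
apply/ler_addgt0Pr => d d0; rewrite add0r.
pose K := rnorm x * rnorm y; have K0 : 0 <= K by rewrite mulr_ge0 ?rnorm_ge0.
have K1 : 0 < K + 1 by rewrite ltr_wpDl.
pose e := d / (2 * (K + 1)); have e0 : 0 < e by rewrite divr_gt0 ?mulr_gt0.
have [p pg] := weierstrass gc e0; have ap := fcalc_approx gc pg.
have padj : rdot (poly_op (rpoly p) A x) y = rdot x (poly_op (rpoly p) A y).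
  rewrite poly_op_adjoint; last by move=> u v; exact: positive_sym.
  congr (rdot x (poly_op _ A y)); apply/polyP => i.
  by rewrite !coef_map/= oppr0.
have -> : rdot (fcalc g x) y - rdot x (fcalc g y) =
    rdot x (poly_op (rpoly p) A y - fcalc g y) - rdot (poly_op (rpoly p) A x - fcalc g x) y.
  by rewrite rdotDr rdotDl rdotNr rdotNl -padj; ring.
have -> : d = e * K + e * K + 2 * e.
  by rewrite /e; field; rewrite gt_eqF.
apply: ler_wpDr; first by rewrite mulr_ge0 ?(ltW e0).
rewrite (le_trans (ler_normB _ _))//.
rewrite lerD// (le_trans (ler_abs_rdot _ _))//.
  by rewrite /K mulrCA ler_wpM2l ?rnorm_ge0.
by rewrite /K mulrA ler_wpM2r ?rnorm_ge0.
Qed.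

(** No square root is taken: if [0 <= g <= c] then [c - g] has norm at most [c], so the form of
    [c - g(A)] is at most [c ||x||^2]. *)
Lemma fcalc_ge0 g x : cont01 g ->
  (forall r, 0 <= r <= 1 -> 0 <= g r) -> 0 <= rdot (fcalc g x) x.
Proof.
move=> gc g0; have [c c0 gcle] := segment_bounded gc.
have Ngc : cont01 (fun r => (-1) * g r) := cont01M (@cont01_cst _ (-1)) gc.
have cont : cont01 (fun r => c + (-1) * g r) := cont01D (@cont01_cst _ c) Ngc.
have le : rnorm (fcalc (fun r => c + (-1) * g r) x) <= c * rnorm x.
  apply: fcalc_le => // r r01; have := gcle _ r01; have := g0 _ r01.
  by move=> gr0; rewrite ger0_norm// => grc; rewrite ger0_norm; lra.
have := ler_rdot (fcalc (fun r => c + (-1) * g r) x) x.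
have := ler_wpM2r (rnorm_ge0 x) le; rewrite -mulrA -expr2.
rewrite (@fcalcD (fun=> c) (fun r => (-1) * g r) x (@cont01_cst _ c) Ngc).
by rewrite fcalcZ// fcalc_cst rdotDl !rdotrZl -rnorm_sqr; lra.
Qed.

Lemma fcalc_eigen g x (l : R) : cont01 g -> 0 <= l <= 1 ->
  A x = l%:C%C *: x -> fcalc g x = (g l)%:C%C *: x.
Proof.
move=> gc l01 Ax; apply: (eq_rnorm_small (K := 2 * rnorm x)) => e e0 _.
have [p pg] := weierstrass gc e0; have := fcalc_approx gc pg x.
rewrite (poly_op_eigen _ Ax) rpolyE => h.
rewrite -(subrKA (p.[l]%:C%C *: x)) (le_trans (ler_rnormD _ _))//.
rewrite mulrCA mulr2n mulrDl mul1r lerD//; first by rewrite rdistC.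
by rewrite -scalerBl rnormZ -rmorphB normc_real ler_wpM2r ?rnorm_ge0 ?pg.
Qed.

End UnitCalculus.

(** * Variation of the observations over dyadic windows *)

Section Scalars.
Context {R : realType}.
Implicit Types (l s t d : R).

Lemma cont01_powR t : 0 < t -> cont01 (fun r : R => r `^ t).
Proof.
move=> t0.
have cpos r : 0 < r -> {for r, continuous (fun r : R => r `^ t)}.
  move=> r0; apply: differentiable_continuous; apply/derivable1_diffP.
  by apply: derivable_powR; rewrite in_itv/= r0.
apply/continuous_within_itvP => //; split.
- by move=> r; rewrite in_itv/= => /andP[r0 _]; exact: cpos.
- by rewrite powR0 ?gt_eqF//; exact: powR_cvg0.
- by apply: cvg_at_left_filter; exact: cpos.
Unshelve. all: by end_near. Qed.

Lemma powR_le1 l t : 0 <= l <= 1 -> 0 <= t -> l `^ t <= 1.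
move=> /andP[l0 l1] t0; have := @ge0_ler_powR R t t0 l 1.
rewrite powR1; apply; rewrite ?nnegrE//.

Qed.

(** With [u = - ln l], this is [1 - exp (- d u) <= d u] together with [s u exp (- s u) <= 1]. *)
Lemma powR_diff_le l s d : 0 <= l <= 1 -> 0 < s -> 0 <= d -> l `^ s * (1 - l `^ d) <= d / s.
Proof.
move=> /andP[l0 l1] s0 d0.
have [->|lne] := eqVneq l 0; first by rewrite powR0 ?gt_eqF// mul0r divr_ge0// ltW.
rewrite /powR (negPf lne); have u0 : ln l <= 0 by rewrite ln_le0.
have h1 : 1 - expR (d * ln l) <= - (d * ln l).
  by have := expR_ge1Dx (d * ln l); lra.
have h2 : expR (s * ln l) * (- (s * ln l)) <= 1.
  have := expR_ge1Dx (- (s * ln l)); rewrite -(ler_pM2l (expR_gt0 (s * ln l))).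
  by rewrite expRN divff ?gt_eqF ?expR_gt0//; have := expR_gt0 (s * ln l); lra.
rewrite ler_pdivlMr// (le_trans (ler_wpM2r (ltW s0) (ler_wpM2l (expR_ge0 _) h1)))//.
by move/(ler_wpM2l d0): h2; lra.
Qed.

(** Nonnegativity of the variance [\sum w (S1 g - S2)^2 = S1 (S1 S3 - S2^2)]; if [S1 = 0] all
    weights vanish. *)
Lemma weighted_cauchy (I : eqType) (r : seq I) (w g : I -> R) : (forall i, 0 <= w i) ->
  (\sum_(i <- r) w i * g i) ^+ 2 <= (\sum_(i <- r) w i) * \sum_(i <- r) w i * g i ^+ 2.
Proof.
move=> w0; set S1 := \sum_(i <- r) w i; set S2 := \sum_(i <- r) w i * g i.
set S3 := \sum_(i <- r) w i * g i ^+ 2.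
have h : 0 <= \sum_(i <- r) w i * (S1 * g i - S2) ^+ 2.
  by apply: sumr_ge0 => i _; rewrite mulr_ge0 ?sqr_ge0.
have hE : \sum_(i <- r) w i * (S1 * g i - S2) ^+ 2 = S1 * (S1 * S3 - S2 ^+ 2).
  rewrite (eq_bigr (fun i => S1 ^+ 2 * (w i * g i ^+ 2) - 2 * S1 * S2 * (w i * g i)
    + S2 ^+ 2 * w i)); last by move=> i _; ring.
  by rewrite big_split sumrB -!mulr_sumr -/S1 -/S2 -/S3/=; ring.
have S10 : 0 <= S1 by apply: sumr_ge0.
have [S1p|] := ltP 0 S1.
  by move: h; rewrite hE pmulr_rge0// subr_ge0.
move=> S1n; have S1z : S1 = 0 by apply/le_anti; rewrite S1n.
suff -> : S2 = 0 by rewrite expr0n mulr_ge0// sumr_ge0// => i _; rewrite mulr_ge0 ?sqr_ge0.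
move/eqP: S1z; rewrite psumr_eq0// => /allP wz.
by rewrite /S2 big_seq big1// => i /wz/= /eqP ->; rewrite mul0r.
Qed.

(** The factor gained in the bound for [||C A^n||] each time [n] doubles. *)
Definition rate : R := Num.sqrt (1 / 2).

Lemma rate_sqr : rate ^+ 2 = 1 / 2.
Proof. by rewrite sqr_sqrtr. Qed.

Lemma rate_ge : 1 / 2 <= rate.
Proof. by rewrite -ler_sqr ?nnegrE ?sqrtr_ge0// rate_sqr; lra. Qed.

Lemma rate_le : rate <= 3 / 4.
Proof. by rewrite -ler_sqr ?nnegrE ?sqrtr_ge0// rate_sqr; lra. Qed.

Lemma rate_gt0 : 0 < rate. Proof. by have := rate_ge; lra. Qed.

Lemma sum_rate n : \sum_(j < n) rate ^+ j <= 4.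
Proof.
have : (1 - rate) * \sum_(j < n) rate ^+ j <= 1.
  rewrite -opprB mulNr -subrX1 opprB lerBlDr lerDl; exact/exprn_ge0/ltW/rate_gt0.
have : 0 <= \sum_(j < n) rate ^+ j by apply: sumr_ge0 => j _; exact/exprn_ge0/ltW/rate_gt0.
have := rate_le; nra.
Qed.

(** With truncated subtraction the exponent is [|i - j|]; each side of [i] is a geometric sum of at
    most [4]. *)
Lemma sum_rate_dist n i : \sum_(j < n) rate ^+ (i - j + (j - i))%N <= 8.
Proof.
have rate0 := ltW rate_gt0.
apply: (@le_trans _ _ (\sum_(j < (maxn n i.+1)) rate ^+ (i - j + (j - i))%N)).
  rewrite (big_ord_widen _ (fun j => rate ^+ (i - j + (j - i))%N) (leq_maxl n i.+1)).
  rewrite [leRHS](bigID (fun j : 'I__ => (j < n)%N))/= lerDl.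
  by apply: sumr_ge0 => j _; exact: exprn_ge0.
rewrite -(subnKC (leq_maxr n i.+1)) big_split_ord/= (natrD _ 4 4) lerD//.
  rewrite (reindex_inj rev_ord_inj)/= (le_trans _ (sum_rate i.+1))//.
  apply: ler_sum => j _; rewrite subSS subKn ?leq_subr; last by rewrite -ltnS.
  by rewrite (eqP (_ : (i - j <= i)%N)) ?addn0// leq_subr.
rewrite (le_trans _ (sum_rate (maxn n i.+1 - i.+1)))//.
apply: ler_sum => j _; apply: ler_wiXn2l => //; first by have := rate_le; lra.
by rewrite (leq_trans _ (leq_addl _ _))// addSn -addnS addKn.
Qed.

End Scalars.

(** * Decay of the observation along the powers of [A] *)

Section Admissible.
Context {R : realType} (H Y : hilbertType R).
Variables (A : {linear H -> H}) (C : {linear H -> Y}) (b : R).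
Hypothesis Apos : positive_op A.
Hypothesis A1 : forall x, rdot (A x) x <= rnorm x ^+ 2.
Hypothesis b0 : 0 <= b.
Hypothesis Cb : forall N x, \sum_(n < N) rnorm (C (iter n A x)) ^+ 2 <= b * rnorm x ^+ 2.
Implicit Types (x y : H).

Lemma fcalc_pow n x : fcalc A (fun r => r ^+ n) x = iter n A x.
Proof.
rewrite -(@fcalc_ext _ _ _ Apos A1 (horner ('X^n))); first last.
- exact: cont01_horner.
- by move=> r _; rewrite hornerXn.
by rewrite fcalc_poly// /rpoly map_polyXn poly_opX.
Qed.

Lemma cont01X n : cont01 (fun r : R => r ^+ n).
Proof. by apply: continuous_subspaceT; exact: exprn_continuous. Qed.

(* [A^n = (I + A + ... + A^(n-1)) h(A)] where [h = r^n / (1 + r + ... + r^(n-1))] is at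
   most [1/n]. *)
Lemma admissible_decay n x : (0 < n)%N ->
  rnorm (C (iter n A x)) ^+ 2 <= b / n%:R * rnorm x ^+ 2.
Proof.
move=> n0; have n0R : 0 < n%:R :> R by rewrite ltr0n.
pose S (r : R) := \sum_(k < n) r ^+ k.
have S1 r : 0 <= r <= 1 -> 1 <= S r.
  move=> /andP[r0 r1]; case: n n0 @S {n0R} => // n _ /=.
  by rewrite big_ord_recl expr0 lerDl sumr_ge0// => i _; rewrite exprn_ge0.
pose p := \sum_(k < n) 'X^k : {poly R}.
have pS r : p.[r] = S r.
  by rewrite horner_sum; apply: eq_bigr => k _; rewrite hornerXn.
have Sc : cont01 S.
  by rewrite (_ : S = horner p); [exact: cont01_horner|apply/funext => r; rewrite pS].
pose h (r : R) := r ^+ n * (S r)^-1.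
have hc : cont01 h.
  apply: cont01M; first exact: cont01X.
  apply/subspace_continuousP => r; rewrite /= in_itv/= => r01.
  apply: cvgV; first by rewrite gt_eqF// (lt_le_trans ltr01)// S1.
  by move/subspace_continuousP: Sc; apply; rewrite /= in_itv.
have hn r : 0 <= r <= 1 -> `|h r| <= n%:R^-1.
  move=> r01; have S0 : 0 < S r by rewrite (lt_le_trans ltr01)// S1.
  case/andP: r01 => r0 r1.
  rewrite ger0_norm ?mulr_ge0 ?exprn_ge0 ?invr_ge0 ?(ltW S0)//.
  rewrite ler_pdivrMr// ler_pdivlMl// mulr_natl.
  have -> : r ^+ n *+ n = \sum_(k < n) r ^+ n by rewrite sumr_const card_ord.
  by apply: ler_sum => k _; apply: ler_wiXn2l => //; exact: ltnW.
have hE : iter n A x = \sum_(k < n) iter k A (fcalc A h x).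
  rewrite -fcalc_pow (@fcalc_ext _ _ _ Apos A1 _ (fun r => p.[r] * h r)); first last.
  - exact: cont01X.
  - by move=> r r01; rewrite pS mulrCA mulfV ?mulr1// gt_eqF// (lt_le_trans ltr01)// S1.
  rewrite fcalcM//; last exact: cont01_horner.
  rewrite fcalc_poly// /rpoly rmorph_sum.
  transitivity (\sum_(k < n) poly_op (map_poly (real_complex R) 'X^k) A (fcalc A h x)).
    elim/big_rec2: _ => [|k u v _ IH]; first by rewrite poly_op0.
    by rewrite poly_opD IH.
  by apply: eq_bigr => k _; rewrite map_polyXn poly_opX.
rewrite hE linear_sum.
have yn : rnorm (fcalc A h x) ^+ 2 <= n%:R^-1 ^+ 2 * rnorm x ^+ 2.
  by rewrite -exprMn lerXn2r ?nnegrE ?mulr_ge0 ?rnorm_ge0 ?invr_ge0 ?ler0n ?fcalc_le.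
pose a (k : 'I_n) := rnorm (C (iter k A (fcalc A h x))).
(* Cauchy-Schwarz loses a factor [n], while the bound [1/n] on [h] gains [n^2]. *)
have cs : (\sum_(k < n) a k) ^+ 2 <= n%:R * \sum_(k < n) a k ^+ 2.
  have := weighted_cauchy (index_enum 'I_n) a (w := fun=> 1) (fun=> ler01).
  rewrite /= sumr_const card_ord.
  rewrite (eq_bigr a) => [|k _]; last by rewrite mul1r.
  rewrite [X in _ <= _ * X -> _](eq_bigr (fun k => a k ^+ 2)) => [|k _] //.
  by rewrite mul1r.
apply: le_trans (le_trans cs _).
  by rewrite lerXn2r ?nnegrE ?rnorm_ge0 ?ler_rnorm_sum// sumr_ge0// => k _; exact: rnorm_ge0.
rewrite (le_trans (ler_wpM2l (ltW n0R) (Cb n _)))//.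
rewrite (le_trans (ler_wpM2l (ltW n0R) (ler_wpM2l b0 yn)))//.
by rewrite le_eqVlt; apply/orP; left; apply/eqP; field; rewrite gt_eqF.
Qed.

Lemma admissible_decay2 k x : rnorm (C (iter (2 ^ k) A x)) <= Num.sqrt b * rate ^+ k * rnorm x.
Proof.
rewrite -ler_sqr ?nnegrE ?mulr_ge0 ?rnorm_ge0 ?sqrtr_ge0 ?exprn_ge0 ?(ltW rate_gt0)//.
rewrite 2!exprMn sqr_sqrtr// exprAC rate_sqr (le_trans (admissible_decay _ _)) ?expn_gt0//.
by rewrite natrX expr_div_n expr1n mul1r.
Qed.

(** The factor [l^(2^k)] is spent on the decay of [C A^(2^k)], and the cofactor is bounded by its
    supremum. *)
Lemma fcalc_factor k f r (c : R) x : cont01 f -> cont01 r ->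
  (forall l, 0 <= l <= 1 -> f l = l ^+ (2 ^ k) * r l) ->
  (forall l, 0 <= l <= 1 -> `|r l| <= c) ->
  rnorm (C (fcalc A f x)) <= Num.sqrt b * rate ^+ k * c * rnorm x.
Proof.
move=> fc rc fr rl; rewrite (fcalc_ext Apos A1 fr fc) fcalcM//; last exact: cont01X.
rewrite fcalc_pow (le_trans (admissible_decay2 _ _))// -[leRHS]mulrA ler_wpM2l//.
  by rewrite mulr_ge0 ?sqrtr_ge0 ?exprn_ge0 ?(ltW rate_gt0).
exact: fcalc_le.
Qed.

End Admissible.

(** * A dyadic polynomial partition of unity *)

Section Dyadic.
Context {R : realType}.
Implicit Types (l : R).

(* On [0, 1] both [psi N j] and [phi N j] are concentrated where [1 - l] is of order
   [2 ^- j]. *)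
Definition psi (N j : nat) : {poly R} :=
  if j == 0%N then 1 - 'X^2
  else if (j < N)%N then 'X^(2 ^ j.-1) * (1 - 'X^(2 ^ j)) else 'X^(2 ^ N.-1).

(** For [0 < j < N] and [u = 'X^(2^j)], the product with [psi N j] is to be [u (1 - u)^2 (2 + u)].
    One square root of [u] goes to each factor, so that both keep a power of ['X] and the difference
    [1 - u]. *)
Definition phi (N j : nat) : {poly R} :=
  if j == 0%N then 1 - 'X^2
  else if (j < N)%N then 'X^(2 ^ j.-1) * ((1 - 'X^(2 ^ j)) * (2%:P + 'X^(2 ^ j)))
  else 'X^(2 ^ N.-1) * (2%:P - 'X^(2 ^ N)).

Let exp_double k : (0 < k)%N -> 'X^(2 ^ k) = 'X^(2 ^ k.-1) * 'X^(2 ^ k.-1) :> {poly R}.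
Proof. by case: k => // k _; rewrite -exprD addnn expnS mul2n. Qed.

Let polyC2 : 2%:P = 2 :> {poly R}.
Proof. by rewrite polyCMn. Qed.

(* With [theta u = 2 u - u^2] one has
   [theta u - theta (u^2) = u (1 - u)^2 (2 + u)], so the sum telescopes. *)
Let sum_phi_psi_lt N k : (0 < k)%N -> (k <= N)%N ->
  \sum_(j < k) phi N j * psi N j = 1 - (2 * 'X^(2 ^ k) - 'X^(2 ^ k) * 'X^(2 ^ k)).
Proof.
elim: k => // -[_ _ _|k IH _ kN].
  by rewrite big_ord1 /phi /psi/= expn1; ring.
rewrite big_ord_recr IH//=; last exact: ltnW.
rewrite /phi /psi/= kN polyC2 (exp_double (k := k.+1))// (exp_double (k := k.+2))//=.
rewrite (exp_double (k := k.+1))//=.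
ring.
Qed.

Lemma sum_phi_psi N : (0 < N)%N -> \sum_(j < N.+1) phi N j * psi N j = 1.
Proof.
move=> N0; rewrite big_ord_recr/= sum_phi_psi_lt// /phi /psi gtn_eqF// ltnn polyC2.
by rewrite (exp_double N0); ring.
Qed.

(** Pointwise [psi^2 <= phi psi], so the telescoping of [sum_phi_psi] serves again; for [0 < j < N]
    the slack is [u (1 - u)^2 (1 + u)] with [u = l^(2^j)]. *)
Lemma sum_psi_sqr N l : (0 < N)%N -> 0 <= l <= 1 -> \sum_(j < N.+1) (psi N j).[l] ^+ 2 <= 1.
Proof.
move=> N0 l01; have [l0 l1] := andP l01.
have lX k : 0 <= l ^+ k <= 1 by rewrite exprn_ge0//= exprn_ile1.
have lXX k : (0 < k)%N -> l ^+ (2 ^ k) = l ^+ (2 ^ k.-1) * l ^+ (2 ^ k.-1).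
  by case: k => // k _; rewrite -exprD addnn expnS mul2n.
have h k : (0 < k)%N -> (k <= N)%N -> \sum_(j < k) (psi N j).[l] ^+ 2 <=
    1 - (2 * l ^+ (2 ^ k) - l ^+ (2 ^ k) * l ^+ (2 ^ k)).
  elim: k => // -[_ _ _|k IH _ kN].
    rewrite -[leRHS]/(1 - (2 * l ^+ 2 - l ^+ 2 * l ^+ 2)) big_ord1 /psi eqxx.
    by have -> : (1 - 'X^2).[l] = 1 - l ^+ 2; [rewrite !(hornerD, hornerM, hornerN, hornerXn, hornerC)|lra].
  rewrite big_ord_recr/=; have := IH isT (ltnW kN).
  rewrite /psi/= kN !(hornerD, hornerM, hornerN, hornerXn, hornerC) (lXX k.+2)//= (lXX k.+1)//=.
  have /andP[+ _] := lX (2 ^ k)%N; set v := l ^+ (2 ^ k) => v0.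
  have : 0 <= v * v * (1 - v * v) ^+ 2 * (1 + v * v).
    have v2 : 0 <= v * v by exact: mulr_ge0.
    exact: mulr_ge0 (mulr_ge0 v2 (sqr_ge0 _)) (addr_ge0 ler01 v2).
  by lra.
rewrite big_ord_recr/=; have := h N N0 (leqnn _).
rewrite /psi gtn_eqF// ltnn !(hornerD, hornerM, hornerN, hornerXn, hornerC) (lXX N)//.
have /andP[+ +] := lX (2 ^ N.-1)%N; set v := l ^+ (2 ^ N.-1) => v0 v1.
have : 0 <= v * v * ((1 - v) * (1 + v)).
  by apply: mulr_ge0; apply: mulr_ge0 => //; [rewrite subr_ge0|exact: addr_ge0].
by rewrite -expr2; lra.
Qed.

(** Keeps the difference [1 - l^(2^j)], which serves windows [i > j]; [phi_factor] keeps the power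
    of [l], which serves [i <= j]. *)
Lemma phi_le N j l : (j < N)%N -> 0 <= l <= 1 ->
  `|(phi N j).[l]| <= 3 * (1 - l ^+ (2 ^ j)).
Proof.
move=> jN /andP[l0 l1]; rewrite /phi; case: eqP => [->|/eqP j0].
  rewrite expn0 expr1 !(hornerD, hornerM, hornerN, hornerXn, hornerC) ger0_norm ?subr_ge0 ?exprn_ile1//.
  by rewrite expr2; nra.
rewrite jN !(hornerD, hornerM, hornerN, hornerXn, hornerC).
have : 0 <= l ^+ (2 ^ j.-1) <= 1 by rewrite exprn_ge0//= exprn_ile1.
have : 0 <= l ^+ (2 ^ j) <= 1 by rewrite exprn_ge0//= exprn_ile1.
move: (l ^+ (2 ^ j)) (l ^+ (2 ^ j.-1)) => u v /andP[u0 u1] /andP[v0 v1].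
have u1' : 0 <= 1 - u by rewrite subr_ge0.
have u2 : 0 <= 2 + u by rewrite addr_ge0.
rewrite ger0_norm ?mulr_ge0//; apply: (@le_trans _ _ ((1 - u) * (2 + u))).
  by rewrite ler_piMl ?mulr_ge0.
by rewrite mulrC ler_wpM2r//; lra.
Qed.

Lemma phi_factor N j : (0 < j)%N -> exists2 g : {poly R}, phi N j = 'X^(2 ^ (minn j N).-1) * g &
  forall l, 0 <= l <= 1 -> `|g.[l]| <= 3.
Proof.
move=> j0; rewrite /phi gtn_eqF//; case: ltnP => jN.
  exists ((1 - 'X^(2 ^ j)) * (2%:P + 'X^(2 ^ j))); first by [].
  move=> l /andP[l0 l1]; rewrite !(hornerD, hornerM, hornerN, hornerXn, hornerC).
  have : 0 <= l ^+ (2 ^ j) <= 1 by rewrite exprn_ge0//= exprn_ile1.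
  move: (l ^+ _) => u /andP[u0 u1].
  by rewrite ger0_norm; [nra|rewrite mulr_ge0 ?subr_ge0 ?addr_ge0].
exists (2%:P - 'X^(2 ^ N)) => //.
move=> l /andP[l0 l1]; rewrite !(hornerD, hornerM, hornerN, hornerXn, hornerC).
have : 0 <= l ^+ (2 ^ N) <= 1 by rewrite exprn_ge0//= exprn_ile1.
move: (l ^+ _) => u /andP[u0 u1].
by rewrite ger0_norm; lra.
Qed.

End Dyadic.

(** * Almost orthogonality of the dyadic pieces *)

Section KeyEstimate.
Context {R : realType} (H Y : hilbertType R).
Variables (A : {linear H -> H}) (C : {linear H -> Y}) (b : R).
Hypothesis Apos : positive_op A.
Hypothesis A1 : forall x, rdot (A x) x <= rnorm x ^+ 2.
Hypothesis b0 : 0 <= b.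
Hypothesis Cb : forall N x, \sum_(n < N) rnorm (C (iter n A x)) ^+ 2 <= b * rnorm x ^+ 2.
Implicit Types (x y : H).

Let P (p : {poly R}) := poly_op (rpoly p) A.

(** A Bessel inequality: by self-adjointness the left side is the form of the polynomial
    [\sum psi^2], which is at most [1] on the unit interval. *)
Lemma sum_psi_rnorm N x : (0 < N)%N ->
  \sum_(j < N.+1) rnorm (P (psi N j) x) ^+ 2 <= rnorm x ^+ 2.
Proof.
move=> N0; have ps p y z : rdot (P p y) z = rdot y (P p z).
  by rewrite /P -fcalc_poly// fcalc_sym//; exact: cont01_horner.
pose s : {poly R} := \sum_(j < N.+1) psi N j * psi N j.
have sE : \sum_(j < N.+1) rnorm (P (psi N j) x) ^+ 2 = rdot (P s x) x.
  rewrite /s /P /rpoly rmorph_sum.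
  elim/big_rec2: _ => [|j p r _ ->]; first by rewrite poly_op0 rdot0l.
  by rewrite poly_opD rdotDl rmorphM poly_opM [in RHS]ps rnorm_sqr.
have : 0 <= rdot (P (1 - s) x) x.
  rewrite /P -fcalc_poly//; apply: fcalc_ge0 => //; first exact: cont01_horner.
  move=> r r01; rewrite hornerD hornerN hornerC subr_ge0 horner_sum.
  rewrite (le_trans _ (sum_psi_sqr N0 r01))//.
  by apply: ler_sum => j _; rewrite hornerM expr2.
rewrite sE /P /rpoly rmorphB rmorph1 poly_opD -scaleN1r poly_opZ poly_opC scale1r.
by rewrite rdotDl scaleN1r rdotNl -rnorm_sqr subr_ge0.
Qed.

Let cont_diff s d : 0 < s -> 0 < d -> cont01 (fun l : R => l `^ s * (1 - l `^ d)).
Proof.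
move=> s0 d0; apply: cont01M; first exact: cont01_powR.
rewrite (_ : (fun l => 1 - l `^ d) = (fun l => 1 + -1 * l `^ d)).
  by apply: cont01D; [exact: cont01_cst|apply: cont01M; [exact: cont01_cst|exact: cont01_powR]].
by apply/funext => l; rewrite mulN1r.
Qed.

Lemma op_powR_diff s d x : 0 < s -> 0 < d ->
  op_powR A s x - op_powR A (s + d) x = fcalc A (fun l => l `^ s * (1 - l `^ d)) x.
Proof.
move=> s0 d0; have sd0 : 0 < s + d by rewrite addr_gt0.
rewrite /op_powR !gt_eqF// -/(fcalc A (fun l => l `^ s)) -/(fcalc A (fun l => l `^ (s + d))).
rewrite (fcalc_ext (g := fun l => l `^ s * (1 - l `^ d))
  (h := fun l => l `^ s + -1 * l `^ (s + d)) Apos A1); first last.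
- exact: cont_diff.
- move=> l l01; rewrite powRD; last by rewrite gt_eqF.
  by ring.
have c1 := cont01_powR s0; have c2 := cont01M (@cont01_cst R (-1)) (cont01_powR sd0).
rewrite (fcalcD Apos A1 x c1 c2) (fcalcZ Apos A1 (-1) x (cont01_powR sd0)).
have -> : (-1)%:C%C = -1 :> R[i] by rewrite realCN.
by rewrite scaleN1r.
Qed.

Let diff_bound (l s d : R) : 0 <= l <= 1 -> 0 < s -> 0 <= d -> `|l `^ s * (1 - l `^ d)| <= d / s.
Proof.
move=> l01 s0 d0; rewrite ger0_norm ?powR_diff_le//.
by rewrite mulr_ge0 ?powR_ge0// subr_ge0 powR_le1.
Qed.

Let powR_X (l : R) (k : nat) : 0 <= l -> l ^+ (2 ^ k) = l `^ (2 ^+ k).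
Proof. by move=> l0; rewrite -natrX powR_mulrn. Qed.

Let rate_double (i j : nat) : (j <= i)%N -> 2 ^+ j / 2 ^+ i <= rate ^+ (i - j) :> R.
Proof.
move=> ji; have rate0 := @rate_gt0 R.
have -> : 2 ^+ j / 2 ^+ i = (rate ^+ (i - j)) ^+ 2 :> R.
  rewrite exprAC rate_sqr -[in 2 ^+ i](subnKC ji) exprD expr_div_n expr1n.
  by field; rewrite !expf_neq0.
rewrite expr2 ler_piMr ?exprn_ge0 ?(ltW rate0)//.
by rewrite exprn_ile1 ?(ltW rate0)//; have := @rate_le R; lra.
Qed.

(** The gain [rate^|i-j|] has two sources: for [j < i] the power [l^s] is small on the [j]-th piece,
    for [j >= i] that piece carries a higher power of [l] for [C] to act on. *)
Let term_bound N i j (s d M : R) y : (0 < i)%N -> (i < N)%N -> (j <= N)%N -> 0 < M ->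
  2 ^+ i <= s -> 0 < d -> d <= 2 ^+ i / M ->
  rnorm (C (fcalc A (fun l => l `^ s * (1 - l `^ d)) (P (phi N j) y))) <=
  96 * Num.sqrt b / M * rate ^+ i * rate ^+ (i - j + (j - i)) * rnorm y.
Proof.
move=> i0 iN jN M0 is_ d0 dM.
have p2 k : 0 < 2 ^+ k :> R by rewrite exprn_gt0.
have s0 : 0 < s by rewrite (lt_le_trans _ is_).
have rate0 := @rate_gt0 R.
have rateS k : rate ^+ k <= 2 * rate ^+ k.+1 :> R.
  by rewrite exprS mulrA ler_peMl ?exprn_ge0 ?(ltW rate0)//; have := @rate_ge R; lra.
have ds : d / s <= M^-1.
  rewrite ler_pdivrMr// (le_trans dM)// mulrC ler_wpM2l// invr_ge0 ltW//.
rewrite /P -fcalc_poly// -fcalcM//; [|exact: cont_diff|exact: cont01_horner].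
have fc : cont01 (fun l : R => l `^ s * (1 - l `^ d) * (phi N j).[l]).
  by apply: cont01M; [exact: cont_diff|exact: cont01_horner].
have [ji|ij] := ltnP j i.
  (* Of the exponent [s >= 2 * 2^k], one part [2^k] is spent on [C], and at least [2^k] remains.
     Half of that tames [1 - l^d], at cost [4 / M], the other half tames [1 - l^(2^j)], at cost
     [4 rate^(i-j)]; with the [3] of [phi_le] this makes [48], doubled in passing from [rate^k] to
     [rate^i]. *)
  pose k := i.-1; have ik : i = k.+1 by rewrite prednK.
  have sk : 2 ^+ k <= s - 2 ^+ k.
    by rewrite lerBrDr (le_trans _ is_)// ik exprS mulr2n mulrDl mul1r.
  have sk0 : 0 < s - 2 ^+ k by rewrite (lt_le_trans _ sk).
  have rc : cont01 (fun l : R => l `^ (s - 2 ^+ k) * (1 - l `^ d) * (phi N j).[l]).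
    by apply: cont01M; [exact: cont_diff|exact: cont01_horner].
  apply: (le_trans (fcalc_factor (k := k) (c := 48 / M * rate ^+ (i - j)) Apos A1 b0 Cb y fc rc _ _)).
  - move=> l /andP[l0 l1]; rewrite powR_X// !mulrA -powRD ?subrKC//.
    by rewrite gt_eqF.
  - move=> l l01; have [l0 l1] := andP l01.
    have h0 : 0 < 2 ^+ k / 2 :> R by rewrite divr_gt0.
    have lk : l `^ (s - 2 ^+ k) <= l `^ (2 ^+ k / 2) * l `^ (2 ^+ k / 2).
      rewrite -powRD -?splitr; last by rewrite gt_eqF.
      have [->|ln0] := eqVneq l 0; first by rewrite !powR0 ?gt_eqF.
      by apply: ger_powR => //; rewrite lt_def ln0 l0 l1.
    rewrite !normrM; apply: (@le_trans _ _ ((l `^ (2 ^+ k / 2) * (1 - l `^ d)) *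
        (3 * (l `^ (2 ^+ k / 2) * (1 - l `^ (2 ^+ j)))))).
      have := phi_le (ltn_trans ji iN) l01; rewrite powR_X// => ph.
      have ld0 : 0 <= 1 - l `^ d by rewrite subr_ge0 powR_le1// ltW.
      rewrite ger0_norm ?powR_ge0// (ger0_norm ld0).
      rewrite (le_trans (ler_pM _ _ (ler_wpM2r ld0 lk) ph)) ?mulr_ge0 ?powR_ge0//.
      by rewrite le_eqVlt; apply/orP; left; apply/eqP; ring.
    have b1 := le_trans (ler_norm _) (diff_bound l01 h0 (ltW d0)).
    have b2 := le_trans (ler_norm _) (diff_bound l01 h0 (ltW (p2 j))).
    have b10 : 0 <= l `^ (2 ^+ k / 2) * (1 - l `^ d).
      by rewrite mulr_ge0 ?powR_ge0// subr_ge0 powR_le1// ltW.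
    have b20 : 0 <= l `^ (2 ^+ k / 2) * (1 - l `^ (2 ^+ j)).
      by rewrite mulr_ge0 ?powR_ge0// subr_ge0 powR_le1// ltW.
    have b23 := ler_wpM2l (ler0n R 3) b2.
    apply: (le_trans (ler_pM b10 (mulr_ge0 (ler0n _ 3) b20) b1 b23)).
    have d4 : d / (2 ^+ k / 2) <= 4 / M.
      rewrite ler_pdivrMr// (le_trans dM)// ik exprS.
      by rewrite le_eqVlt; apply/orP; left; apply/eqP; field; rewrite gt_eqF.
    have dn0 : 0 <= d / (2 ^+ k / 2) by rewrite divr_ge0 ?ltW.
    have j4 : 2 ^+ j / (2 ^+ k / 2) <= 4 * rate ^+ (i - j) :> R.
      rewrite (le_trans _ (ler_wpM2l _ (rate_double (ltnW ji))))// ik exprS.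
      by rewrite le_eqVlt; apply/orP; left; apply/eqP; field; rewrite gt_eqF.
    have j40 : 0 <= 3 * (2 ^+ j / (2 ^+ k / 2)) :> R.
      by rewrite mulr_ge0// divr_ge0 ?ltW.
    apply: (le_trans (ler_pM dn0 j40 d4 (ler_wpM2l (ler0n _ 3) j4))).
    by rewrite le_eqVlt; apply/orP; left; apply/eqP; field; rewrite gt_eqF.
  rewrite (eqP (_ : j - i == 0)%N) ?subn_eq0 1?ltnW// addn0 ler_wpM2r ?rnorm_ge0//.
  rewrite !mulrA ler_wpM2r ?exprn_ge0 ?(ltW rate0)//.
  have := rateS k; rewrite -ik => /(ler_wpM2l (_ : 0 <= Num.sqrt b * 48 / M)).
  by rewrite !mulr_ge0 ?sqrtr_ge0 ?invr_ge0 ?(ltW M0)// => /(_ isT); lra.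
(* Here [C] absorbs the power [2^(j-1)] contained in [phi], and [l^s (1 - l^d) <= d / s <= 1 / M]
   needs no further help. *)
have j0 : (0 < j)%N by exact: leq_trans ij.
have [g gE g3] := @phi_factor R N j j0; rewrite (minn_idPl jN) in gE.
have rc : cont01 (fun l : R => l `^ s * (1 - l `^ d) * g.[l]).
  by apply: cont01M; [exact: cont_diff|exact: cont01_horner].
apply: (le_trans (fcalc_factor (k := j.-1) (c := M^-1 * 3) Apos A1 b0 Cb y fc rc _ _)).
- by move=> l _; rewrite gE hornerM hornerXn; ring.
- move=> l l01; rewrite normrM ler_pM ?g3//.
  by rewrite (le_trans (diff_bound _ _ _))// ltW.
rewrite (eqP (_ : i - j == 0)%N) ?subn_eq0// add0n ler_wpM2r ?rnorm_ge0//.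
have := rateS j.-1; rewrite prednK// -[in rate ^+ j](subnKC ij) exprD.
have t0 : 0 <= Num.sqrt b / M * 3 by rewrite !mulr_ge0 ?sqrtr_ge0 ?invr_ge0 ?(ltW M0).
move=> /(ler_wpM2l t0) h; rewrite (_ : _ * (M^-1 * 3) = Num.sqrt b / M * 3 * rate ^+ j.-1); last by ring.
apply: (le_trans h); have u0 : 0 <= rate ^+ i * rate ^+ (j - i) :> R by rewrite mulr_ge0 ?exprn_ge0 ?(ltW rate0).
have := mulr_ge0 t0 u0; lra.
Qed.

Let resolution N x : (0 < N)%N -> x = \sum_(j < N.+1) P (phi N j) (P (psi N j) x).
Proof.
move=> N0; transitivity (P (\sum_(j < N.+1) phi N j * psi N j) x).
  by rewrite sum_phi_psi// /P /rpoly rmorph1 poly_opC scale1r.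
rewrite /P /rpoly rmorph_sum; elim/big_rec2: _ => [|j p u _ <-].
  by rewrite poly_op0.
by rewrite poly_opD rmorphM poly_opM.
Qed.

Let g N x (j : nat) := rnorm (P (psi N j) x).
Let S N x (i : nat) := \sum_(j < N.+1) rate ^+ (i - j + (j - i)) * g N x j.

Let diff_le N i (s d M : R) x : (0 < i)%N -> (i < N)%N -> 0 < M ->
  2 ^+ i <= s -> 0 <= d -> d <= 2 ^+ i / M ->
  rnorm (C (op_powR A s x) - C (op_powR A (s + d) x)) <=
  96 * Num.sqrt b / M * rate ^+ i * S N x i.
Proof.
move=> i0 iN M0 is_; rewrite le_eqVlt => /predU1P[<- _|d0 dM].
  rewrite addr0 subrr rnorm0.
  rewrite mulr_ge0//; last by apply: sumr_ge0 => j _; rewrite mulr_ge0 ?exprn_ge0 ?rnorm_ge0 ?(ltW rate_gt0).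
  by rewrite !mulr_ge0 ?sqrtr_ge0 ?exprn_ge0 ?invr_ge0 ?(ltW M0) ?(ltW rate_gt0).
have s0 : 0 < s by rewrite (lt_le_trans _ is_) ?exprn_gt0.
have N0 : (0 < N)%N by exact: leq_trans iN.
rewrite -linearB op_powR_diff// {1}(resolution x N0).
set f := fun l : R => l `^ s * (1 - l `^ d).
pose lf := fcalc_is_linear Apos A1 (cont_diff s0 d0).
pose fl : {linear H -> H} := HB.pack (fcalc A f) (GRing.isLinear.Build _ _ _ _ (fcalc A f) lf).
have -> : C (fcalc A f (\sum_(j < N.+1) P (phi N j) (P (psi N j) x))) =
    \sum_(j < N.+1) C (fcalc A f (P (phi N j) (P (psi N j) x))).
  by rewrite [fcalc A f _](linear_sum fl) linear_sum.
rewrite (le_trans (ler_rnorm_sum _ _ _))// /S mulr_sumr.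
apply: ler_sum => j _; rewrite [leRHS]mulrA.
by apply: term_bound => //; rewrite -ltnS.
Qed.

(** Schur test: the kernel [rate^|i-j|] has row and column sums at most [8], whence the [64], and
    [96] comes from [term_bound]. [N] is a mere cut-off: [G] may depend on it, the bound of its sum
    does not. [G] does not depend on [M], [s], [t]. *)
Lemma diff_estimate N x : (0 < N)%N -> exists G : nat -> R,
  [/\ forall i, 0 <= G i, \sum_(i < N) G i <= 96 ^+ 2 * 64 * b * rnorm x ^+ 2
   & forall (M s t : R) i, 0 < M -> (0 < i)%N -> (i < N)%N -> 2 ^+ i <= s -> 2 ^+ i <= t ->
     `|s - t| <= 2 ^+ i / M ->
     rnorm (C (op_powR A s x) - C (op_powR A t x)) ^+ 2 <= G i / (M ^+ 2 * 2 ^+ i)].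
Proof.
move=> N0; have rate0 := ltW (@rate_gt0 R).
have S0 i : 0 <= S N x i.
  by apply: sumr_ge0 => j _; rewrite mulr_ge0 ?exprn_ge0 ?rnorm_ge0.
exists (fun i => 96 ^+ 2 * b * S N x i ^+ 2); split.
- by move=> i; rewrite !mulr_ge0 ?sqr_ge0.
- rewrite -mulr_sumr.
  have -> : 96 ^+ 2 * 64 * b * rnorm x ^+ 2 = 96 ^+ 2 * b * (64 * rnorm x ^+ 2) by ring.
  rewrite ler_wpM2l ?mulr_ge0//.
  apply: (@le_trans _ _ (\sum_(i < N) 8 * \sum_(j < N.+1) rate ^+ (i - j + (j - i)) * g N x j ^+ 2)).
    apply: ler_sum => i _; rewrite /S.
    have /le_trans := @weighted_cauchy R _ (index_enum 'I_N.+1)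
      (fun j => rate ^+ (i - j + (j - i))) (fun j => g N x j) (fun j => exprn_ge0 _ rate0).
    apply; rewrite ler_wpM2r ?sum_rate_dist//.
    by apply: sumr_ge0 => j _; rewrite mulr_ge0 ?sqr_ge0// exprn_ge0.
  rewrite -mulr_sumr exchange_big/=.
  have -> : 64 * rnorm x ^+ 2 = 8 * (8 * rnorm x ^+ 2) by ring.
  rewrite ler_wpM2l//.
  rewrite (le_trans _ (ler_wpM2l _ (sum_psi_rnorm x N0)))// mulr_sumr.
  apply: ler_sum => j _; rewrite -mulr_suml ler_wpM2r ?sqr_ge0//.
  by under eq_bigr do rewrite addnC; exact: sum_rate_dist.
move=> M s t i M0 i0 iN is_ it st.
wlog le_st : s t is_ it st / s <= t.
  move=> W; have [/W|/ltW/W] := leP s t; first exact.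
  by rewrite rdistC distrC; exact.
move: st; rewrite distrC ger0_norm ?subr_ge0// => st.
have := diff_le x i0 iN M0 is_ (_ : 0 <= t - s) st; rewrite subr_ge0 => /(_ le_st).
rewrite subrKC => h.
apply: (@le_trans _ _ ((96 * Num.sqrt b / M * rate ^+ i * S N x i) ^+ 2)).
  by rewrite lerXn2r ?nnegrE ?rnorm_ge0// (le_trans _ h)// rnorm_ge0.
rewrite !exprMn sqr_sqrtr// -exprM mulnC exprM rate_sqr.
rewrite le_eqVlt; apply/orP; left; apply/eqP.
by rewrite expr_div_n expr1n; field; rewrite !gt_eqF// exprn_gt0.
Qed.

End KeyEstimate.

(** * Comparison of sums over time sets with a density *)

Section Counting.
Context {R : realType}.
Implicit Types (T : set R) (v : R -> R).

Definition has_density T (d : R) :=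
  [/\ T `<=` `[0, +oo[, locally_finite T &
    ((counting_fun T r)%:R / r)%:E @[r --> +oo] --> d%:E].

Definition window T (a c : R) : set R := T `&` `]a, c].

Lemma windowE T a c t : window T a c t <-> T t /\ a < t <= c.
Proof. by rewrite /window /= in_itv. Qed.

Lemma segmentE T a c t : (T `&` `[a, c]) t <-> T t /\ a <= t <= c.
Proof. by rewrite /= in_itv. Qed.

Lemma finite_window T a c : locally_finite T -> 0 <= a -> finite_set (window T a c).
Proof.
move=> Tfin a0; have [c0|c0] := ltP 0 c.
  apply: sub_finite_set (Tfin c c0) => t /windowE[Tt /andP[at_ tc]].
  by apply/segmentE; rewrite tc (le_trans a0 (ltW at_)).
rewrite (_ : window T a c = set0) // -subset0 => t /windowE[_ /andP[at_ tc]].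
by have := le_lt_trans (le_trans c0 a0) at_; rewrite ltNge tc.
Qed.

Lemma window_setU T (a c e : R) : a <= c -> c <= e ->
  window T a e = window T a c `|` window T c e.
Proof.
move=> ac ce; apply/seteqP; split => t.
  move=> /windowE[Tt /andP[at_ te]]; have [tc|ct] := leP t c; [left|right].
    by apply/windowE; rewrite at_.
  by apply/windowE; rewrite ct.
move=> [|] /windowE[Tt /andP[h1 h2]]; apply/windowE; split=> //.
  by rewrite h1 (le_trans h2).
by rewrite h2 (le_lt_trans ac h1).
Qed.

Lemma sum_window_split T v (a c e : R) : locally_finite T -> 0 <= a -> a <= c -> c <= e ->
  \sum_(t \in window T a e) v t =
  \sum_(t \in window T a c) v t + \sum_(t \in window T c e) v t.
Proof.
move=> Tfin a0 ac ce; rewrite (window_setU T ac ce) fsbigU0//.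
- exact: finite_window.
- by apply: finite_window => //; exact: le_trans ac.
- move=> t [/windowE[_ /andP[_ tc]] /windowE[_ /andP[ct _]]].
  by have := lt_le_trans ct tc; rewrite ltxx.
Qed.

Lemma sum_fset_cst (s : {fset R}) (k : R) : \sum_(t <- s) k = (#|` s|)%fset%:R * k.
Proof. by rewrite big_const_seq count_predT iter_addr_0 mulr_natl. Qed.

Lemma fsum_cst (A : set R) (k : R) : finite_set A ->
  \sum_(t \in A) k = (#|` fset_set A|)%fset%:R * k.
Proof.
move=> Afin; rewrite fsbig_finite// big_const_seq count_predT.
by rewrite iter_addr_0 mulr_natl.
Qed.

Lemma counting_window T a c : T `<=` `[0, +oo[ -> locally_finite T -> 0 < a -> a <= c ->
  (#|` fset_set (window T a c)|)%fset%:R =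
  (counting_fun T c)%:R - (counting_fun T a)%:R :> R.
Proof.
move=> T0 Tfin a0 ac; have c0 := lt_le_trans a0 ac.
have U : T `&` `[0, c] = (T `&` `[0, a]) `|` window T a c.
  apply/seteqP; split => t.
    move=> /segmentE[Tt /andP[t0 tc]]; have [ta|at_] := leP t a; [left|right].
      by apply/segmentE; rewrite t0.
    by apply/windowE; rewrite at_.
  move=> [/segmentE|/windowE] [Tt /andP[h1 h2]]; apply/segmentE; split=> //.
    by rewrite h1 (le_trans h2).
  by rewrite h2 (ltW (lt_trans a0 h1)).
have wfin := finite_window c Tfin (ltW a0).
have := @fsbigU0 R 0 +%R R (T `&` `[0, a]) (window T a c) (fun=> 1) (Tfin a a0) wfin.
rewrite -U (fsum_cst 1 (Tfin c c0)) (fsum_cst 1 (Tfin a a0)) (fsum_cst 1 wfin) !mulr1.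
rewrite /counting_fun => ->; first by rewrite addrC addKr.
move=> t [/segmentE[_ /andP[_ ta]] /windowE[_ /andP[at_ _]]].
by have := lt_le_trans at_ ta; rewrite ltxx.
Qed.

Lemma density_bound T d e : has_density T d -> 0 < e ->
  exists2 r0 : R, 0 < r0 & forall r, r0 <= r -> `|(counting_fun T r)%:R - d * r| <= e * r.
Proof.
move=> [_ _ Td] e0; have /fine_cvgP[_ /cvgrPdist_le/(_ _ e0)[r1 [_ r1P]]] := Td.
exists (Num.max r1 0 + 1); first by rewrite ltr_wpDl// le_max lexx orbT.
move=> r rr; have r1r : r1 < r.
  by rewrite (lt_le_trans _ rr)// (le_lt_trans (_ : r1 <= Num.max r1 0)) ?le_max ?lexx// ltrDl.
have r0 : 0 < r.
  by rewrite (lt_le_trans _ rr)// ltr_wpDl// le_max lexx orbT.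
have := r1P r r1r; rewrite /= distrC => h.
have -> : (counting_fun T r)%:R - d * r = ((counting_fun T r)%:R / r - d) * r.
  by rewrite mulrBl divfK// gt_eqF.
by rewrite normrM (gtr0_norm r0) ler_pM2r.
Qed.

Definition grid M i l : R := 2 ^+ i * (1 + l%:R / M%:R).

Lemma grid_diff M i l : grid M i l.+1 - grid M i l = 2 ^+ i / M%:R.
Proof. by rewrite /grid -natr1; ring. Qed.

Lemma grid_bounds M i l : (0 < M)%N -> (l <= M)%N -> 2 ^+ i <= grid M i l <= 2 ^+ i.+1.
Proof.
move=> M0 lM; have p2 : 0 < 2 ^+ i :> R by rewrite exprn_gt0.
have M0R : 0 < M%:R :> R by rewrite ltr0n.
rewrite /grid exprSr ler_peMr ?(ltW p2) ?lerDl ?divr_ge0//= ler_pM2l//.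
by rewrite mulr2n lerD2l ler_pdivrMr// mul1r ler_nat.
Qed.

Lemma window_count T d M : has_density T d -> 0 < d -> (0 < M)%N ->
  exists i0, forall i l, (i0 <= i)%N -> (l < M)%N ->
    d * (2 ^+ i / M%:R) / 2 <= (#|` fset_set (window T (grid M i l) (grid M i l.+1))|)%fset%:R
      <= 2 * (d * (2 ^+ i / M%:R)).
Proof.
move=> Td d0 M0; have M0R : 0 < M%:R :> R by rewrite ltr0n.
(* Both endpoints are at most [2^(i+1)], so each count is off by at most a quarter of the expected
   number [d 2^i / M], and their difference by at most a half. *)
have e0 : 0 < d / (8 * M%:R) by rewrite divr_gt0 ?mulr_gt0.
have [r0 r00 r0P] := density_bound Td e0.
exists (Num.truncn r0).+1 => i l ii lM.
have p2 : 0 < 2 ^+ i :> R by rewrite exprn_gt0.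
have r0i : r0 <= 2 ^+ i.
  rewrite (le_trans (ltW (truncnS_gt r0)))// -natrX ler_nat.
  by rewrite (leq_trans ii)// ltnW// ltn_expl.
have /andP[l1 l2] := grid_bounds i M0 (ltnW lM).
have /andP[k1 k2] := grid_bounds i M0 lM.
have gd := grid_diff M i l.
have gl : grid M i l <= grid M i l.+1.
  by rewrite -subr_ge0 gd divr_ge0// ltW.
have [T0 Tfin _] := Td.
rewrite counting_window//; last by rewrite (lt_le_trans p2).
have := r0P _ (le_trans r0i l1); have := r0P _ (le_trans r0i k1).
have := ler_wpM2l (ltW e0) l2; have := ler_wpM2l (ltW e0) k2.
have -> : d / (8 * M%:R) * 2 ^+ i.+1 = d * (2 ^+ i / M%:R) / 4.
  by rewrite exprS; field; rewrite gt_eqF.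
have := congr1 ( *%R d) gd; rewrite mulrBr.
have : 0 <= d * (2 ^+ i / M%:R) by rewrite mulr_ge0 ?divr_ge0 ?ltW.
move: (d * (2 ^+ i / M%:R)) => D D0 DE h1 h2; rewrite !ler_norml => /andP[h3 h4] /andP[h5 h6].
by apply/andP; split; lra.
Qed.

Lemma sum_pairs (A B : set R) v (E : R) : finite_set A -> finite_set B ->
  (forall s t, A s -> B t -> v s <= 2 * v t + E) ->
  (#|` fset_set B|)%fset%:R * \sum_(s \in A) v s <=
  2 * (#|` fset_set A|)%fset%:R * \sum_(t \in B) v t +
    (#|` fset_set A|)%fset%:R * (#|` fset_set B|)%fset%:R * E.
Proof.
move=> Afin Bfin AB.
have inB t : t \in fset_set B -> B t by rewrite in_fset_set// inE.
have inA t : t \in fset_set A -> A t by rewrite in_fset_set// inE.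
rewrite !fsbig_finite//.
have -> : (#|` fset_set B|)%fset%:R * \sum_(s <- fset_set A) v s =
    \sum_(s <- fset_set A) \sum_(t <- fset_set B) v s.
  by rewrite mulr_sumr; apply: eq_bigr => s _; rewrite sum_fset_cst.
have -> : 2 * (#|` fset_set A|)%fset%:R * \sum_(t <- fset_set B) v t +
    (#|` fset_set A|)%fset%:R * (#|` fset_set B|)%fset%:R * E =
    \sum_(s <- fset_set A) \sum_(t <- fset_set B) (2 * v t + E).
  rewrite sum_fset_cst big_split/= -mulr_sumr sum_fset_cst.
  by move: (\sum_(t <- _) v t) (_%:R) (_%:R) => a b c; ring.
rewrite big_seq [leRHS]big_seq; apply: ler_sum => s /inA As.
by rewrite big_seq [leRHS]big_seq; apply: ler_sum => t /inB Bt; exact: AB.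
Qed.

(* Average the hypothesis over all pairs of points of [S] and [T] in each dyadic
   interval cut into [M] equal windows, where both sets have about
   [density * 2^i / M] points. *)
Lemma sum_compare S T dS dT : has_density S dS -> has_density T dT -> 0 < dS -> 0 < dT ->
  exists2 k : R, 0 <= k & forall M, (0 < M)%N -> exists2 i0, (0 < i0)%N &
    forall v (G : nat -> R) I, (forall t, 0 <= v t) -> (forall i, 0 <= G i) ->
    (forall i s t, (i0 <= i)%N -> (i < I)%N -> 2 ^+ i <= s -> 2 ^+ i <= t ->
      `|s - t| <= 2 ^+ i / M%:R -> v s <= 2 * v t + 2 * (G i / (M%:R ^+ 2 * 2 ^+ i))) ->
    (i0 <= I)%N ->
    \sum_(s \in window S (2 ^+ i0) (2 ^+ I)) v s <=
    k * (\sum_(t \in window T (2 ^+ i0) (2 ^+ I)) v t + M%:R ^- 2 * \sum_(i < I) G i).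
Proof.
(* A window has at most [2 dS w] points of [S] and at least [dT w / 2] of [T], where [w = 2^i / M]:
   the averaged factor [2] becomes [8 dS / dT], and the errors sum to [4 dS G / M^3], whose last
   [1 / M] is used up by the [M] windows. Both constants are fixed before [M], which lets [M] be
   chosen from them later. *)
move=> Sd Td dS0 dT0; pose k1 := 8 * dS / dT; pose k2 := 4 * dS.
have k10 : 0 <= k1 by rewrite divr_ge0 ?mulr_ge0 ?ltW.
have k20 : 0 <= k2 by rewrite mulr_ge0 ?ltW.
exists (k1 + k2); first exact: addr_ge0.
move=> M M0; have M0R : 0 < M%:R :> R by rewrite ltr0n.
have [iS iSP] := window_count Sd dS0 M0; have [iT iTP] := window_count Td dT0 M0.
have [_ Sfin _] := Sd; have [_ Tfin _] := Td.
pose i0 := (maxn iS iT).+1; exists i0 => // v G I v0 G0 vG i0I.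
have p2 i : 0 < 2 ^+ i :> R by rewrite exprn_gt0.
have vs0 (A : set R) : 0 <= \sum_(t \in A) v t by exact: fsumr_ge0.
have gl i l : (l < M)%N -> 0 < grid M i l /\ grid M i l <= grid M i l.+1.
  move=> lM; have /andP[h _] := grid_bounds i M0 (ltnW lM).
  split; first exact: lt_le_trans h.
  by rewrite -subr_ge0 grid_diff divr_ge0// ltW.
have win i l : (i0 <= i)%N -> (i < I)%N -> (l < M)%N ->
    \sum_(s \in window S (grid M i l) (grid M i l.+1)) v s <=
    k1 * \sum_(t \in window T (grid M i l) (grid M i l.+1)) v t +
      k2 * (M%:R ^- 2 * (G i / M%:R)).
  move=> i0i iI lM; have [g0 gg] := gl i l lM.
  have /andP[_ nS2] := iSP i l (leq_trans (leq_trans (leq_maxl iS iT) (leqnSn _)) i0i) lM.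
  have /andP[nT1 _] := iTP i l (leq_trans (leq_trans (leq_maxr iS iT) (leqnSn _)) i0i) lM.
  have := @sum_pairs (window S (grid M i l) (grid M i l.+1))
    (window T (grid M i l) (grid M i l.+1)) v (2 * (G i / (M%:R ^+ 2 * 2 ^+ i)))
    (finite_window _ Sfin (ltW g0)) (finite_window _ Tfin (ltW g0)).
  move: (#|` _|)%fset%:R (#|` _|)%fset%:R nS2 nT1 => nT nS nS2 nT1.
  have /andP[gi _] := grid_bounds i M0 (ltnW lM).
  have nT0 : 0 < nT.
    by rewrite (lt_le_trans _ nT1)// divr_gt0// mulr_gt0// divr_gt0.
  move=> /(_ _)/le_trans pairs; rewrite -(ler_pM2l nT0); apply: pairs.
    move=> s t /windowE[_ /andP[s1 s2]] /windowE[_ /andP[t1 t2]]; apply: vG => //.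
    - by rewrite (le_trans gi)// ltW.
    - by rewrite (le_trans gi)// ltW.
    - by rewrite -(grid_diff M i l) ler_norml; apply/andP; split; lra.
  rewrite mulrDr lerD//.
    rewrite !mulrA ler_wpM2r//.
    have -> : nT * 8 * dS / dT = 8 * dS * (nT / dT) by ring.
    apply: (@le_trans _ _ (2 * (2 * (dS * (2 ^+ i / M%:R))))); first by rewrite ler_wpM2l.
    have -> : 2 * (2 * (dS * (2 ^+ i / M%:R))) = 8 * dS * (dT * (2 ^+ i / M%:R) / 2 / dT).
      by field; rewrite !gt_eqF.
    by rewrite ler_wpM2l ?mulr_ge0 ?(ltW dS0)// ler_wpM2r// invr_ge0 ltW.
  rewrite (mulrC nS) -!mulrA ler_wpM2l ?(ltW nT0)//.
  rewrite (le_trans (ler_wpM2r _ nS2)) ?mulr_ge0 ?invr_ge0 ?(ltW M0R) ?(ltW (p2 i))//.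
  by rewrite /k2 le_eqVlt; apply/orP; left; apply/eqP; field; rewrite !gt_eqF.
have block i l : (i0 <= i)%N -> (i < I)%N -> (l <= M)%N ->
    \sum_(s \in window S (2 ^+ i) (grid M i l)) v s <=
    k1 * \sum_(t \in window T (2 ^+ i) (grid M i l)) v t +
      k2 * (M%:R ^- 2 * (l%:R * (G i / M%:R))).
  move=> i0i iI; elim: l => [_|l IH lM].
    have -> : grid M i 0 = 2 ^+ i by rewrite /grid mul0r addr0 mulr1.
    have w0 U : window U (2 ^+ i) (2 ^+ i) = set0.
      rewrite -subset0 => t /windowE[_ /andP[t1 t2]].
      by have := lt_le_trans t1 t2; rewrite ltxx.
    by rewrite !w0 !fsbig_set0 !(mulr0, mul0r) addr0.
  have /andP[g1 _] := grid_bounds i M0 (ltnW lM); have [_ g2] := gl i l lM.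
  rewrite !(@sum_window_split _ v (2 ^+ i) (grid M i l) (grid M i l.+1)) ?(ltW (p2 i))//.
  have := IH (ltnW lM); have := win i l i0i iI lM; rewrite -[l.+1%:R]natr1.
  move: (\sum_(s \in _) v s) (\sum_(s \in _) v s) (\sum_(s \in _) v s) (\sum_(s \in _) v s).
  by move=> a b c e h1 h2; rewrite mulrDl mul1r !mulrDr; lra.
have gM i : grid M i M = 2 ^+ i.+1.
  by rewrite /grid divff ?gt_eqF// exprSr.
have main K : (i0 <= K)%N -> (K <= I)%N ->
    \sum_(s \in window S (2 ^+ i0) (2 ^+ K)) v s <=
    k1 * \sum_(t \in window T (2 ^+ i0) (2 ^+ K)) v t +
      k2 * (M%:R ^- 2 * \sum_(i < K) G i).
  elim: K => // K IH; rewrite leq_eqVlt => /predU1P[<- _|i0K KI].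
    have w0 U : window U (2 ^+ i0) (2 ^+ i0) = set0.
      rewrite -subset0 => t /windowE[_ /andP[t1 t2]].
      by have := lt_le_trans t1 t2; rewrite ltxx.
    rewrite !w0 !fsbig_set0 mulr0 add0r mulr_ge0// mulr_ge0 ?invr_ge0 ?sqr_ge0//.
    by apply: sumr_ge0.
  have pi : 2 ^+ i0 <= 2 ^+ K :> R by rewrite -!natrX ler_nat leq_exp2l.
  have pS : 2 ^+ K <= 2 ^+ K.+1 :> R by rewrite -!natrX ler_nat leq_exp2l.
  rewrite !(@sum_window_split _ v (2 ^+ i0) (2 ^+ K) (2 ^+ K.+1)) ?(ltW (p2 i0))//.
  have := IH i0K (ltnW KI); have := block K M i0K KI (leqnn M); rewrite gM.
  rewrite (_ : M%:R * (G K / M%:R) = G K) ?big_ord_recr/=; last first.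
    by rewrite mulrCA divff ?gt_eqF// mulr1.
  move: (\sum_(s \in _) v s) (\sum_(s \in _) v s) (\sum_(s \in _) v s) (\sum_(s \in _) v s).
  by move=> a b c e; rewrite !mulrDr; lra.
have G1 : 0 <= \sum_(i < I) G i by exact: sumr_ge0.
have M2 : 0 <= M%:R ^- 2 :> R by rewrite invr_ge0 sqr_ge0.
rewrite (le_trans (main I i0I (leqnn _)))// mulrDr lerD//.
  by rewrite ler_wpM2r// lerDl.
by rewrite ler_wpM2r ?mulr_ge0// lerDr.
Qed.

End Counting.

(** * The Muntz approximation *)

Section Muntz.
Context {R : realType}.
Implicit Types (T : set R) (q t x : R) (s : seq R) (c : R -> R).

Lemma is_derive_powR_sum s c x : 0 < x ->
  is_derive x 1 (fun x => \sum_(r <- s) c r * x `^ r) (\sum_(r <- s) c r * (r * x `^ (r - 1))).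
Proof.
move=> x0; elim: s => [|r s IH].
  rewrite big_nil (_ : (fun x => _) = cst 0); first exact: is_derive_cst.
  by apply/funext => y; rewrite big_nil.
rewrite big_cons (_ : (fun x => _) =
  (c r \*: (fun x : R => x `^ r)) + (fun x : R => \sum_(r <- s) c r * x `^ r)).
  by apply: is_deriveD; apply: is_deriveZ; exact: is_derive1_powR.
by apply/funext => y; rewrite big_cons.
Qed.

Lemma cont01_powR_sum s c : (forall r, r \in s -> 0 < r) ->
  cont01 (fun x => \sum_(r <- s) c r * x `^ r).
Proof.
elim: s => [_|r s IH rs].
  rewrite (_ : (fun x => _) = fun=> 0); first exact: cont01_cst.
  by apply/funext => y; rewrite big_nil.
rewrite (_ : (fun x => _) = (fun x => c r * x `^ r + \sum_(r <- s) c r * x `^ r)).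
  apply: cont01D; last by apply: IH => u us; apply: rs; rewrite inE us orbT.
  apply: cont01M; first exact: cont01_cst.
  by apply: cont01_powR; apply: rs; rewrite mem_head.
by apply/funext => y; rewrite big_cons.
Qed.

(* At an interior maximum [y] of [f] the equation gives [t f y = (t - q) g y]. *)
Lemma euler_ode_max (f g D : R -> R) q t (B : R) : 0 < q -> q < t -> cont01 f ->
  f 0 = 0 -> f 1 = 0 -> (forall x, 0 < x < 1 -> is_derive x 1 f (D x)) ->
  (forall x, 0 < x < 1 -> x * D x = t * f x - (t - q) * g x) ->
  (forall x, 0 <= x <= 1 -> g x <= B) -> 0 <= B ->
  forall x, 0 <= x <= 1 -> f x <= B * (1 - q / t).
Proof.
move=> q0 qt fc f0 f1 fD ode gB B0 x x01.
have t0 : 0 < t by exact: lt_trans qt.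
have B1 : 0 <= B * (1 - q / t).
  by rewrite mulr_ge0// subr_ge0 ler_pdivrMr// mul1r ltW.
have [y] := EVT_max (@ler01 R) fc; rewrite in_itv/= => y01 ymax.
have /le_trans : f x <= f y by apply: ymax; rewrite in_itv.
apply; have [->|yn0] := eqVneq y 0; first by rewrite f0.
have [->|yn1] := eqVneq y 1; first by rewrite f1.
have yI : 0 < y < 1.
  case/andP: y01 => y0 y1; apply/andP; split; first by rewrite lt_def yn0.
  by rewrite lt_neqAle yn1.
have D0 : D y = 0.
  have Dmax : is_derive y 1 f 0.
    apply: (derive1_at_max ler01); last first.
    - by move=> u; rewrite in_itv/= => /andP[u0 u1]; apply: ymax; rewrite in_itv/= !ltW.
    - by rewrite in_itv.
    - by move=> u; rewrite in_itv/= => /fD[].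
  by have [_ <-] := fD y yI; have [_ ->] := Dmax.
have := ode y yI; rewrite D0 mulr0 => /esym/eqP; rewrite subr_eq0 => /eqP fy.
have -> : f y = g y * (1 - q / t).
  apply: (mulfI (lt0r_neq0 t0)); rewrite fy; field; rewrite gt_eqF//.
by rewrite ler_wpM2r ?gB// subr_ge0 ler_pdivrMr// mul1r ltW.
Qed.

(** Von Golitschek's argument. Adding an exponent [t] replaces the error [g] by the solution [f] of
    [x f' = t f - (t - q) g] vanishing at [1], which is again [x^q] minus a combination of powers;
    the maximum principle of [euler_ode_max], applied to [f] and [- f], gains the factor
    [1 - q / t]. *)
Theorem muntz q s : 0 < q -> uniq s -> (forall t, t \in s -> q < t) ->
  exists c, forall x, 0 <= x <= 1 ->
    `|x `^ q - \sum_(t <- s) c t * x `^ t| <= \prod_(t <- s) (1 - q / t).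
Proof.
move=> q0; elim: s => [_ _|t s IH /= /andP[ts us] sq].
  exists (fun=> 0) => x x01; rewrite !big_nil subr0 ger0_norm ?powR_ge0//.
  by rewrite powR_le1// ltW.
have [|c cP] := IH us; first by move=> r rs; apply: sq; rewrite inE rs orbT.
have qt : q < t by apply: sq; rewrite mem_head.
have t0 : 0 < t by exact: lt_trans qt.
(* The equation multiplies the coefficient of [x^r] by [(t - q) / (t - r)] and leaves that of [x^q]
   equal to [1]. The power [x^t] solves the homogeneous equation, so its coefficient [e] is free to
   enforce [f 1 = 0]. *)
pose d r := c r * ((t - q) / (t - r)).
pose e := 1 - \sum_(r <- s) d r.
pose c' r := if r == t then e else d r.
have sum_c' x : \sum_(r <- t :: s) c' r * x `^ r = e * x `^ t + \sum_(r <- s) d r * x `^ r.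
  rewrite big_cons /c' eqxx; congr (_ + _); apply: eq_big_seq => r rs.
  by case: eqP => // rt; rewrite -rt rs in ts.
exists c' => x x01; rewrite [leRHS]big_cons [leRHS]mulrC.
set B := \prod_(r <- s) (1 - q / r) in cP *.
have B0 : 0 <= B by rewrite (le_trans _ (cP x x01)).
pose g x := x `^ q - \sum_(r <- s) c r * x `^ r.
pose cf r := if r == q then 1 else - c' r.
pose f x := \sum_(r <- q :: t :: s) cf r * x `^ r.
have qs : q \notin t :: s.
  by apply/negP => /sq; rewrite ltxx.
have fE y : f y = y `^ q - \sum_(r <- t :: s) c' r * y `^ r.
  rewrite /f big_cons {1}/cf eqxx mul1r -sumrN; congr (_ + _).
  apply: eq_big_seq => r rs; rewrite /cf; case: eqP => [rq|]; last by rewrite mulNr.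
  by rewrite -rq rs in qs.
pose D y := \sum_(r <- q :: t :: s) cf r * (r * y `^ (r - 1)).
have pos r : r \in q :: t :: s -> 0 < r.
  by rewrite inE => /predU1P[->//|/sq]; exact: lt_trans.
have fc : cont01 f by exact: cont01_powR_sum.
have f0 : f 0 = 0.
  by rewrite /f big_seq big1// => r /pos r0; rewrite powR0 ?mulr0// gt_eqF.
have f1 : f 1 = 0.
  rewrite fE sum_c' powR1 mulr1 (eq_bigr d) => [|r _]; last by rewrite /= mulr1.
  by rewrite subrK subrr.
have fD (y : R) : 0 < y < 1 -> is_derive y 1 f (D y).
  by move=> /andP[y0 _]; exact: is_derive_powR_sum.
have ode (y : R) : 0 < y < 1 -> y * D y = t * f y - (t - q) * g y.
  move=> /andP[y0 _].
  have -> : y * D y = \sum_(r <- q :: t :: s) r * (cf r * y `^ r).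
    rewrite /D mulr_sumr; apply: eq_bigr => r _.
    have -> : y `^ r = y * y `^ (r - 1).
      rewrite -{2}(powRr1 (ltW y0)) -powRD ?subrKC//.
      by rewrite (gt_eqF y0) implybT.
    by ring.
  have key : \sum_(r <- s) r * (cf r * y `^ r) =
      t * \sum_(r <- s) cf r * y `^ r + (t - q) * \sum_(r <- s) c r * y `^ r.
    rewrite !mulr_sumr -big_split; apply: eq_big_seq => r rs /=.
    have rq : r != q by apply: contraNneq qs => <-; rewrite inE rs orbT.
    have rt : r != t by apply: contraNneq ts => <-.
    rewrite /cf (negPf rq) /c' (negPf rt) /d; field.
    by rewrite subr_eq0 eq_sym.
  have cfq : cf q = 1 by rewrite /cf eqxx.
  by rewrite /f /g !big_cons key cfq; ring.
have ode' (y : R) : 0 < y < 1 -> y * - D y = t * - f y - (t - q) * - g y.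
  by move=> /ode; rewrite mulrN => ->; ring.
rewrite -fE ler_norml lerNl; apply/andP; split.
  apply: (@euler_ode_max (fun y => - f y) (fun y => - g y) (fun y => - D y)) => //.
  - by move=> y; apply: cvgN; exact: fc.
  - by rewrite f0 oppr0.
  - by rewrite f1 oppr0.
  - by move=> y y01; apply: is_deriveN; exact: fD.
  - by move=> y /cP; rewrite ler_norml lerNl => /andP[].
apply: (euler_ode_max (g := g) (D := D) q0 qt) => //.
by move=> y /cP; rewrite ler_norml => /andP[].
Qed.

(** Each late dyadic window has at least [d 2^i / 2] points, with inverses at least [2^-(i+1)], and
    so contributes [d / 4]. *)
Lemma sum_inv_window T d : has_density T d -> 0 < d -> exists i0, forall j I,
  (i0 <= j)%N -> (j <= I)%N ->
  d / 4 * (I - j)%:R <= \sum_(t \in window T (2 ^+ j) (2 ^+ I)) t^-1.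
Proof.
move=> Td d0; have [i0 i0P] := window_count Td d0 (ltn0Sn 0); exists i0 => j I i0j.
have [_ Tfin _] := Td; have p2 i : 0 < 2 ^+ i :> R by rewrite exprn_gt0.
have gl i : grid 1 i 0 = 2 ^+ i :> R by rewrite /grid mul0r addr0 mulr1.
have gr i : grid 1 i 1 = 2 ^+ i.+1 :> R by rewrite /grid divr1 exprSr.
have s0 K : 0 <= \sum_(t \in window T (2 ^+ j) (2 ^+ K)) t^-1 :> R.
  by apply: fsumr_ge0 => t /windowE[_ /andP[/(lt_trans (p2 _))/ltW t0 _]]; rewrite invr_ge0.
elim: I => [|I IH jI]; first by move=> _; rewrite sub0n mulr0 s0.
move: jI.
rewrite leq_eqVlt => /predU1P[<-|jI]; first by rewrite subnn mulr0 s0.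
have i0I : (i0 <= I)%N by exact: leq_trans i0j jI.
rewrite (@sum_window_split _ _ _ _ (2 ^+ I)) ?(ltW (p2 _))//; first last.
- by rewrite -!natrX ler_nat leq_exp2l.
- by rewrite -!natrX ler_nat leq_exp2l.
rewrite subSn// -[((I - j).+1)%:R]natr1 mulrDr mulr1 lerD ?IH//.
have /andP[+ _] := i0P I 0%N i0I (ltn0Sn 0); rewrite gl gr => h.
have wfin := finite_window (2 ^+ I.+1) Tfin (ltW (p2 I)).
rewrite fsbig_finite//.
apply: (@le_trans _ _ (\sum_(t <- fset_set (window T (2 ^+ I) (2 ^+ I.+1))) (2 ^+ I.+1)^-1)).
  rewrite sum_fset_cst ler_pdivlMr// (le_trans _ h)// exprS divr1.
  by rewrite le_eqVlt; apply/orP; left; apply/eqP; field.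
rewrite big_seq [leRHS]big_seq; apply: ler_sum => t.
rewrite in_fset_set// inE => /windowE[_ /andP[t1 t2]].
by rewrite lef_pV2 ?posrE// (lt_trans (p2 I)).
Qed.

Lemma muntz_density T d q e : has_density T d -> 0 < d -> 0 < q -> 0 < e ->
  exists s c, [/\ uniq s, forall t, t \in s -> T t /\ 0 < t & forall x, 0 <= x <= 1 ->
    `|x `^ q - \sum_(t <- s) c t * x `^ t| <= e].
Proof.
move=> Td d0 q0 e0; have [_ Tfin _] := Td.
have [i1 i1P] := sum_inv_window Td d0.
pose j := maxn i1 (Num.truncn q).+1.
have qj : q < 2 ^+ j.
  rewrite (lt_trans (truncnS_gt q))// -natrX ltr_nat (leq_ltn_trans (leq_maxr i1 _))//.
  exact: ltn_expl.
(* Starting at [2^j > q] keeps the exponents above [q]; by [1 - u <= exp (- u)] the product over [K]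
   windows is at most [exp (- q d K / 4)], hence at most [e]. *)
pose K := (Num.truncn (- ln e / (q * (d / 4)))).+1; pose I := (j + K)%N.
have p2 : 0 < 2 ^+ j :> R by rewrite exprn_gt0.
have wfin := finite_window (2 ^+ I) Tfin (ltW p2).
pose s : seq R := fset_set (window T (2 ^+ j) (2 ^+ I)).
have sT t : t \in s -> T t /\ q < t.
  rewrite in_fset_set// inE => /windowE[Tt /andP[t1 _]].
  by split => //; exact: lt_trans t1.
have us : uniq s by exact: fset_uniq.
have [c cP] := muntz q0 us (fun t ts => proj2 (sT t ts)).
exists s, c; split => //.
  by move=> t /sT[Tt qt]; split => //; exact: lt_trans qt.
move=> x /cP/le_trans; apply.
have : q * (d / 4 * (I - j)%:R) <= \sum_(t <- s) q / t.
  rewrite -mulr_sumr ler_wpM2l ?(ltW q0)// -fsbig_finite//.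
  by apply: i1P; [exact: leq_maxl|exact: leq_addr].
rewrite addKn => h.
apply: (@le_trans _ _ (expR (- \sum_(t <- s) q / t))).
  rewrite -sumrN expR_sum big_seq [leRHS]big_seq.
  apply: ler_prod => t /sT[_ qt]; have t0 : 0 < t by exact: lt_trans qt.
  rewrite subr_ge0 ler_pdivrMr// mul1r (ltW qt)/=.
  exact: expR_ge1Dx.
rewrite -[leRHS](lnK (x := e)) ?posrE// ler_expR lerNl (le_trans _ h)//.
have qd : 0 < q * (d / 4) by rewrite mulr_gt0 ?divr_gt0.
by rewrite mulrA -ler_pdivrMl// mulrC ltW// truncnS_gt.
Qed.

End Muntz.

(** * Sufficiency *)

Section Naturals.
Context {R : realType}.
Implicit Types (v : R -> R).

Definition nats : set R := range (fun n : nat => n%:R).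

Let natr_inj : set_inj setT (fun n : nat => n%:R : R).
Proof. by move=> m n _ _ /eqP; rewrite eqr_nat => /eqP. Qed.

Lemma esum_nats v : (forall t, 0 <= v t) ->
  (\esum_(t in nats) (v t)%:E = \sum_(n <oo) (v n%:R)%:E)%E.
Proof.
move=> v0; rewrite /nats esum_image//.
by rewrite nneseries_esumT// => n; rewrite lee_fin.
Qed.

Lemma esum_nats_ge v N : (forall t, 0 <= v t) ->
  ((\sum_(n < N) v n%:R)%:E <= \esum_(t in nats) (v t)%:E)%E.
Proof.
move=> v0; rewrite esum_nats// -sumEFin -(big_mkord xpredT (fun n => (v n%:R)%:E)).
by apply: nneseries_lim_ge => n _ _; rewrite lee_fin.
Qed.

Lemma esum_nats_le v (c : R) : (forall t, 0 <= v t) ->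
  (forall N, \sum_(n < N) v n%:R <= c) -> (\esum_(t in nats) (v t)%:E <= c%:E)%E.
Proof.
move=> v0 vc; rewrite esum_nats//; apply: lime_le.
  by apply: is_cvg_nneseries => n _ _; rewrite lee_fin.
by apply: nearW => N; rewrite big_mkord sumEFin lee_fin.
Qed.

Let nats_segment (r : R) : 0 <= r ->
  nats `&` `[0, r] = (fun n : nat => n%:R) @` `I_(Num.truncn r).+1.
Proof.
move=> r0; apply/seteqP; split => t.
  move=> /segmentE[[n _ <-] /andP[_ nr]]; exists n => //=.
  by rewrite ltnS truncn_ge_nat.
move=> [n /= nr <-]; apply/segmentE; split; first by exists n.
by rewrite ler0n/= -truncn_ge_nat.
Qed.

Lemma counting_nats (r : R) : 0 <= r -> counting_fun nats r = (Num.truncn r).+1.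
Proof.
move=> r0; rewrite /counting_fun nats_segment//; apply: card_fset_set.
by apply: inj_card_eq => m n _ _ /eqP; rewrite eqr_nat => /eqP.
Qed.

Lemma nats_density : has_density nats 1.
Proof.
split.
- by move=> _ [n _ <-]; rewrite /= in_itv/= ler0n.
- move=> r r0; rewrite nats_segment ?ltW//; apply: finite_image; exact: finite_II.
- apply: cvg_EFin; first exact: nearW.
  apply/cvgrPdist_le => e e0; near=> r.
  have r0 : 0 < r by near: r; exact: nbhs_pinfty_gt.
  rewrite /= counting_nats ?ltW//.
  have -> : 1 - (Num.truncn r).+1%:R / r = (r - (Num.truncn r).+1%:R) / r.
    by rewrite mulrBl divff ?gt_eqF.
  have rV : 0 <= r^-1 by rewrite invr_ge0 ltW.
  rewrite normrM (ger0_norm rV) ltr_pdivrMr//.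
  apply: (@le_lt_trans _ _ 1).
    have := truncnS_gt r; have := truncn_le r; rewrite (ltW r0) -natr1 => h1 h2.
    by rewrite ler_norml; apply/andP; split; lra.
  rewrite mulrC -ltr_pdivrMr//; near: r; apply: nbhs_pinfty_gt; exact: num_real.
Unshelve. all: by end_near. Qed.

(** Windows exclude their left endpoint, hence the shift to [n.+1]. *)
Lemma sum_window_nats v m p : (m <= p)%N ->
  \sum_(t \in window nats m%:R p%:R) v t = \sum_(m <= n < p) v n.+1%:R.
Proof.
have [_ Nfin _] := nats_density.
elim: p => [|p IH].
  rewrite leqn0 => /eqP ->; rewrite big_geq// (_ : window _ _ _ = set0) ?fsbig_set0//.
  rewrite -subset0 => t /windowE[_ /andP[t1 t2]].
  by have := lt_le_trans t1 t2; rewrite ltxx.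
rewrite leq_eqVlt => /predU1P[->|mp].
  rewrite big_geq// (_ : window _ _ _ = set0) ?fsbig_set0//.
  rewrite -subset0 => t /windowE[_ /andP[t1 t2]].
  by have := lt_le_trans t1 t2; rewrite ltxx.
rewrite (@sum_window_split _ _ _ _ p%:R) ?ler_nat//.
rewrite IH// big_nat_recr//=; congr (_ + _); rewrite (_ : window _ _ _ = [set p.+1%:R]) ?fsbig_set1//.
apply/seteqP; split => t.
  move=> /windowE[[n _ <-]]; rewrite ltr_nat ler_nat => /andP[pn np] /=.
  by congr (_%:R); apply/eqP; rewrite eqn_leq np.
by move=> ->; apply/windowE; rewrite ltr_nat lexx ltnSn; split => //; exists p.+1.
Qed.

End Naturals.

Section Contraction.
Context {R : realType} (H : hilbertType R).
Variable A : {linear H -> H}.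
Hypothesis Apos : positive_op A.

(* [n |-> ||A^n x||] is log-convex, hence nonincreasing as soon as it is bounded. *)
Lemma power_bounded_contraction (K : R) x :
  (forall n, rnorm (iter n A x) <= K) -> rdot (A x) x <= rnorm x ^+ 2.
Proof.
move=> AK; pose c n := rnorm (iter n A x).
have c0 n : 0 <= c n by exact: rnorm_ge0.
have conv n : c n.+1 ^+ 2 <= c n * c n.+2.
  rewrite /c rnorm_sqr.
  change (rdot (A (iter n A x)) (iter n.+1 A x) <= rnorm (iter n A x) * rnorm (iter n.+2 A x)).
  by rewrite positive_sym// ler_rdot.
suff c10 : c 1%N <= c 0%N.
  by rewrite (le_trans (ler_rdot _ _))// expr2 ler_wpM2r ?rnorm_ge0.
rewrite leNgt; apply/negP => c01.
have cpos : 0 < c 1%N by rewrite (le_lt_trans (c0 0%N)).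
have c0pos : 0 < c 0%N.
  have := conv 0%N; rewrite lt_def c0 andbT; apply: contraTneq => ->.
  by rewrite mul0r -ltNge exprn_gt0.
pose d := c 1%N - c 0%N; have d0 : 0 < d by rewrite subr_gt0.
(* Log-convexity implies convexity, so the increments never fall below the first one, and [c] would
   grow linearly. *)
have step n : 0 < c n /\ d <= c n.+1 - c n.
  elim: n => [|n [cn dn]]; first by [].
  have cn1 : 0 < c n.+1 by have := c0 n; lra.
  split => //; apply: (le_trans dn); rewrite -(ler_pM2l cn).
  by have := conv n; have := sqr_ge0 (c n.+1 - c n); lra.
have lin n : n%:R * d <= c n.
  elim: n => [|n IH]; first by rewrite mul0r.
  by have [_] := step n; rewrite -natr1; lra.
have := truncnS_gt (K / d); rewrite ltr_pdivrMr// => h.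
by have := lt_le_trans h (lin _); rewrite ltNge AK.
Qed.

End Contraction.

Section Sufficiency.
Context {R : realType} (H Y : hilbertType R).
Variables (A : {linear H -> H}) (C : {linear H -> Y}) (a b : R).
Hypothesis Apos : positive_op A.
Hypothesis Ccont : continuous C.
Hypothesis a0 : 0 < a.
Hypothesis b0 : 0 <= b.
Implicit Types (x : H) (T : set R).

Let V x (t : R) := rnorm (C (op_powR A t x)) ^+ 2.

Let V0 x t : 0 <= V x t. Proof. exact: sqr_ge0. Qed.

Let Vn x (n : nat) : V x n%:R = rnorm (C (iter n A x)) ^+ 2.
Proof. by rewrite /V op_powR_nat. Qed.

Hypothesis obs_ub : forall x N, \sum_(n < N) V x n%:R <= b * rnorm x ^+ 2.
(** The lower bound is phrased through upper bounds of the partial sums, which keeps extended reals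
    out of this section. *)
Hypothesis obs_lb : forall x (c : R), (forall N, \sum_(n < N) V x n%:R <= c) ->
  a * rnorm x ^+ 2 <= c.

(** The observations of [A^m x] are a tail of those of [x], so [a ||A^m x||^2 <= b ||x||^2] for all
    [m] and the powers are bounded. *)
Lemma observable_contraction x : rdot (A x) x <= rnorm x ^+ 2.
Proof.
apply: (@power_bounded_contraction _ _ _ Apos (Num.sqrt (b / a) * rnorm x)) => m.
rewrite -ler_sqr ?nnegrE ?mulr_ge0 ?sqrtr_ge0 ?rnorm_ge0// exprMn.
rewrite sqr_sqrtr ?divr_ge0 ?(ltW a0)// mulrAC ler_pdivlMr// mulrC.
apply: obs_lb => N; rewrite (le_trans _ (obs_ub x (m + N)))//.
rewrite big_split_ord/= ler_wpDl ?sumr_ge0//; apply: ler_sum => n _.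
by rewrite !Vn -iterD addnC.
Qed.

Let A1 := observable_contraction.

Let Cb N x : \sum_(n < N) rnorm (C (iter n A x)) ^+ 2 <= b * rnorm x ^+ 2.
Proof. by under eq_bigr do rewrite -Vn; exact: obs_ub. Qed.

Lemma op_powR_contraction t x : 0 <= t -> rnorm (op_powR A t x) <= rnorm x.
Proof.
rewrite /op_powR le_eqVlt eq_sym; case: eqP => //= _ t0.
rewrite -[leRHS]mul1r -/(fcalc A (fun r => r `^ t)).
apply: (fcalc_le Apos A1 (cont01_powR t0)) => r r01.
by rewrite ger0_norm ?powR_ge0// powR_le1// ltW.
Qed.

Lemma obs_compare S T dS dT (e : R) : has_density S dS -> has_density T dT ->
  0 < dS -> 0 < dT -> 0 < e ->
  exists i0 k, [/\ (0 < i0)%N, 0 <= k & forall x I, (i0 <= I)%N ->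
    \sum_(s \in window S (2 ^+ i0) (2 ^+ I)) V x s <=
    k * \sum_(t \in window T (2 ^+ i0) (2 ^+ I)) V x t + e * rnorm x ^+ 2].
Proof.
move=> Sd Td dS0 dT0 e0; have [k k0 kP] := sum_compare Sd Td dS0 dT0.
pose K := 96 ^+ 2 * 64 * b; have K0 : 0 <= K by rewrite !mulr_ge0.
(* The total error is [k K / M^2] times [||x||^2], and [M >= 1] makes this at most [e ||x||^2]. *)
pose M := (Num.truncn (k * K / e)).+1.
have M1 : k * K / e < M%:R by exact: truncnS_gt.
have M0 : 0 < M%:R :> R by rewrite ltr0n.
have [i0 i00 i0P] := kP M isT; exists i0, k; split => // x I i0I.
have I0 : (0 < I)%N by exact: leq_trans i0I.
have [G [G0 GK Gd]] := diff_estimate Apos A1 b0 Cb x I0.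
apply: (@le_trans _ _ (k * (\sum_(t \in window T (2 ^+ i0) (2 ^+ I)) V x t +
    M%:R ^- 2 * \sum_(i < I) G i))).
  apply: i0P => // i s t i0i iI s1 t1 st.
  have i1 : (0 < i)%N by exact: leq_trans i0i.
  have := Gd _ _ _ i M0 i1 iI s1 t1 st; rewrite /V.
  set u := C (op_powR A s x); set v := C (op_powR A t x) => uv.
  have : rnorm u ^+ 2 <= (rnorm v + rnorm (u - v)) ^+ 2.
    rewrite lerXn2r ?nnegrE ?addr_ge0 ?rnorm_ge0//.
    by rewrite -{1}(subrK v u) addrC ler_rnormD.
  move: (rnorm u) (rnorm v) (rnorm (u - v)) uv => p q r uv pqr.
  by have := sqr_ge0 (q - r); lra.
rewrite mulrDr lerD// mulrCA.
have -> : e * rnorm x ^+ 2 = M%:R ^- 2 * (M%:R ^+ 2 * e * rnorm x ^+ 2).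
  by field; rewrite gt_eqF.
rewrite ler_wpM2l ?invr_ge0 ?sqr_ge0//.
apply: (le_trans (ler_wpM2l k0 GK)); rewrite -/K mulrA ler_wpM2r ?sqr_ge0//.
rewrite -ler_pdivrMr// (le_trans (ltW M1))// expr2 ler_peMl ?(ltW M0)//.
by rewrite ler1n.
Qed.

Lemma finite_set_bounded (X : set R) : finite_set X -> exists I0, forall t, X t -> t <= 2 ^+ I0.
Proof.
move=> Xfin; pose s := \sum_(t <- fset_set X) `|t|.
exists (Num.truncn s).+1 => t Xt.
have ts : t <= s.
  rewrite (le_trans (ler_norm t))// /s (bigD1_seq t) ?in_fset_set ?inE ?fset_uniq//=.
  by rewrite lerDl sumr_ge0.
rewrite (le_trans ts)// (le_trans (ltW (truncnS_gt s)))// -natrX ler_nat ltnW//.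
exact: ltn_expl.
Qed.

Lemma fsum_subset (v : R -> R) (X Z : set R) : (forall t, 0 <= v t) -> finite_set Z ->
  X `<=` Z -> \sum_(t \in X) v t <= \sum_(t \in Z) v t.
Proof.
move=> v0 Zfin XZ; rewrite [leRHS](fsbigID X)//= (setIidr XZ) lerDl.
by apply: fsumr_ge0.
Qed.

(** The early times of [T] are finitely many and each costs at most [||C||^2 ||x||^2]; the late ones
    are compared with the naturals. *)
Lemma observable_upper T d : has_density T d -> 0 < d ->
  exists2 b' : R, 0 <= b' & forall x X, finite_set X -> X `<=` T ->
    \sum_(t \in X) V x t <= b' * rnorm x ^+ 2.
Proof.
move=> Td d0; have [T0 Tfin _] := Td.
have [i0 [k [i00 k0 kP]]] := obs_compare Td nats_density d0 ltr01 ltr01.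
have [c c0 Cc] := (linear_boundP C).1 Ccont.
have p2 i : 0 < 2 ^+ i :> R by rewrite exprn_gt0.
pose n0 := (#|` fset_set (T `&` `[0, 2 ^+ i0])|)%fset.
have Hfin := Tfin _ (p2 i0).
exists (n0%:R * c ^+ 2 + (k * b + 1)).
  by rewrite !addr_ge0 ?mulr_ge0 ?sqr_ge0.
move=> x X Xfin XT; have [I1 I1P] := finite_set_bounded Xfin.
pose I := maxn i0 I1.
have wfin := finite_window (2 ^+ I) Tfin (ltW (p2 i0)).
pose Z := (T `&` `[0, 2 ^+ i0]) `|` window T (2 ^+ i0) (2 ^+ I).
have XZ : X `<=` Z.
  move=> t Xt; have Tt := XT _ Xt; have [ti|it] := leP t (2 ^+ i0); [left|right].
    by apply/segmentE; rewrite ti andbT; have := T0 _ Tt; rewrite /= in_itv/= andbT.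
  apply/windowE; rewrite it (le_trans (I1P _ Xt))// -!natrX ler_nat leq_exp2l//.
  exact: leq_maxr.
rewrite (le_trans (fsum_subset (V0 x) _ XZ)) ?finite_setU// fsbigU0//; last first.
  move=> t [/segmentE[_ /andP[_ t1]] /windowE[_ /andP[t2 _]]].
  by have := lt_le_trans t2 t1; rewrite ltxx.
rewrite (mulrDl (n0%:R * c ^+ 2)) lerD//.
  have -> : n0%:R * c ^+ 2 * rnorm x ^+ 2 = n0%:R * (c * rnorm x) ^+ 2 by ring.
  rewrite -(sum_fset_cst _ ((c * rnorm x) ^+ 2)) fsbig_finite// big_seq [leRHS]big_seq.
  apply: ler_sum => t; rewrite in_fset_set// inE => /segmentE[_ /andP[t0 _]].
  rewrite /V lerXn2r ?nnegrE ?mulr_ge0 ?rnorm_ge0//.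
  by rewrite (le_trans (Cc _))// ler_wpM2l// op_powR_contraction.
apply: (le_trans (kP x I (leq_maxl _ _))).
rewrite (mulrDl (k * b)) lerD// -mulrA ler_wpM2l//.
rewrite (le_trans _ (obs_ub x (2 ^ I).+1))// -!natrX sum_window_nats ?leq_exp2l ?leq_maxl//.
rewrite -(big_mkord xpredT (fun n => V x n%:R)) big_nat_recl// ler_wpDl//.
rewrite [leRHS](big_cat_nat (n := 2 ^ i0)) ?leq_exp2l ?leq_maxl//= ler_wpDl//.
by apply: sumr_ge0.
Qed.

Let sums_le T x (B : R) :=
  forall X, finite_set X -> X `<=` T -> \sum_(t \in X) V x t <= B.

Lemma fcalc_powR_sum (s : seq R) (c : R -> R) x : (forall t, t \in s -> 0 < t) ->
  fcalc A (fun l => \sum_(t <- s) c t * l `^ t) x =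
  \sum_(t <- s) (c t)%:C%C *: op_powR A t x.
Proof.
elim: s => [_|t s IH ts].
  rewrite big_nil (_ : (fun l => _) = fun=> 0); last by apply/funext => l; rewrite big_nil.
  by rewrite fcalc_cst ?scale0r.
have t0 : 0 < t by apply: ts; rewrite mem_head.
have {}ts r : r \in s -> 0 < r by move=> rs; apply: ts; rewrite inE rs orbT.
rewrite big_cons -IH// (_ : (fun l => _) =
  (fun l => c t * l `^ t + \sum_(r <- s) c r * l `^ r)); last first.
  by apply/funext => l; rewrite big_cons.
have c1 : cont01 (fun l : R => c t * l `^ t).
  by apply: cont01M; [exact: cont01_cst|exact: cont01_powR].
rewrite (fcalcD Apos A1 x c1 (@cont01_powR_sum R s c ts)); congr (_ + _).
by rewrite (fcalcZ Apos A1 (c t) x (cont01_powR t0)) /op_powR gt_eqF.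
Qed.

(** A Muntz combination expresses [C A^n] by finitely many [C A^t] with [t] in [T], up to an
    operator of small norm; each of these observations is at most [Num.sqrt B]. *)
Lemma muntz_observation T d n (e : R) : has_density T d -> 0 < d -> (0 < n)%N -> 0 < e ->
  exists2 k : R, 0 <= k & forall x B, sums_le T x B -> V x n%:R <= k * B + e * rnorm x ^+ 2.
Proof.
move=> Td d0 n0 e0; have [c c0 Cc] := (linear_boundP C).1 Ccont.
have n0R : 0 < n%:R :> R by rewrite ltr0n.
have c1 : 0 < c + 1 by rewrite ltr_wpDl.
pose e1 := Num.sqrt (e / 2) / (c + 1).
have e10 : 0 < e1 by rewrite divr_gt0// sqrtr_gt0 divr_gt0.
have ce1 : 2 * (c * e1) ^+ 2 <= e.
  have ce : c * e1 <= Num.sqrt (e / 2).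
    rewrite /e1 mulrCA ler_piMr ?sqrtr_ge0//.
    by rewrite ler_pdivrMr// mul1r lerDl.
  have : (c * e1) ^+ 2 <= e / 2.
    rewrite -[leRHS]sqr_sqrtr ?divr_ge0 ?(ltW e0)// lerXn2r ?nnegrE ?sqrtr_ge0//.
    by rewrite mulr_ge0// ltW.
  by lra.
have [s [w [us sT sw]]] := muntz_density Td d0 n0R e10.
pose S := \sum_(t <- s) `|w t|; have S0 : 0 <= S by exact: sumr_ge0.
exists (2 * S ^+ 2) => [|x B xB]; first by rewrite mulr_ge0 ?sqr_ge0.
have B0 : 0 <= B.
  by have := xB set0 (finite_set0 _) (@sub0set _ _); rewrite fsbig_set0.
have s0 t : t \in s -> 0 < t by move=> /sT[].
have sc := @cont01_powR_sum R s w s0.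
have pc := cont01_powR n0R.
have mc : cont01 (fun l : R => -1 * \sum_(t <- s) w t * l `^ t).
  by apply: cont01M; [exact: cont01_cst|exact: sc].
pose g (l : R) := l `^ n%:R + -1 * \sum_(t <- s) w t * l `^ t.
have gc : cont01 g := cont01D pc mc.
have gx : op_powR A n%:R x = fcalc A g x + \sum_(t <- s) (w t)%:C%C *: op_powR A t x.
  rewrite (fcalcD Apos A1 x pc mc) (fcalcZ Apos A1 (-1) x sc) fcalc_powR_sum//.
  rewrite realCN scaleN1r /op_powR gt_eqF// subrK.
  by [].
have h1 : rnorm (C (fcalc A g x)) <= c * e1 * rnorm x.
  rewrite (le_trans (Cc _))// -mulrA ler_wpM2l//.
  apply: (fcalc_le Apos A1 gc) => l l01; rewrite /g mulN1r; exact: sw.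
have h2 : rnorm (C (\sum_(t <- s) (w t)%:C%C *: op_powR A t x)) <= S * Num.sqrt B.
  rewrite linear_sum (le_trans (ler_rnorm_sum _ _ _))// /S mulr_suml.
  rewrite big_seq [leRHS]big_seq; apply: ler_sum => t ts.
  rewrite linearZ/= rnormZ normc_real ler_wpM2l//.
  rewrite -ler_sqr ?nnegrE ?sqrtr_ge0 ?rnorm_ge0// sqr_sqrtr//.
  have := xB [set t] (finite_set1 _) _; rewrite fsbig_set1; apply.
  by move=> _ ->; have [] := sT t ts.
rewrite /V gx linearD.
have h3 := le_trans (ler_rnormD _ _) (lerD h1 h2).
apply: (@le_trans _ _ ((c * e1 * rnorm x + S * Num.sqrt B) ^+ 2)).
  by rewrite lerXn2r ?nnegrE ?rnorm_ge0// (le_trans _ h3)// rnorm_ge0.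
apply: (@le_trans _ _ (2 * S ^+ 2 * Num.sqrt B ^+ 2 + 2 * (c * e1) ^+ 2 * rnorm x ^+ 2)).
  by have := sqr_ge0 (c * e1 * rnorm x - S * Num.sqrt B); lra.
by rewrite sqr_sqrtr// lerD2l ler_wpM2r ?sqr_ge0.
Qed.

Lemma muntz_observations T d p (e : R) : has_density T d -> 0 < d -> 0 < e ->
  exists2 k : R, 0 <= k & forall x B, sums_le T x B ->
    \sum_(n < p) V x n.+1%:R <= k * B + e * rnorm x ^+ 2.
Proof.
move=> Td d0; elim: p e => [|p IH] e e0.
  by exists 0 => // x B _; rewrite big_ord0 mul0r add0r mulr_ge0 ?sqr_ge0// ltW.
have e2 : 0 < e / 2 by rewrite divr_gt0.
have [k k0 kP] := IH _ e2; have [l l0 lP] := muntz_observation Td d0 (ltn0Sn p) e2.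
exists (k + l) => [|x B xB]; first exact: addr_ge0.
rewrite big_ord_recr/=; have := kP x B xB; have := lP x B xB; lra.
Qed.

Lemma observable_lower T d : has_density T d -> 0 < d -> T 0 ->
  exists2 a' : R, 0 < a' & forall x B, sums_le T x B -> a' * rnorm x ^+ 2 <= B.
Proof.
move=> Td d0 T0; have [_ Tfin _] := Td.
have a4 : 0 < a / 4 by rewrite divr_gt0.
have p2 i : 0 < 2 ^+ i :> R by rewrite exprn_gt0.
(* Late and early times each lose at most [a / 4], so half of the lower bound survives. *)
have [i0 [k [i00 k0 kP]]] := obs_compare nats_density Td ltr01 d0 a4.
have [l l0 lP] := muntz_observations (2 ^ i0) Td d0 a4.
(* The three terms account for time [0], for the times [1] to [2^i0] and for the later ones. *)
pose K := 1 + l + k; have K0 : 0 < K by rewrite ltr_pwDl ?ltr_pwDl.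
exists (a / (2 * K)) => [|x B xB]; first by rewrite divr_gt0 ?mulr_gt0.
suff : a * rnorm x ^+ 2 <= K * B + a / 2 * rnorm x ^+ 2.
  move=> h; rewrite mulrAC ler_pdivrMr ?mulr_gt0//.
  by rewrite (mulrC B) -mulrA -ler_pdivrMl// mulrC; lra.
apply: obs_lb => N; pose I := maxn i0 N.
have wfin := finite_window (2 ^+ I) Tfin (ltW (p2 i0)).
apply: (@le_trans _ _ (\sum_(n < (2 ^ I).+1) V x n%:R)).
  have NI : (N <= (2 ^ I).+1)%N.
    by rewrite ltnW// ltnS (leq_trans (leq_maxr i0 N))// ltnW// ltn_expl.
  rewrite -(big_mkord xpredT (fun n => V x n%:R)).
  rewrite -[leRHS](big_mkord xpredT (fun n => V x n%:R)).
  by rewrite [leRHS](big_cat_nat (n := N))//= lerDl sumr_ge0.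
rewrite big_ord_recl/=.
have -> : \sum_(i < 2 ^ I) V x (bump 0 i)%:R =
    \sum_(n < 2 ^ i0) V x n.+1%:R + \sum_(s \in window nats (2 ^+ i0) (2 ^+ I)) V x s.
  transitivity (\sum_(0 <= n < 2 ^ I) V x n.+1%:R); first by rewrite big_mkord.
  rewrite (big_cat_nat (n := 2 ^ i0)) ?leq_exp2l ?leq_maxl//= big_mkord.
  by rewrite -!natrX sum_window_nats// leq_exp2l ?leq_maxl.
have h0 : V x 0%:R <= B.
  by have := xB [set 0] (finite_set1 _) _; rewrite fsbig_set1; apply => _ ->.
have h1 := lP x B xB; have h2 := kP x I (leq_maxl _ _).
have h3 : \sum_(t \in window T (2 ^+ i0) (2 ^+ I)) V x t <= B.
  by apply: xB => // t [].
by have := ler_wpM2l k0 h3; rewrite /K; lra.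
Qed.

End Sufficiency.

Lemma density_observable (R : realType) (T : set R) (d : R) (H Y : hilbertType R)
    (A : {linear H -> H}) (C : {linear H -> Y}) :
  has_density T d -> 0 < d -> T 0 -> positive_op A -> continuous C ->
  exactly_observable C A (range (fun n : nat => n%:R)) -> exactly_observable C A T.
Proof.
move=> Td d0 T0 Apos Ccont [a [b [a0 ab obs]]].
pose V x (t : R) := rnorm (C (op_powR A t x)) ^+ 2.
have V0 x t : 0 <= V x t by exact: sqr_ge0.
have b0 : 0 <= b by rewrite (le_trans (ltW a0)).
have obs_ub x N : \sum_(n < N) V x n%:R <= b * rnorm x ^+ 2.
  have /andP[_] := obs x; rewrite -lee_fin; apply: le_trans; exact: esum_nats_ge.
have obs_lb x (c : R) : (forall N, \sum_(n < N) V x n%:R <= c) -> a * rnorm x ^+ 2 <= c.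
  move=> Nc; have /andP[+ _] := obs x; rewrite -lee_fin => /le_trans; apply.
  exact: (@esum_nats_le R (V x) c (V0 x) Nc).
have [a' a'0 lower] := observable_lower Apos Ccont a0 b0 obs_ub obs_lb Td d0 T0.
have [b' b'0 upper] := observable_upper Apos Ccont a0 b0 obs_ub obs_lb Td d0.
have esum_ub x : (\esum_(t in T) (V x t)%:E <= (b' * rnorm x ^+ 2)%:E)%E.
  apply: ge_ereal_sup => _ [X [Xfin XT] <-].
  by rewrite fsumEFin// lee_fin upper.
(* On the trivial space nothing relates [a'] to [b'], hence the maximum. *)
exists a', (Num.max a' b'); split => //; first by rewrite le_max lexx.
move=> x; apply/andP; split; last first.
  apply: (le_trans (esum_ub x)).
  by rewrite lee_fin ler_wpM2r ?sqr_ge0// le_max lexx orbT.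
have fin : (\esum_(t in T) (V x t)%:E)%E \is a fin_num.
  rewrite ge0_fin_numE ?(le_lt_trans (esum_ub x)) ?ltry//.
  by apply: esum_ge0 => t _; rewrite lee_fin.
rewrite -[leRHS]fineK// lee_fin; apply: lower => X Xfin XT.
rewrite -lee_fin fineK// -fsumEFin//; apply: esum_ge; exists X => //.
Qed.

(** * The Hilbert space of square-summable sequences *)

Section SquareSummable.
Context {R : realType}.
Implicit Types (x y : nat -> R[i]).

Definition sqnorm_sum x (n : nat) : R := \sum_(k < n) normc (x k) ^+ 2.

Definition square_summable x := exists M, forall n, sqnorm_sum x n <= M.

Definition l2_pred : {pred nat -> R[i]} := fun x => `[< square_summable x >].

Lemma normcD_sqr (u v : R[i]) : normc (u + v) ^+ 2 <= 2 * (normc u ^+ 2 + normc v ^+ 2).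
Proof.
have h : normc (u + v) <= normc u + normc v by exact: (@le_normcD R u v).
have h2 : normc (u + v) ^+ 2 <= (normc u + normc v) ^+ 2.
  by rewrite lerXn2r ?nnegrE ?addr_ge0 ?normc_ge0.
by have := sqr_ge0 (normc u - normc v); lra.
Qed.

Lemma l2_submod : submod_closed l2_pred.
Proof.
split.
  apply/asboolP; exists 0 => n; apply: sumr_le0 => k _.
  by rewrite normc0 expr0n.
move=> c x y /asboolP[M xM] /asboolP[N yN]; apply/asboolP.
exists (2 * (normc c ^+ 2 * M + N)) => n.
apply: (@le_trans _ _ (2 * (normc c ^+ 2 * sqnorm_sum x n + sqnorm_sum y n))).
  rewrite /sqnorm_sum mulr_sumr -big_split/= mulr_sumr; apply: ler_sum => k _.
  by rewrite -exprMn -normcM; exact: normcD_sqr.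
by rewrite ler_wpM2l// lerD// ler_wpM2l ?sqr_ge0.
Qed.

HB.instance Definition _ := GRing.isSubmodClosed.Build _ _ l2_pred l2_submod.

End SquareSummable.

Record l2 (R : realType) := L2 { l2val : nat -> R[i]; l2P : l2val \in l2_pred }.
HB.instance Definition _ (R : realType) := [isSub for @l2val R].
HB.instance Definition _ (R : realType) := [Choice of l2 R by <:].
HB.instance Definition _ (R : realType) := [SubChoice_isSubLmodule of l2 R by <:].

Section InnerProduct.
Context {R : realType}.
Implicit Types (x y z : l2 R).

Lemma l2D x y k : l2val (x + y) k = l2val x k + l2val y k. Proof. by []. Qed.
Lemma l2Z c x k : l2val (c *: x) k = c * l2val x k. Proof. by []. Qed.

Definition l2term x y k : R := complex.Re (l2val x k * (l2val y k)^*%C).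

Definition l2rdot x y : R := limn (series (l2term x y)).

Lemma ReM_le (u v : R[i]) : `|complex.Re (u * v^*%C)| <= normc u ^+ 2 + normc v ^+ 2.
Proof.
case: u v => [a b] [c d] /=; rewrite !sqr_sqrtr ?addr_ge0 ?sqr_ge0// mulrN opprK.
have := sqr_ge0 (a - c); have := sqr_ge0 (a + c).
have := sqr_ge0 (b - d); have := sqr_ge0 (b + d).
by move=> h1 h2 h3 h4; rewrite ler_norml; apply/andP; split; nra.
Qed.

Lemma l2term_diag x k : l2term x x k = normc (l2val x k) ^+ 2.
Proof.
rewrite /l2term; case: (l2val x k) => a b /=.
by rewrite sqr_sqrtr ?addr_ge0 ?sqr_ge0// mulrN opprK !expr2.
Qed.

Lemma l2val_bound x : exists M, forall n, \sum_(k < n) normc (l2val x k) ^+ 2 <= M.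
Proof. by have /asboolP := l2P x. Qed.

Lemma l2rdot_cvg x y : cvgn (series (l2term x y)).
Proof.
apply: normed_cvg; apply: nondecreasing_is_cvgn.
  by apply: nondecreasing_series => k _ _ /=.
have [M xM] := l2val_bound x; have [N yN] := l2val_bound y.
exists (M + N) => _ [n _ <-]; rewrite /normed_series_of /series /= big_mkord.
apply: (@le_trans _ _ (\sum_(k < n) normc (l2val x k) ^+ 2 + \sum_(k < n) normc (l2val y k) ^+ 2)).
  by rewrite -big_split/=; apply: ler_sum => k _; exact: ReM_le.
by rewrite lerD.
Qed.

Lemma l2rdot_lim x y : series (l2term x y) n @[n --> \oo] --> l2rdot x y.
Proof. exact: l2rdot_cvg. Qed.

Lemma l2rdot_unique x y (l : R) : series (l2term x y) n @[n --> \oo] --> l -> l2rdot x y = l.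
Proof. by move/cvg_lim; exact. Qed.

Lemma l2rdotDl x y z : l2rdot (x + y) z = l2rdot x z + l2rdot y z.
Proof.
apply: l2rdot_unique; rewrite (_ : series _ = series (l2term x z) + series (l2term y z)).
  by apply: cvgD; exact: l2rdot_lim.
apply/funext => n; rewrite fctE /series/= -big_split/=; apply: eq_bigr => k _.
by rewrite /l2term l2D mulrDl raddfD.
Qed.

Lemma l2rdotC x y : l2rdot x y = l2rdot y x.
Proof.
apply: l2rdot_unique; rewrite (_ : series _ = series (l2term y x)).
  exact: l2rdot_lim.
congr series; apply/funext => k; rewrite /l2term.
by case: (l2val x k) (l2val y k) => [a b] [c d] /=; ring.
Qed.

Lemma l2rdotiC x y : l2rdot x ('i%C *: y) = - l2rdot y ('i%C *: x).
Proof.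
apply: l2rdot_unique; rewrite (_ : series _ = - series (l2term y ('i%C *: x))).
  by apply: cvgN; exact: l2rdot_lim.
apply/funext => n; rewrite fctE /series/= -sumrN; apply: eq_bigr => k _.
rewrite /l2term !l2Z; case: (l2val x k) (l2val y k) => [a b] [c d] /=; ring.
Qed.

Lemma l2rdotZl c x y : l2rdot (c *: x) y =
  complex.Re c * l2rdot x y - complex.Im c * l2rdot x ('i%C *: y).
Proof.
apply: l2rdot_unique.
rewrite (_ : series _ = fun n => complex.Re c * series (l2term x y) n
  - complex.Im c * series (l2term x ('i%C *: y)) n).
  by apply: cvgB; apply: cvgM; (exact: cvg_cst || exact: l2rdot_lim).
apply/funext => n; rewrite /series/= !mulr_sumr -sumrB.
apply: eq_bigr => k _; rewrite /l2term !l2Z.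
by case: c (l2val x k) (l2val y k) => [e f] [a b] [c d] /=; ring.
Qed.

Lemma l2rdot_partial x n : \sum_(k < n) normc (l2val x k) ^+ 2 <= l2rdot x x.
Proof.
rewrite (_ : \sum_(k < n) _ = series (l2term x x) n).
  apply: nondecreasing_cvgn_le; last exact: l2rdot_cvg.
  by apply: nondecreasing_series => k _ _; rewrite l2term_diag sqr_ge0.
by rewrite /series/= big_mkord; apply: eq_bigr => k _; rewrite l2term_diag.
Qed.

Lemma l2rdot_le x (M : R) : (forall n, \sum_(k < n) normc (l2val x k) ^+ 2 <= M) ->
  l2rdot x x <= M.
Proof.
move=> xM; apply: limr_le; first exact: l2rdot_cvg.
apply: nearW => n; rewrite /series/= big_mkord.
by under eq_bigr do rewrite l2term_diag.
Qed.

Lemma l2rdot_ge0 x : 0 <= l2rdot x x.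
Proof. by rewrite (le_trans _ (l2rdot_partial x 0))// big_ord0. Qed.

Lemma l2coord_le x k : normc (l2val x k) ^+ 2 <= l2rdot x x.
Proof.
rewrite (le_trans _ (l2rdot_partial x k.+1))// big_ord_recr/= lerDr.
by apply: sumr_ge0 => i _; exact: sqr_ge0.
Qed.

Lemma l2rdot_eq0 x : l2rdot x x = 0 -> x = 0.
Proof.
move=> x0; apply: val_inj; apply/funext => k /=.
apply: eq0_normc; apply/eqP; rewrite -sqrf_eq0 eq_le sqr_ge0 andbT -x0.
exact: l2coord_le.
Qed.

(** The imaginary part of a sesquilinear form is the real part after [y] is replaced by [i y], so
    only real series have to converge. *)
Definition l2dot x y : R[i] := (l2rdot x y +i* l2rdot x ('i%C *: y))%C.

End InnerProduct.

Lemma realCX (R : realType) (a : R) n : (a ^+ n)%:C%C = a%:C%C ^+ n.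
Proof. exact: rmorphXn. Qed.

Section Form.
Context {R : realType}.
Implicit Types (x y z : l2 R).

Lemma l2dotC x y : l2dot x y = (l2dot y x)^*%C.
Proof. by rewrite /l2dot /= (l2rdotC x y) (l2rdotiC x y). Qed.

Lemma l2dotDl x y z : l2dot (x + y) z = l2dot x z + l2dot y z.
Proof. by rewrite /l2dot !l2rdotDl. Qed.

Lemma l2dotZl c x y : l2dot (c *: x) y = c * l2dot x y.
Proof.
have ii : 'i%C *: ('i%C *: y) = (-1) *: y :> l2 R.
  by rewrite scalerA -expr2 sqr_i.
have rN : l2rdot x ((-1) *: y) = - l2rdot x y.
  by rewrite l2rdotC l2rdotZl /= oppr0 mul0r subr0 mulN1r l2rdotC.
by rewrite /l2dot !l2rdotZl ii rN; case: c => a b; congr (_ +i* _)%C; rewrite /=; ring.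
Qed.

Lemma l2dotBl z : zmod_morphism (fun x => l2dot x z).
Proof. by move=> x y; rewrite l2dotDl -scaleN1r l2dotZl mulN1r. Qed.

Lemma l2dotBr x : zmod_morphism (l2dot x).
Proof.
move=> y z; rewrite (l2dotC x (y - z)) (l2dotC x y) (l2dotC x z) [l2dot (y - z) x]l2dotBl.
exact: rmorphB.
Qed.

Lemma l2dotZl_for z : scalable_for *%R (fun x => l2dot x z).
Proof. by move=> c x; exact: l2dotZl. Qed.

Lemma l2dotZr_for x : scalable_for (Num.conj \; *%R) (l2dot x).
Proof.
move=> c y; rewrite (l2dotC x (c *: y)) (l2dotC x y) l2dotZl; exact: rmorphM.
Qed.

Lemma l2dot_herm x y : l2dot x y = (-1) ^+ false * Num.conj (l2dot y x).
Proof. by rewrite expr0 mul1r l2dotC. Qed.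

Lemma l2dot_diag x : l2dot x x = (l2rdot x x)%:C%C.
Proof.
rewrite /l2dot; congr (_ +i* _)%C; have := l2rdotiC x x; lra.
Qed.

Lemma l2dot_gt0 x : x != 0 -> 0 < l2dot x x.
Proof.
move=> x0; rewrite l2dot_diag ltcR lt_def l2rdot_ge0 andbT.
by apply: contra_neq x0; exact: l2rdot_eq0.
Qed.

HB.instance Definition _ := isBilinear.Build R[i] (l2 R) (l2 R) R[i] *%R
  (Num.conj \; *%R) (@l2dot R) l2dotBl l2dotBr l2dotZl_for l2dotZr_for.
HB.instance Definition _ := isHermitianSesquilinear.Build R[i] (l2 R) false
  (@Num.conj R[i]) (@l2dot R) l2dot_herm.
HB.instance Definition _ := isDotProduct.Build R[i] (l2 R) (@l2dot R) l2dot_gt0.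

Definition l2norm x : R[i] := (Num.sqrt (l2rdot x x))%:C%C.

Lemma l2rdotZr (r : R) x y : l2rdot x (r%:C%C *: y) = r * l2rdot x y.
Proof. by rewrite l2rdotC l2rdotZl /= mul0r subr0 l2rdotC. Qed.

(* The discriminant of [t |-> ||x - t y||^2] is nonpositive. *)
Lemma l2_cauchy_schwarz x y : l2rdot x y <= Num.sqrt (l2rdot x x) * Num.sqrt (l2rdot y y).
Proof.
set a := Num.sqrt (l2rdot x x); set b := Num.sqrt (l2rdot y y).
have a2 : l2rdot x x = a ^+ 2 by rewrite sqr_sqrtr ?l2rdot_ge0.
have b2 : l2rdot y y = b ^+ 2 by rewrite sqr_sqrtr ?l2rdot_ge0.
have a0 : 0 <= a by exact: sqrtr_ge0.
have b0 : 0 <= b by exact: sqrtr_ge0.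
have [/l2rdot_eq0 ->|xn0] := eqVneq (l2rdot x x) 0.
  by rewrite l2rdotC -(scale0r y) (l2rdotZr 0) mul0r mulr_ge0.
have [/l2rdot_eq0 ->|yn0] := eqVneq (l2rdot y y) 0.
  by rewrite -(scale0r x) (l2rdotZr 0) mul0r mulr_ge0.
have ap : 0 < a by rewrite lt_def a0 -sqrf_eq0 -a2 xn0.
have bp : 0 < b by rewrite lt_def b0 -sqrf_eq0 -b2 yn0.
have := l2rdot_ge0 (b%:C%C *: x + (- a)%:C%C *: y).
rewrite l2rdotDl !(l2rdotC _ (_ + _)) !l2rdotDl.
rewrite !l2rdotZr !(l2rdotC (_ *: _)) !l2rdotZr a2 b2 (l2rdotC y x) => h.
have ab : 0 < 2 * (a * b) by rewrite !mulr_gt0.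
by rewrite -(ler_pM2l ab); lra.
Qed.

Lemma l2norm_triangle x y : l2norm (x + y) <= l2norm x + l2norm y.
Proof.
rewrite /l2norm -realCD lecR -ler_sqr ?nnegrE ?addr_ge0 ?sqrtr_ge0//.
rewrite sqrrD !sqr_sqrtr ?l2rdot_ge0//.
rewrite l2rdotDl !(l2rdotC _ (_ + _)) !l2rdotDl (l2rdotC y x).
by have := l2_cauchy_schwarz x y; lra.
Qed.

Lemma l2norm_scale c x : l2norm (c *: x) = `|c| * l2norm x.
Proof.
rewrite /l2norm -normcE -realCM; congr (_%:C%C).
have -> : l2rdot (c *: x) (c *: x) = normc c ^+ 2 * l2rdot x x.
  apply: complexI; rewrite -l2dot_diag l2dotZl [l2dot x _]l2dotZr_for /=.
  by rewrite mulrA -normCK l2dot_diag realCM realCX.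
by rewrite sqrtrM ?sqr_ge0// sqrtr_sqr ger0_norm// normc_ge0.
Qed.

Lemma l2norm_eq0 x : l2norm x = 0 -> x = 0.
Proof.
move=> [/eqP]; rewrite sqrtr_eq0 => x0; apply: l2rdot_eq0.
by apply/eqP; rewrite eq_le x0 l2rdot_ge0.
Qed.

HB.instance Definition _ := Lmodule_isNormed.Build R[i] (l2 R)
  l2norm_triangle l2norm_scale l2norm_eq0.

Lemma l2_rnormE x : rnorm x = Num.sqrt (l2rdot x x).
Proof. by []. Qed.

Lemma l2_rnorm_sqr x : rnorm x ^+ 2 = l2rdot x x.
Proof. by rewrite l2_rnormE sqr_sqrtr ?l2rdot_ge0. Qed.

End Form.

Section Completeness.
Context {R : realType}.
Implicit Types (x y : l2 R).

Lemma cauchy_real (u : nat -> R) :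
  (forall e : R, 0 < e -> exists N, forall m n, (N <= m)%N -> (N <= n)%N ->
     `|u m - u n| <= e) ->
  exists l : R, forall e : R, 0 < e -> exists N, forall n, (N <= n)%N -> `|u n - l| <= e.
Proof.
move=> cu; suff /cvg_ex[l ul] : cvgn u.
  exists l => e e0; have /cvgrPdist_le/(_ _ e0)[N _ Nu] := ul; exists N => n /Nu /=.
  by rewrite distrC.
apply/cauchy_cvgP/cauchy_ballP => e e0; have [|N Nu] := cu (e / 2).
  by rewrite divr_gt0.
near_simpl; exists ([set n | (N <= n)%N], [set n | (N <= n)%N]).
  by split; exists N.
move=> [m n] [/= Nm Nn]; rewrite -ball_normE /ball_/=.
by rewrite (le_lt_trans (Nu _ _ Nm Nn))// ltr_pdivrMr// ltr_pMr// ltr1n.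
Qed.

Lemma normc_le_ReIm (z : R[i]) : normc z <= `|complex.Re z| + `|complex.Im z|.
Proof.
case: z => a b /=; rewrite -[leRHS]ger0_norm ?addr_ge0// -sqrtr_sqr ler_wsqrtr//.
rewrite sqrrD !real_normK ?num_real//.
by have := mulr_ge0 (normr_ge0 a) (normr_ge0 b); lra.
Qed.

Lemma Re_le_normc (z : R[i]) : `|complex.Re z| <= normc z.
Proof.
case: z => a b /=; rewrite -sqrtr_sqr ler_wsqrtr// lerDl sqr_ge0//.
Qed.

Lemma Im_le_normc (z : R[i]) : `|complex.Im z| <= normc z.
Proof.
case: z => a b /=; rewrite -sqrtr_sqr ler_wsqrtr// lerDr sqr_ge0//.
Qed.

Lemma l2coord_rnorm x k : normc (l2val x k) <= rnorm x.
Proof.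
rewrite -ler_sqr ?nnegrE ?normc_ge0 ?rnorm_ge0// l2_rnorm_sqr; exact: l2coord_le.
Qed.

(** The limit is taken coordinatewise. For each finite block of [K] coordinates it is replaced by a
    far term [u m], with [m] depending on [K], and the resulting bound is uniform in [K]. *)
Lemma l2_cauchy_lim (u : nat -> l2 R) :
  (forall m n, rnorm (u m - u n) <= m.+1%:R^-1 + n.+1%:R^-1) ->
  exists l : l2 R, forall n, rnorm (u n - l) <= 4 * n.+1%:R^-1.
Proof.
move=> cu.
have small (e : R) : 0 < e -> exists N, forall n, (N <= n)%N -> 2 * n.+1%:R^-1 <= e.
  move=> e0; exists (Num.truncn (2 / e)) => n Nn.
  rewrite ler_pdivrMr// mulrC -ler_pdivrMr// (le_trans (ltW (truncnS_gt _)))//.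
  by rewrite ler_nat.
have inv_le m n : (m <= n)%N -> n.+1%:R^-1 <= m.+1%:R^-1 :> R.
  by move=> mn; rewrite lef_pV2 ?posrE// ler_nat.
have coord (f : R[i] -> R) k : (forall z, `|f z| <= normc z) ->
    (forall z w, f (z - w) = f z - f w) ->
    exists l : R, forall e : R, 0 < e -> exists N, forall n, (N <= n)%N ->
      `|f (l2val (u n) k) - l| <= e.
  move=> fn fB; apply: cauchy_real => e e0; have [N Ne] := small e e0.
  exists N => m n Nm Nn; rewrite -fB (le_trans (fn _))//.
  rewrite (le_trans (l2coord_rnorm (u m - u n) k))// (le_trans (cu m n))//.
  by rewrite (le_trans _ (Ne N (leqnn N)))// mulr2n mulrDl mul1r lerD// inv_le.
have cRe k := coord (@complex.Re R) k Re_le_normc (raddfB (@complex.Re R : Rcomplex R -> R)).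
have cIm k := coord (@complex.Im R) k Im_le_normc (raddfB (@complex.Im R : Rcomplex R -> R)).
pose l k : R[i] := (sval (cid (cRe k)) +i* sval (cid (cIm k)))%C.
have ul k (e : R) : 0 < e -> exists N, forall n, (N <= n)%N -> normc (l2val (u n) k - l k) <= e.
  move=> e0; rewrite /l; case: cid => a /= /(_ (e / 2)) ha; case: cid => b /= /(_ (e / 2)) hb.
  have e2 : 0 < e / 2 by rewrite divr_gt0.
  have [N1 {}ha] := ha e2; have [N2 {}hb] := hb e2.
  exists (maxn N1 N2) => n; rewrite geq_max => /andP[/ha h1 /hb h2].
  rewrite (le_trans (normc_le_ReIm _))// (splitr e).
  by move: h1 h2; case: (l2val (u n) k) => c d /= h1 h2; rewrite lerD.
have ulK K (e : R) : 0 < e -> exists N, forall n k, (N <= n)%N -> (k < K)%N ->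
    normc (l2val (u n) k - l k) <= e.
  move=> e0; elim: K => [|K [N NP]]; first by exists 0%N.
  have [N' N'P] := ul K e e0; exists (maxn N N') => n k; rewrite geq_max => /andP[Nn N'n].
  by rewrite ltnS leq_eqVlt => /predU1P[->|kK]; [exact: N'P|exact: NP].
have tail n K : \sum_(k < K) normc (l2val (u n) k - l k) ^+ 2 <= (4 * n.+1%:R^-1) ^+ 2.
  pose d : R := n.+1%:R^-1; have d0 : 0 < d by rewrite invr_gt0.
  have K0 : 0 < K%:R + 1 :> R by rewrite ltr_wpDl.
  have [N NP] := ulK K (d / (K%:R + 1)) (divr_gt0 d0 K0).
  (* On the first [K] coordinates [u m] is within [d / (K + 1)] of [l], so their squares add up to
     at most [d^2]; then [2 ((2 d)^2 + d^2) <= (4 d)^2]. *)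
  pose m := maxn n N.
  have h1 : \sum_(k < K) normc (l2val (u n) k - l2val (u m) k) ^+ 2 <= (2 * d) ^+ 2.
    apply: (le_trans (l2rdot_partial (u n - u m) K)); rewrite -l2_rnorm_sqr.
    rewrite lerXn2r ?nnegrE ?rnorm_ge0 ?mulr_ge0 ?(ltW d0)//.
    by rewrite (le_trans (cu _ _))// mulr2n mulrDl mul1r lerD// inv_le// leq_maxl.
  have h2 : \sum_(k < K) normc (l2val (u m) k - l k) ^+ 2 <= d ^+ 2.
    apply: (@le_trans _ _ (\sum_(k < K) (d / (K%:R + 1)) ^+ 2)).
      apply: ler_sum => k _; rewrite lerXn2r ?nnegrE ?normc_ge0//.
        by rewrite divr_ge0 ?ltW.
      by apply: NP => //; exact: leq_maxr.
    rewrite sumr_const card_ord -[_ *+ K]mulr_natl exprMn mulrCA ler_piMr ?sqr_ge0//.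
    rewrite exprVn ler_pdivrMr ?exprn_gt0// mul1r.
    by have := ler0n R K; nra.
  apply: (@le_trans _ _ (2 * (\sum_(k < K) normc (l2val (u n) k - l2val (u m) k) ^+ 2 +
      \sum_(k < K) normc (l2val (u m) k - l k) ^+ 2))).
    rewrite -big_split mulr_sumr; apply: ler_sum => k _ /=.
    by rewrite -(subrKA (l2val (u m) k)) normcD_sqr.
  have := sqr_ge0 d; rewrite -/d; lra.
have lP n : (fun k => l2val (u n) k - l k) \in l2_pred.
  by apply/asboolP; exists ((4 * n.+1%:R^-1) ^+ 2) => K; exact: tail.
have lE : l \in l2_pred.
  have -> : l = l2val (u 0%N) - (fun k => l2val (u 0%N) k - l k).
    by apply/funext => k /=; rewrite !fctE opprB addrC subrK.
  by rewrite rpredB//; exact: l2P.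
exists (L2 lE) => n.
rewrite -ler_sqr ?nnegrE ?rnorm_ge0 ?mulr_ge0// l2_rnorm_sqr.
by apply: l2rdot_le => K; exact: tail.
Qed.

Lemma l2_complete (F : set_system (l2 R)) : ProperFilter F -> cauchy F -> cvg F.
Proof.
move=> FF Fc.
(* Any two members of the filter meet, so the centres of these balls satisfy the explicit Cauchy
   rate of [l2_cauchy_lim]. *)
have ex n : exists x : l2 R, F (ball x (n.+1%:R^-1 : R)%:C%C).
  by move/cauchyP : Fc; apply; rewrite ltcR invr_gt0.
pose u n := sval (cid (ex n)).
have uF n : F (ball (u n) (n.+1%:R^-1 : R)%:C%C) by rewrite /u; case: cid.
have [m n|l lP] := @l2_cauchy_lim u.
  have [y [/ball_rnorm yn /ball_rnorm ym]] := filter_ex (filterI (uF n) (uF m)).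
  rewrite -(subrKA y) (le_trans (ler_rnormD _ _))// lerD 1?ltW//.
  by rewrite rdistC.
apply/cvg_ex; exists l; apply/cvg_ballP => e e0.
have [r er] : exists r, e = r%:C%C by apply/complex_realP/gtr0_real.
move: e0; rewrite {}er ltcR => r0.
pose n := Num.truncn (5 / r).
apply: filterS (uF n) => y /ball_rnorm uy; apply/ball_rnorm.
rewrite -(subrKA (u n)) (le_lt_trans (ler_rnormD _ _))//.
rewrite rdistC (le_lt_trans (lerD (lP n) (ltW uy)))//.
have := truncnS_gt (5 / r); rewrite -/n ltr_pdivrMr// => h.
rewrite -[X in _ + X]mul1r -mulrDl -ltr_pdivlMr ?invr_gt0// invrK mulrC.
by apply: le_lt_trans h; rewrite -natr1; lra.
Qed.

HB.instance Definition _ := Uniform_isComplete.Build (l2 R) l2_complete.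

Lemma l2_norm_dot x : `|x| ^+ 2 = l2dot x x.
Proof. by rewrite normE_rnorm -realCX l2_rnorm_sqr l2dot_diag. Qed.

HB.instance Definition _ := CompleteNormedModule_isHilbert.Build R (l2 R) l2_norm_dot.

End Completeness.

Section L2Separable.
Context {R : realType}.
Implicit Types (x y : l2 R).

Definition fin_seq (f : nat -> R[i]) (N : nat) : nat -> R[i] :=
  fun k => if (k < N)%N then f k else 0.

Lemma fin_seqP f N : fin_seq f N \in l2_pred.
Proof.
apply/asboolP; exists (\sum_(k < N) normc (f k) ^+ 2) => n.
have [nN|Nn] := leqP n N.
  rewrite /sqnorm_sum (big_ord_widen N (fun k => normc (fin_seq f N k) ^+ 2) nN).
  rewrite big_mkcond/=; apply: ler_sum => k _; rewrite /fin_seq ltn_ord.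
  by case: ifP => // _; exact: sqr_ge0.
rewrite /sqnorm_sum -(big_mkord xpredT (fun k => normc (fin_seq f N k) ^+ 2)).
have tail0 : \sum_(N <= k < n) normc (fin_seq f N k) ^+ 2 = 0.
  apply: big1_seq => k; rewrite mem_index_iota => /andP[_ /andP[Nk _]].
  by rewrite /fin_seq ifN -?leqNgt// normc0 expr0n.
rewrite (big_cat_nat (n := N)) ?(ltnW Nn)//= tail0 addr0 big_mkord.
by apply: ler_sum => k _; rewrite /fin_seq ltn_ord.
Qed.

Definition rat_point (s : seq (rat * rat)) : l2 R :=
  L2 (fin_seqP (fun k => (ratr (nth (0, 0) s k).1 +i* ratr (nth (0, 0) s k).2)%C) (size s)).

Lemma rat_close (r e : R) : 0 < e -> exists p : rat, `|r - ratr p| <= e.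
Proof.
move=> e0; have [p] : exists p : rat, r - e < ratr p < r + e.
  have /rat_in_itvoo[p] : r - e < r + e by lra.
  by rewrite in_itv/=; exists p.
by move=> /andP[h1 h2]; exists p; rewrite ler_norml; apply/andP; split; lra.
Qed.

Lemma l2_separable : separable (l2 R).
Proof.
exists (range rat_point).
  by apply: card_le_trans (card_image_le _ _) _; exact: countableP.
move=> O [x Ox] Oopen.
have /nbhs_ballP[e e0 eO] := open_nbhs_nbhs (conj Oopen Ox).
have [r er] : exists r, e = r%:C%C by apply/complex_realP/gtr0_real.
move: e0 eO; rewrite {}er /= ltcR => r0 eO.
pose d := (r / 2) ^+ 2; have d0 : 0 < d by rewrite exprn_gt0 ?divr_gt0.
have [N NP] : exists N, forall n, \sum_(k < n) normc (l2val x (N + k)) ^+ 2 <= d / 2.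
  have xlim := @l2rdot_lim R x x.
  have d2 : 0 < d / 2 by rewrite divr_gt0.
  have /cvgrPdist_le/(_ _ d2)[N _ NP] := xlim; exists N => n.
  have := NP N (leqnn N); rewrite /series/= big_mkord => h.
  have := l2rdot_partial x (N + n); rewrite big_split_ord/=.
  move: h; rewrite (eq_bigr (fun k : 'I_N => normc (l2val x k) ^+ 2)) => [|k _]; last exact: l2term_diag.
  by rewrite ler_norml => /andP[_]; lra.
(* The head then costs [d N / (N + 1)^2], which is at most [d / 2]. *)
pose e1 := r / (4 * (N%:R + 1)).
have N0 : 0 < N%:R + 1 :> R by rewrite ltr_wpDl.
have e10 : 0 < e1 by rewrite divr_gt0 ?mulr_gt0.
have app k : exists p : rat * rat, normc (l2val x k - (ratr p.1 +i* ratr p.2)%C) <= 2 * e1.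
  have [p pP] := rat_close (complex.Re (l2val x k)) e10.
  have [p' p'P] := rat_close (complex.Im (l2val x k)) e10.
  exists (p, p'); rewrite (le_trans (normc_le_ReIm _))//.
  by move: pP p'P; case: (l2val x k) => u v /= h1 h2; rewrite mulr2n mulrDl mul1r lerD.
pose s := mkseq (fun k => sval (cid (app k))) N.
have sP k : (k < N)%N ->
    normc (l2val x k - (ratr (nth (0, 0) s k).1 +i* ratr (nth (0, 0) s k).2)%C) <= 2 * e1.
  by move=> kN; rewrite nth_mkseq//; case: cid.
exists (rat_point s); split; last by exists s.
apply: eO; rewrite -ball_normE /ball_/= normE_rnorm ltcR.
suff h : rnorm (x - rat_point s) <= r / 2.
  by rewrite (le_lt_trans h)// ltr_pdivrMr// ltr_pMr// ltr1n.
rewrite -ler_sqr ?nnegrE ?rnorm_ge0 ?divr_ge0 ?(ltW r0)// l2_rnorm_sqr -/d.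
apply: l2rdot_le => n.
have lB k : l2val (x - rat_point s) k = l2val x k - l2val (rat_point s) k by [].
have tE k : l2val (x - rat_point s) (N + k) = l2val x (N + k).
  by rewrite lB /= /fin_seq size_mkseq ifN ?subr0// -leqNgt leq_addr.
have head : \sum_(k < N) normc (l2val (x - rat_point s) k) ^+ 2 <= d / 2.
  apply: (@le_trans _ _ (\sum_(k < N) (2 * e1) ^+ 2)).
    have e12 : 0 <= 2 * e1 by rewrite ltW// mulr_gt0.
    apply: ler_sum => k _; rewrite lerXn2r ?nnegrE ?normc_ge0//.
    by rewrite lB /= /fin_seq size_mkseq ltn_ord; exact: sP.
  rewrite sumr_const card_ord -[_ *+ N]mulr_natl.
  have -> : N%:R * (2 * e1) ^+ 2 = d * (N%:R / (N%:R + 1) ^+ 2).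
    by rewrite /e1 /d; field; rewrite gt_eqF.
  rewrite ler_pM2l// ler_pdivrMr ?exprn_gt0//.
  by have := ler0n R N; nra.
apply: (@le_trans _ _ (\sum_(k < N + n) normc (l2val (x - rat_point s) k) ^+ 2)).
  rewrite -(big_mkord xpredT (fun k => normc (l2val (x - rat_point s) k) ^+ 2)).
  rewrite -[leRHS](big_mkord xpredT (fun k => normc (l2val (x - rat_point s) k) ^+ 2)).
  rewrite [leRHS](big_cat_nat (n := n)) ?leq_addl//= lerDl.
  by apply: sumr_ge0 => k _; exact: sqr_ge0.
rewrite big_split_ord/= (splitr d) lerD//.
rewrite (le_trans _ (NP n))//; apply: ler_sum => k _.
by rewrite -tE.
Qed.

End L2Separable.

(** * Necessity *)

Section Diagonal.
Context {R : realType}.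
Variable m : nat -> R.
Hypothesis m01 : forall k, 0 <= m k <= 1.
Implicit Types (x y : l2 R).

Let mul_le (z : R[i]) k : normc ((m k)%:C%C * z) ^+ 2 = m k ^+ 2 * normc z ^+ 2.
Proof. by rewrite normcM normc_real exprMn real_normK ?num_real. Qed.

Let m_sqr_le1 k : m k ^+ 2 <= 1.
Proof. by have /andP[m0 m1] := m01 k; rewrite exprn_ile1. Qed.

Lemma diag_in x : (fun k => (m k)%:C%C * l2val x k) \in l2_pred.
Proof.
have [M xM] := l2val_bound x; apply/asboolP; exists M => n.
apply: (le_trans _ (xM n)); apply: ler_sum => k _.
by rewrite mul_le ler_piMl ?sqr_ge0.
Qed.

Definition diag_fun x : l2 R := L2 (diag_in x).

Lemma diag_is_linear : linear diag_fun.
Proof.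
move=> c x y; apply: val_inj; apply/funext => k /=.
by rewrite -[LHS]/((m k)%:C%C * (c * l2val x k + l2val y k)) mulrDr mulrCA.
Qed.

HB.instance Definition _ := GRing.isLinear.Build _ _ _ _ diag_fun diag_is_linear.

Definition diag : {linear l2 R -> l2 R} := diag_fun.

Lemma diagE x k : l2val (diag x) k = (m k)%:C%C * l2val x k. Proof. by []. Qed.

Lemma diag_le x : rnorm (diag x) <= rnorm x.
Proof.
rewrite -ler_sqr ?nnegrE ?rnorm_ge0// !l2_rnorm_sqr; apply: l2rdot_le => n.
apply: (le_trans _ (l2rdot_partial x n)); apply: ler_sum => k _.
by rewrite diagE mul_le ler_piMl ?sqr_ge0.
Qed.

Lemma diag_continuous : continuous diag.
Proof. by apply/linear_boundP; exists 1 => // x; rewrite mul1r diag_le. Qed.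

Lemma diag_positive : positive_op diag.
Proof.
split; first exact: diag_continuous.
move=> x; rewrite -[hdot _ _]/(l2dot (diag x) x) lecE /=; apply/andP; split.
  apply/eqP; apply: l2rdot_unique; rewrite (_ : series _ = fun=> 0); first exact: cvg_cst.
  apply/funext => n; rewrite /series/= big1// => k _; rewrite /l2term l2Z diagE.
  by case: (l2val x k) => a b /=; ring.
rewrite /l2rdot; apply: limr_ge; first exact: l2rdot_cvg.
apply: nearW => n; rewrite /series/=; apply: sumr_ge0 => k _; rewrite /l2term diagE.
have /andP[m0 _] := m01 k; case: (l2val x k) => a b /=.
have -> : (m k * a - 0 * b) * a - (m k * b + 0 * a) * - b = m k * (a ^+ 2 + b ^+ 2) by ring.
by rewrite mulr_ge0// addr_ge0 ?sqr_ge0.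
Qed.

Lemma diag_contraction x : rdot (diag x) x <= rnorm x ^+ 2.
Proof. by rewrite (le_trans (ler_rdot _ _))// expr2 ler_wpM2r ?rnorm_ge0 ?diag_le. Qed.

Definition l2basis k : l2 R := L2 (fin_seqP (fun j => (j == k)%:R) k.+1).

Lemma l2basisE k j : l2val (l2basis k) j = (j == k)%:R.
Proof.
rewrite /= /fin_seq; case: ifP => // /negbT; rewrite -leqNgt => kj.
by rewrite gtn_eqF.
Qed.

Lemma rnorm_l2basis k : rnorm (l2basis k) = 1.
Proof.
rewrite l2_rnormE -[RHS]sqrtr1; congr Num.sqrt; apply/eqP; rewrite eq_le; apply/andP; split.
  apply: l2rdot_le => n; rewrite (eq_bigr (fun j : 'I_n => (j == k :> nat)%:R)) => [|j _].
    case: (ltnP k n) => kn; last by rewrite big1// => j _; rewrite ltn_eqF// (leq_trans _ kn).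
    rewrite (bigD1 (Ordinal kn))//= eqxx big1 ?addr0// => j jk.
    by rewrite (_ : (j == k :> nat) = false)//; apply/negbTE.
  by rewrite l2basisE; case: eqP => _; rewrite ?normc1 ?normc0 ?expr1n ?expr0n.
rewrite (le_trans _ (l2coord_le _ k))// l2basisE eqxx normc1 expr1n.
by [].
Qed.

Lemma diag_basis k : diag (l2basis k) = (m k)%:C%C *: l2basis k.
Proof.
apply: val_inj; apply/funext => j; rewrite [LHS]diagE [RHS]l2Z !l2basisE.
by case: eqP => [->//|_]; rewrite !mulr0.
Qed.

Lemma op_powR_diag_basis k t : 0 <= t -> op_powR diag t (l2basis k) = (m k `^ t)%:C%C *: l2basis k.
Proof.
rewrite /op_powR le_eqVlt eq_sym; case: eqP => [->|_] /=.
  (* The convention that [0] to the power [0] is [1] agrees with [A^0 = I]; this is the case that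
     makes time [0] visible. *)
  by move=> _; rewrite powRr0 scale1r.
move=> t0; apply: (fcalc_eigen diag_positive diag_contraction (cont01_powR t0) (m01 k)).
exact: diag_basis.
Qed.

End Diagonal.

(** * The diagonal test pair *)

Section Example.
Context {R : realType}.
Implicit Types (x : l2 R) (T : set R).

(* Chosen so that [lam k `^ (2 t) = 2 `^ (- t / k)] for [k > 0]: the observation of the
   [k]-th basis vector weighs the times of order [k]. *)
Definition lam (k : nat) : R := if k == 0%N then 0 else 2 `^ (- (2 * k%:R)^-1).
Definition gam (k : nat) : R := Num.sqrt (1 - lam k ^+ 2).

Lemma lam_lt1 k : 0 <= lam k < 1.
Proof.
rewrite /lam; case: eqP => [_|/eqP k0]; first by rewrite lexx ltr01.
rewrite powR_ge0/= /powR pnatr_eq0/= -[ltRHS]expR0 ltr_expR mulNr oppr_lt0.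
have k0R : 0 < k%:R :> R by rewrite ltr0n lt0n.
by apply: mulr_gt0; [rewrite invr_gt0 mulr_gt0|rewrite ln_gt0 ?ltr1n].
Qed.

Lemma lam01 k : 0 <= lam k <= 1.
Proof. by have /andP[-> /ltW] := lam_lt1 k. Qed.

Lemma gam_sqr k : gam k ^+ 2 = 1 - lam k ^+ 2.
Proof.
by rewrite sqr_sqrtr// subr_ge0; have /andP[h1 h2] := lam01 k; rewrite exprn_ile1.
Qed.

Lemma gam01 k : 0 <= gam k <= 1.
Proof.
rewrite sqrtr_ge0/= -ler_sqr ?nnegrE ?sqrtr_ge0// gam_sqr expr1n.
by rewrite gerBl sqr_ge0.
Qed.

Let A := diag lam01.
Let C := diag gam01.

Lemma gam_lam_sqr x : rnorm (C x) ^+ 2 = rnorm x ^+ 2 - rnorm (A x) ^+ 2.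
Proof.
rewrite !l2_rnorm_sqr; apply: l2rdot_unique.
rewrite (_ : series _ = series (l2term x x) - series (l2term (A x) (A x))).
  by apply: cvgB; exact: l2rdot_lim.
apply/funext => n; rewrite /GRing.add/= /GRing.opp/= /series/= -sumrB; apply: eq_bigr => k _.
rewrite !l2term_diag !diagE !normcM !exprMn !normc_real !real_normK ?num_real// gam_sqr.
ring.
Qed.

(** Telescoping of [||C y||^2 = ||y||^2 - ||A y||^2] along the orbit of [x]. *)
Lemma sum_gam_lam x N :
  \sum_(n < N) rnorm (C (iter n A x)) ^+ 2 = rnorm x ^+ 2 - rnorm (iter N A x) ^+ 2.
Proof.
elim: N => [|N IH]; first by rewrite big_ord0 subrr.
rewrite big_ord_recr IH (gam_lam_sqr (iter N A x)) iterS.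
move: (rnorm x ^+ 2) (rnorm (iter N A x) ^+ 2) (rnorm (A (iter N A x)) ^+ 2) => a b c.
exact: subrKA.
Qed.

Lemma iter_lam x n k : l2val (iter n A x) k = (lam k ^+ n)%:C%C * l2val x k.
Proof.
elim: n => [|n IH]; first by rewrite expr0 mul1r.
by rewrite iterS diagE IH exprS realCM mulrA.
Qed.

(** The entries [lam k] approach [1], so the decay is not uniform in [k]: the first [K] coordinates
    decay geometrically, and the tail of [x] is small already and does not grow. *)
Lemma lam_stable x (e : R) : 0 < e -> exists N, rnorm (iter N A x) ^+ 2 <= e.
Proof.
move=> e0; have e2 : 0 < e / 2 by rewrite divr_gt0.
have /cvgrPdist_le/(_ _ e2)[K _ KP] := @l2rdot_lim R x x.
have := KP K (leqnn K); rewrite /series/= big_mkord.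
rewrite (eq_bigr (fun k : 'I_K => normc (l2val x k) ^+ 2)) => [|k _]; last exact: l2term_diag.
rewrite ler_norml => /andP[_ tail].
pose d := e / (2 * (l2rdot x x + 1)).
have x1 : 0 < l2rdot x x + 1 by rewrite ltr_wpDl ?l2rdot_ge0.
have d0 : 0 < d by rewrite divr_gt0 ?mulr_gt0.
have [N NP] : exists N, forall k, (k < K)%N -> lam k ^+ N <= d.
  suff [N NP] : exists N, forall n k, (N <= n)%N -> (k < K)%N -> lam k ^+ n <= d.
    by exists N => k; apply: NP.
  elim: (K) => [|L [N NP]]; first by exists 0%N.
  have /andP[l0 l1] := lam_lt1 L; have [N' N'P] := expr_small l0 l1 d0.
  exists (maxn N N') => n k; rewrite geq_max => /andP[Nn N'n].
  by rewrite ltnS leq_eqVlt => /predU1P[->|kL]; [exact: N'P|exact: NP].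
exists N; rewrite l2_rnorm_sqr; apply: l2rdot_le => n.
pose f k := normc (l2val x k) ^+ 2; pose h k := normc (l2val (iter N A x) k) ^+ 2.
have hf k : h k <= f k.
  rewrite /h iter_lam normcM normc_real exprMn real_normK ?num_real//.
  have /andP[l0 l1] := lam01 k.
  by rewrite ler_piMl ?sqr_ge0// !exprn_ile1// exprn_ge0.
have hd k : (k < K)%N -> h k <= d * f k.
  move=> kK; rewrite /h iter_lam normcM normc_real exprMn real_normK ?num_real//.
  have /andP[l0 l1] := lam01 k.
  rewrite ler_wpM2r ?sqr_ge0// expr2 (le_trans _ (NP k kK))// ler_piMl ?exprn_ge0//.
  exact: exprn_ile1.
apply: (@le_trans _ _ (\sum_(k < K + n) h k)).
  rewrite -(big_mkord xpredT h) -[leRHS](big_mkord xpredT h).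
  rewrite [leRHS](big_cat_nat (n := n)) ?leq_addl//= lerDl.
  by apply: sumr_ge0 => k _; exact: sqr_ge0.
rewrite big_split_ord/= (splitr e) lerD//.
  apply: (@le_trans _ _ (d * \sum_(k < K) f k)).
    by rewrite mulr_sumr; apply: ler_sum => k _; exact: hd.
  rewrite (le_trans (ler_wpM2l (ltW d0) (l2rdot_partial x K)))//.
  rewrite /d mulrAC ler_pdivrMr ?mulr_gt0//.
  by have := ltW e0; have := l2rdot_ge0 x; nra.
apply: (@le_trans _ _ (\sum_(k < n) f (K + k)%N)); first by apply: ler_sum => k _; exact: hf.
have := l2rdot_partial x (K + n); rewrite big_split_ord/= /f; lra.
Qed.

Lemma lam_observable : exactly_observable C A (range (fun n : nat => n%:R)).
Proof.
have Apos := diag_positive lam01.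
exists 1, 1; split => // x; rewrite mul1r.
pose V (t : R) := rnorm (C (op_powR A t x)) ^+ 2.
have V0 t : 0 <= V t by exact: sqr_ge0.
have VN N : \sum_(n < N) V n%:R = rnorm x ^+ 2 - rnorm (iter N A x) ^+ 2.
  by rewrite -sum_gam_lam; apply: eq_bigr => n _; rewrite /V op_powR_nat.
apply/andP; split; last first.
  by apply: (esum_nats_le V0) => N; rewrite VN gerBl sqr_ge0.
apply/lee_addgt0Pr => e e0; have [N NP] := lam_stable x e0.
rewrite -leeBlDr// -EFinB (le_trans _ (esum_nats_ge N V0))// lee_fin VN.
by rewrite lerD2l lerN2.
Qed.

Lemma basis_observation k t : 0 <= t ->
  rnorm (C (op_powR A t (l2basis k))) ^+ 2 = (1 - lam k ^+ 2) * (lam k `^ t) ^+ 2.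
Proof.
move=> t0; rewrite op_powR_diag_basis// linearZ/= rnormZ normc_real.
rewrite -[diag_fun _ _]/(C (l2basis k)) diag_basis rnormZ normc_real rnorm_l2basis mulr1.
by rewrite exprMn !real_normK ?num_real// gam_sqr mulrC.
Qed.

End Example.

(** * Bounds for the density of a universal time set *)

Section Necessity.
Context {R : realType}.
Implicit Types (T : set R) (k : nat).

Definition weight k (t : R) : R := 2 `^ (- (t / k%:R)).

Lemma weight_ge0 k t : 0 <= weight k t. Proof. exact: powR_ge0. Qed.

Lemma weight_mono k s t : s <= t -> weight k t <= weight k s.
Proof.
by move=> st; rewrite ler_powR ?ler1n// lerN2 ler_wpM2r ?invr_ge0.
Qed.

Lemma weight_nat k j : (0 < k)%N -> weight k (j%:R * k%:R) = 2 ^- j.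
Proof.
by move=> k0; rewrite /weight mulfK ?pnatr_eq0 -?lt0n// powRN powR_mulrn.
Qed.

Lemma lam_powR k t : (0 < k)%N -> (lam k `^ t) ^+ 2 = weight k t.
Proof.
move=> k0; rewrite /lam /weight (gtn_eqF k0) -powRrM -powR_mulrn ?powR_ge0// -powRrM.
congr (2 `^ _); field; by rewrite pnatr_eq0 -lt0n.
Qed.

(** For [u = lam k ^+ 2] one has [u^k = 1/2], so [1/2 = (1 - u) \sum_(i < k) u^i], with all terms of
    the sum between [1/2] and [1]. *)
Lemma lam_gap k : (0 < k)%N -> (2 * k%:R)^-1 <= 1 - (lam k : R) ^+ 2 <= k%:R^-1.
Proof.
move=> k0; have k0R : 0 < k%:R :> R by rewrite ltr0n.
have /andP[l0 l1] := lam_lt1 (R := R) k.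
have m0 : 0 <= lam k ^+ 2 :> R by rewrite sqr_ge0.
have m1 : lam k ^+ 2 <= 1 :> R by rewrite exprn_ile1// ltW.
have mk : (lam k ^+ 2) ^+ k = 2^-1 :> R.
  rewrite exprAC -(powR_mulrn k)// lam_powR// -[k%:R]mul1r (weight_nat 1 k0)//.
have := subrX1 (lam k ^+ 2 : R) k; rewrite mk.
have : k%:R / 2 <= \sum_(i < k) (lam k ^+ 2) ^+ i :> R.
  rewrite -[k in k%:R]card_ord mulr_natl -sumr_const; apply: ler_sum => i _.
  by rewrite -mk ler_wiXn2l// ltnW.
have : \sum_(i < k) (lam k ^+ 2) ^+ i <= k%:R :> R.
  rewrite -[k in k%:R]card_ord -[_%:R]sumr_const; apply: ler_sum => i _.
  exact: exprn_ile1.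
move: (\sum_(i < k) _) => s sk ks h.
have {}h : (1 - lam k ^+ 2) * s = 2^-1 by lra.
rewrite invfM; apply/andP; split.
  by rewrite ler_pdivrMr// -h ler_wpM2l// subr_ge0.
rewrite -[leRHS]mul1r ler_pdivlMr//; nra.
Qed.

Lemma count_le T (X : set R) (r : R) : finite_set (T `&` `[0, r]) -> X `<=` T `&` `[0, r] ->
  (#|` fset_set X|)%fset%:R <= (counting_fun T r)%:R :> R.
Proof.
move=> Tfin XT; have Xfin := sub_finite_set XT Tfin.
rewrite -[leLHS]mulr1 -[leRHS]mulr1 -!fsum_cst//; exact: fsum_subset.
Qed.

(** Between [j k] and [(j+1) k] the weight is at most [2^-j], and the number of points is crudely
    bounded by all those up to [(j+1) k]. The bracket is the exact value of
    [\sum_(j <= J) (j+1) / 2^j]. *)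
Lemma sum_weight_le T (e : R) k J : locally_finite T -> (0 < k)%N ->
  (forall r : R, k%:R <= r -> (counting_fun T r)%:R <= e * r) ->
  \sum_(t \in T `&` `[0, J.+1%:R * k%:R]) weight k t <=
  e * k%:R * (4 - (J%:R + 3) / 2 ^+ J).
Proof.
move=> Tfin k0 Te; have k0R : 0 < k%:R :> R by rewrite ltr0n.
have cJ j : locally_finite T -> finite_set (T `&` `[0, j.+1%:R * k%:R]).
  by apply; rewrite mulr_gt0.
have bound j (X : set R) (c : R) : X `<=` T `&` `[0, j.+1%:R * k%:R] -> 0 <= c ->
    (forall t, X t -> weight k t <= c) ->
    \sum_(t \in X) weight k t <= e * (j.+1%:R * k%:R) * c.
  move=> XT c0 Xc; have Xfin := sub_finite_set XT (cJ j Tfin).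
  apply: (@le_trans _ _ (\sum_(t \in X) c)).
    rewrite !fsbig_finite// big_seq [leRHS]big_seq.
    by apply: ler_sum => t; rewrite in_fset_set// inE; exact: Xc.
  rewrite fsum_cst// ler_wpM2r// (le_trans (count_le (cJ j Tfin) XT))// Te//.
  by rewrite ler_peMl ?(ltW k0R)// ler1n.
elim: J => [|J IH].
  rewrite (le_trans (bound 0%N _ 1 _ _ _))//.
    move=> t /segmentE[_ /andP[t0 _]].
    by have := weight_mono k t0; rewrite {2}/weight mul0r oppr0 powRr0.
  by rewrite expr0; lra.
have JJ : J.+1%:R * k%:R <= J.+2%:R * k%:R :> R by rewrite ler_pM2r// ler_nat.
have JJ0 : 0 <= J.+1%:R * k%:R :> R by rewrite mulr_ge0.
have -> : T `&` `[0, J.+2%:R * k%:R] =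
    (T `&` `[0, J.+1%:R * k%:R]) `|` window T (J.+1%:R * k%:R) (J.+2%:R * k%:R).
  apply/seteqP; split => t.
    move=> /segmentE[Tt /andP[t0 tc]].
    have [ta|at_] := leP t (J.+1%:R * k%:R); [left|right].
      by apply/segmentE; rewrite t0.
    by apply/windowE; rewrite at_.
  move=> [/segmentE|/windowE] [Tt /andP[h1 h2]]; apply/segmentE; split=> //.
    by rewrite h1 (le_trans h2).
  by rewrite h2 (ltW (le_lt_trans JJ0 h1)).
rewrite fsbigU0//; [|exact: cJ|exact: finite_window|]; last first.
  move=> t [/segmentE[_ /andP[_ t1]] /windowE[_ /andP[t2 _]]].
  by have := lt_le_trans t2 t1; rewrite ltxx.
have h : \sum_(t \in window T (J.+1%:R * k%:R) (J.+2%:R * k%:R)) weight k t <=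
    e * (J.+2%:R * k%:R) * 2 ^- J.+1.
  apply: bound => [t /windowE[Tt /andP[t1 t2]]||t /windowE[_ /andP[t1 _]]].
  - by apply/segmentE; rewrite t2 (ltW (le_lt_trans JJ0 t1)).
  - by rewrite invr_ge0 exprn_ge0.
  - by rewrite -(weight_nat _ k0); exact/weight_mono/ltW.
apply: (le_trans (lerD IH h)).
have e1 : J.+1%:R = J%:R + 1 :> R by rewrite natr1.
have e2 : J.+2%:R = J%:R + 2 :> R by rewrite -addn2 natrD.
rewrite le_eqVlt; apply/orP; left; apply/eqP; rewrite e2 e1 exprS.
by field; rewrite expf_neq0.
Qed.

Let A := diag (@lam01 R).
Let C := diag (@gam01 R).

Let V k t := rnorm (C (op_powR A t (l2basis k))) ^+ 2.

Lemma universal_esum_basis T : universal_time_set T ->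
  exists a b : R, [/\ 0 < a, a <= b & forall k,
    (a%:E <= \esum_(t in T) (V k t)%:E <= b%:E)%E].
Proof.
move=> [_ _ univ].
have [a [b [a0 ab obs]]] := univ _ _ A C (@l2_separable R) (@l2_separable R)
  (diag_positive (@lam01 R)) (@diag_continuous R _ (@gam01 R)) (@lam_observable R).
exists a, b; split => // k; have := obs (l2basis k).
by rewrite rnorm_l2basis expr1n !mulr1.
Qed.

(** As [lam 0 = 0], the basis vector of index [0] lies in the kernel of [A] and is observed at time
    [0] only. *)
Lemma universal_zero T : universal_time_set T -> T 0.
Proof.
move=> Tuniv; have [T_ge0 _ _] := Tuniv.
have [a [b [a0 ab /(_ 0%N) /andP[obs _]]]] := universal_esum_basis Tuniv.
apply: contrapT => T0; move: obs; rewrite esum1 ?lee_fin ?leNgt ?a0// => t Tt.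
have := T_ge0 _ Tt; rewrite /= in_itv/= andbT => t0.
rewrite /V basis_observation// powR0 ?expr0n ?mulr0//.
by apply: contraPneq Tt => ->.
Qed.

Lemma universal_density_lty T (d : \bar R) : universal_time_set T ->
  ((counting_fun T r)%:R / r)%:E @[r --> +oo] --> d -> (d < +oo)%E.
Proof.
move=> Tuniv; have [T_ge0 Tfin _] := Tuniv.
have [a [b [a0 ab obs]]] := universal_esum_basis Tuniv.
rewrite ltey; move=> Td; apply/eqP => dy; move: Td; rewrite dy.
(* Times up to [k] have weight at least [1/2] and the gap is at least [1 / (2 k)], so at most
   [4 b k] of them are compatible with the upper bound [b]. *)
move=> /cvgeyPge/(_ (4 * b + 1))[M [_ MP]].
pose k := (Num.truncn (Num.max M 0)).+1.
have Mk : M < k%:R by rewrite (le_lt_trans _ (truncnS_gt _))// le_max lexx.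
have k0 : 0 < k%:R :> R by [].
have kn0 : (0 < k)%N by [].

have := MP _ Mk; rewrite /= lee_fin ler_pdivlMr// => Nk.
have kfin := Tfin _ k0; have /andP[_] := obs k.
suff : ((4 * k%:R)^-1 * (counting_fun T k%:R)%:R <= b) -> False.
  move=> h ub; apply: h; rewrite -lee_fin (le_trans _ ub)//.
  apply: (@le_trans _ _ (\sum_(t \in T `&` `[0, k%:R]) V k t)%:E).
    rewrite lee_fin mulrC -fsum_cst// !fsbig_finite// big_seq [leRHS]big_seq.
    apply: ler_sum => t; rewrite in_fset_set// inE => /segmentE[_ /andP[t0 tk]].
    rewrite /V basis_observation// lam_powR//.
    have /andP[lk _] := lam_gap kn0.
    have := weight_mono k tk; rewrite -[k%:R]mul1r (weight_nat 1 kn0) expr1 => wt.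
    rewrite (_ : (4 * _)^-1 = (2 * k%:R)^-1 * 2^-1); last by field; rewrite gt_eqF.
    by rewrite ler_pM// invr_ge0 ?mulr_ge0.
  by rewrite -fsumEFin//; apply: esum_ge; exists (T `&` `[0, k%:R]).
rewrite mulrC ler_pdivrMr ?mulr_gt0//; nra.
Qed.

Lemma universal_density_gt0 T (d : \bar R) : universal_time_set T ->
  ((counting_fun T r)%:R / r)%:E @[r --> +oo] --> d -> (0 < d)%E.
Proof.
move=> Tuniv Td; have [T_ge0 Tfin _] := Tuniv.
have [a [b [a0 ab obs]]] := universal_esum_basis Tuniv.
(* The gap is at most [1 / k] and the weights sum to at most [4 e k], so the observation is at most
   [4 e = a / 2], below the lower bound [a]. *)
rewrite ltNge; apply/negP => d0; pose e := a / 8.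
have e0 : 0 < e by rewrite divr_gt0.
have de : (d < e%:E)%E by rewrite (le_lt_trans d0).
have [M [_ MP]] := Td _ (open_ereal_lt' de).
pose k := (Num.truncn (Num.max M 0)).+1.
have Mk : M < k%:R by rewrite (le_lt_trans _ (truncnS_gt _))// le_max lexx.
have k0 : 0 < k%:R :> R by [].
have kn0 : (0 < k)%N by [].

have Te (r : R) : k%:R <= r -> (counting_fun T r)%:R <= e * r.
  move=> kr; have := MP _ (lt_le_trans Mk kr); rewrite /= lte_fin ltr_pdivrMr.
    exact: ltW.
  exact: lt_le_trans kr.
have /andP[+ _] := obs k; apply/negP; rewrite -ltNge.
apply: (@le_lt_trans _ _ (4 * e)%:E); last by rewrite lte_fin /e; lra.
apply: ge_ereal_sup => _ [X [Xfin XT] <-]; rewrite fsumEFin// lee_fin.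
have [J JP] := finite_set_bounded Xfin.
have XJ : X `<=` T `&` `[0, (2 ^ J).+1%:R * k%:R].
  move=> t Xt; have Tt := XT _ Xt; have := T_ge0 _ Tt.
  rewrite /= in_itv/= andbT => t0; apply/segmentE; rewrite t0; split => //.
  rewrite (le_trans (JP _ Xt))// -natrX -natrM ler_nat.
  by rewrite (leq_trans (leqnSn _))// leq_pmulr.
have JX := Tfin _ (mulr_gt0 (ltr0Sn R (2 ^ J)) k0).
have -> : \sum_(t \in X) V k t = (1 - lam k ^+ 2) * \sum_(t \in X) weight k t.
  rewrite !fsbig_finite// mulr_sumr big_seq [RHS]big_seq.
  apply: eq_bigr => t; rewrite in_fset_set// inE => Xt.
  have := T_ge0 _ (XT _ Xt); rewrite /= in_itv/= andbT => t0.
  by rewrite /V basis_observation// lam_powR.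
have /andP[l0 lk] := lam_gap kn0.
have s0 : 0 <= \sum_(t \in X) weight k t by apply: fsumr_ge0 => t _; exact: weight_ge0.
have s1 : \sum_(t \in X) weight k t <= e * k%:R * 4.
  rewrite (le_trans (fsum_subset (weight_ge0 k) JX XJ))//.
  rewrite (le_trans (sum_weight_le _ Tfin kn0 Te))//.
  by rewrite ler_pM2l ?mulr_gt0// gerBl divr_ge0 ?addr_ge0 ?exprn_ge0.
have -> : 4 * e = k%:R^-1 * (e * k%:R * 4) by field; rewrite gt_eqF.
by rewrite ler_pM// (le_trans _ l0)// invr_ge0 mulr_ge0.
Qed.

End Necessity.

Theorem theorem4p4 (R : realType) (T : set R) (d : \bar R)
    (T_ge0 : T `<=` `[0, +oo[) (T_locfin : locally_finite T)
    (T_density : ((counting_fun T r)%:R / r)%:E @[r --> +oo] --> d) :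
  universal_time_set T <-> T 0 /\ (0 < d < +oo)%E.
Proof.
split => [Tuniv|[T0 /andP[d0 dy]]].
  split; first exact: universal_zero.
  by rewrite (universal_density_gt0 Tuniv T_density) (universal_density_lty Tuniv T_density).
case: d d0 dy T_density => [d| |]// d0 _ T_density.
split => // H Y A C _ _ Apos Ccont; have Td : has_density T d by [].
exact: (density_observable Td d0 T0 Apos Ccont).
Qed.
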